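(* For any combinatorial mutation from a Fano polygon $P$ to a Fano polygon $P'$ there is a flat family $\mathcal X\to\mathbf C^2$ such that the fibre over $0$ is $X_P$ and the fibre over $\infty$ is $X_{P'}$, where $0,\infty\in\mathbf P^1=(\mathbf C^2\setminus\{0\})/\mathbf C^\times$; that is, with coordinates $(\alpha,\beta)$ on $\mathbf C^2$, the fibre over every point $(0,\beta)$ with $\beta\neq0$ is isomorphic to $X_P$ and the fibre over every point $(\alpha,0)$ with $\alpha\ne0$ is isomorphic to $X_{P'}$.
   Context: $N\cong\mathbf Z^2$, $M=\operatorname{Hom}(N,\mathbf Z)$. A polygon $P\subset N_{\mathbf R}$ is Fano if its vertices are primitive lattice points and the origin lies in its interior. $X_P$ is the complex projective toric surface whose fan is the spanning fan of $P$ (cones over the faces of $P$). Combinatorial mutation: let $w\in M$ be primitive and $F=\operatorname{conv}(0,f)$ with $f\in N$ a primitive generator of $w^\perp$. For $h\in\mathbf Z$ let $w_h(P)=\operatorname{conv}\{p\in P\cap N: w(p)=h\}$. Suppose for each $h<0$ there is a (possibly empty) lattice polytope $G_h$ with $\{p\in\operatorname{Vert}(P):w(p)=h\}\subseteq G_h+|h|F\subseteq w_h(P)$. Then the mutation of $P$ with respect to $(w,F)$ is $P'=\operatorname{conv}\big(\bigcup_{h<0}G_h\cup\bigcup_{h\ge0}(w_h(P)+hF)\big)$, which is again a Fano polygon. On the polar polygons $Q=\{u:\langle u,p\rangle\ge-1\ \forall p\in P\}$ and $Q'$ (defined likewise from $P'$) it induces the piecewise linear map $u\mapsto u-\min(0,\langle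 u,f\rangle)\,w$ taking $Q$ to $Q'$. *)

(* Defs.v *)
From HB Require Import structures.
From mathcomp Require Import all_boot all_order all_algebra.
From mathcomp Require Import all_classical all_reals all_analysis.
From mathcomp.real_closed Require Export complex.
From mathcomp Require Import -(notations) mpoly.
Import Order.TTheory GRing.Theory Num.Theory.
Import numFieldNormedType.Exports.

Set Implicit Arguments.
Unset Strict Implicit.
Unset Printing Implicit Defensive.

Local Open Scope classical_set_scope.
Local Open Scope ring_scope.

(* Schemes over a field k are handled through their functors of points on
   commutative k-algebras.  A [comAlgType k] is by definition a nonzero ring;
   nothing is lost, since the zero algebra has exactly one point in every
   Zariski sheaf. *)

Record kfunctor (k : fieldType) := KFunctor {
  pts :> comAlgType k -> Type;
  kmap : forall A B : comAlgType k, {lrmorphism A -> B} -> pts A -> pts B;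
  kmap_id : forall (A : comAlgType k) (f : {lrmorphism A -> A}) (x : pts A),
    f =1 id -> kmap f x = x;
  kmap_comp : forall (A B D : comAlgType k) (f : {lrmorphism A -> B})
      (g : {lrmorphism B -> D}) (h : {lrmorphism A -> D}) (x : pts A),
    h =1 g \o f -> kmap h x = kmap g (kmap f x) }.
Arguments kmap {k} X {A B} f x : rename.

Record kmor (k : fieldType) (X Y : kfunctor k) := KMor {
  kapp :> forall A : comAlgType k, X A -> Y A;
  kapp_nat : forall (A B : comAlgType k) (f : {lrmorphism A -> B}) (x : X A),
    kapp (kmap X f x) = kmap Y f (kapp x) }.
Arguments kapp {k X Y} _ {A} x.

Lemma lrmorphism_ext (k : fieldType) (A B : comAlgType k)
  (f g : {lrmorphism A -> B}) : f =1 g -> f = g.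
Proof.
case: f g => f [[f1] [f2] [f3]] [g [[g1] [g2] [g3]]] /= fg.
have {}fg : f = g by apply/funext.
by subst g; congr GRing.LRMorphism.Pack; congr GRing.LRMorphism.Class;
  congr (_ _); exact: Prop_irrelevance.
Qed.

Lemma sval_inj_prop (T : Type) (Q : T -> Prop) (x y : {t | Q t}) :
  sval x = sval y -> x = y.
Proof. exact: eq_sig_hprop (fun _ => @Prop_irrelevance _) x y. Qed.

Section SpecFunctor.
Variables (k : fieldType) (A : comAlgType k).

Definition Spec_map (B D : comAlgType k) (f : {lrmorphism B -> D})
  (x : {lrmorphism A -> B}) : {lrmorphism A -> D} := f \o x.

Lemma Spec_map_id (B : comAlgType k) (f : {lrmorphism B -> B}) x :
  f =1 id -> Spec_map f x = x.
Proof. by move=> fid; apply: lrmorphism_ext => a /=; rewrite fid. Qed.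

Lemma Spec_map_comp (B D E : comAlgType k) (f : {lrmorphism B -> D})
    (g : {lrmorphism D -> E}) (h : {lrmorphism B -> E}) x :
  h =1 g \o f -> Spec_map h x = Spec_map g (Spec_map f x).
Proof. by move=> hgf; apply: lrmorphism_ext => a /=; rewrite hgf. Qed.

Definition Spec : kfunctor k := KFunctor Spec_map_id Spec_map_comp.

End SpecFunctor.

Section Product.
Variables (k : fieldType) (X Y : kfunctor k).

Definition prod_map (A B : comAlgType k) (f : {lrmorphism A -> B})
  (p : X A * Y A) : X B * Y B := (kmap X f p.1, kmap Y f p.2).

Lemma prod_map_id (A : comAlgType k) (f : {lrmorphism A -> A}) p :
  f =1 id -> prod_map f p = p.
Proof. by case: p => x y fid; rewrite /prod_map !kmap_id. Qed.

Lemma prod_map_comp (A B D : comAlgType k) (f : {lrmorphism A -> B})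
    (g : {lrmorphism B -> D}) (h : {lrmorphism A -> D}) p :
  h =1 g \o f -> prod_map h p = prod_map g (prod_map f p).
Proof. by move=> e; rewrite /prod_map /= -!(kmap_comp _ e). Qed.

Definition kprod : kfunctor k :=
  @KFunctor k (fun A => X A * Y A)%type prod_map prod_map_id prod_map_comp.

Lemma kpair_nat (Z : kfunctor k) (f : kmor Z X) (g : kmor Z Y)
    (A B : comAlgType k) (h : {lrmorphism A -> B}) (z : Z A) :
  (f _ (kmap Z h z), g _ (kmap Z h z)) = kmap kprod h (f _ z, g _ z).
Proof. by rewrite !kapp_nat. Qed.

Definition kpair (Z : kfunctor k) (f : kmor Z X) (g : kmor Z Y) :
  kmor Z kprod := @KMor k Z kprod (fun A z => (f _ z, g _ z)) (kpair_nat f g).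

End Product.

Section Submodules.
Variables (A : comNzRingType) (V : lmodType A).

Definition submodule (W : set V) : Prop :=
  W 0 /\ forall (c : A) (u v : V), W u -> W v -> W (c *: u + v).

Definition span (G : set V) : set V :=
  [set v | forall W : set V, submodule W -> G `<=` W -> W v].

Lemma sub_span G : G `<=` span G.
Proof. by move=> v Gv W _; apply. Qed.

Lemma span_sub G W : submodule W -> G `<=` W -> span G `<=` W.
Proof. by move=> Wsub GW v; apply. Qed.

Lemma span_submodule G : submodule (span G).
Proof.
split=> [W [] //|c u v Gu Gv W Wsub GW].
by apply: Wsub.2; [exact: Gu|exact: Gv].
Qed.

End Submodules.

Definition ideal_gen (A : comNzRingType) (G : set A) : set A :=
  span (G : set A^o).

(* The locus of Spec A where G generates the unit ideal is an arbitrary open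
   subset, and the locus where G vanishes an arbitrary closed subscheme. *)
Definition open_immersion (k : fieldType) (U X : kfunctor k) (j : kmor U X) :
  Prop :=
  (forall A : comAlgType k, injective (@kapp k U X j A)) /\
  forall (A : comAlgType k) (x : X A), exists G : set A,
    forall (B : comAlgType k) (f : {lrmorphism A -> B}),
      (exists u : U B, j _ u = kmap X f x) <-> ideal_gen (f @` G) 1.

Definition closed_immersion (k : fieldType) (Z X : kfunctor k)
  (j : kmor Z X) : Prop :=
  (forall A : comAlgType k, injective (@kapp k Z X j A)) /\
  forall (A : comAlgType k) (x : X A), exists G : set A,
    forall (B : comAlgType k) (f : {lrmorphism A -> B}),
      (exists z : Z B, j _ z = kmap X f x) <-> (forall a, G a -> f a = 0).

Definition is_field (A : comNzRingType) : Prop :=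
  forall x : A, x != 0 -> exists y : A, x * y = 1.

Definition open_cover (k : fieldType) (X : kfunctor k) (I : Type)
  (U : I -> kfunctor k) (j : forall i, kmor (U i) X) : Prop :=
  (forall i, open_immersion (j i)) /\
  forall K : comAlgType k, is_field K ->
    forall x : X K, exists (i : I) (u : U i K), j i _ u = x.

Definition is_localization (k : fieldType) (A B : comAlgType k) (r : A)
  (f : {lrmorphism A -> B}) : Prop :=
  [/\ exists s : B, f r * s = 1,
      forall b : B, exists (a : A) (m : nat), f r ^+ m * b = f a &
      forall a : A, f a = 0 -> exists m : nat, r ^+ m * a = 0].

(* Maps B_i -> D <- B_j under A are the same as maps from A[1/(r_i r_j)], so
   the hypothesis on xs is agreement on the overlaps. *)
Definition zariski_sheaf (k : fieldType) (X : kfunctor k) : Prop :=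
  forall (A : comAlgType k) (n : nat) (r : 'I_n -> A)
      (B : 'I_n -> comAlgType k) (f : forall i, {lrmorphism A -> B i})
      (xs : forall i, X (B i)),
    ideal_gen (range r) 1 ->
    (forall i, is_localization (r i) (f i)) ->
    (forall i j (D : comAlgType k) (g : {lrmorphism B i -> D})
        (h : {lrmorphism B j -> D}),
      g \o f i =1 h \o f j -> kmap X g (xs i) = kmap X h (xs j)) ->
    exists! x : X A, forall i, kmap X (f i) x = xs i.

Definition is_scheme (k : fieldType) (X : kfunctor k) : Prop :=
  zariski_sheaf X /\
  exists (I : Type) (A : I -> comAlgType k) (j : forall i, kmor (Spec (A i)) X),
    open_cover j.

(* Sum of the pure tensors p.1 (x) p.2 over p in s is zero in N (x)_B A, where
   A is a B-module through f: by the universal property of the tensor product,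
   all bilinear maps vanish on it. *)
Definition tensor_eq0 (B A : comNzRingType) (f : B -> A) (N : lmodType B)
  (s : seq (N * A)) : Prop :=
  forall (Z : lmodType B) (b : N -> A -> Z),
    (forall a m n, b (m + n) a = b m a + b n a) ->
    (forall n a a', b n (a + a') = b n a + b n a') ->
    (forall c n a, b (c *: n) a = c *: b n a) ->
    (forall c n a, b n (f c * a) = c *: b n a) ->
    \sum_(p <- s) b p.1 p.2 = 0.

(* N (x)_B A -> N' (x)_B A is injective for every injective g : N -> N'. *)
Definition flat_algebra (B A : comNzRingType) (f : B -> A) : Prop :=
  forall (N N' : lmodType B) (g : {linear N -> N'}), injective g ->
    forall s : seq (N * A),
      tensor_eq0 f [seq (g p.1, p.2) | p <- s] -> tensor_eq0 f s.

(* Flatness is local on X.  The restriction of pi to the chart Spec A_i is, by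
   Yoneda, the algebra map B -> A_i obtained by evaluating at the tautological
   point id of Spec A_i. *)
Definition flat (k : fieldType) (X : kfunctor k) (B : comAlgType k)
  (pi : kmor X (Spec B)) : Prop :=
  exists (I : Type) (A : I -> comAlgType k) (j : forall i, kmor (Spec (A i)) X),
    open_cover j /\
    forall i, flat_algebra
      (pi _ (j i _ (idfun : {lrmorphism A i -> A i})) : {lrmorphism B -> A i}).

Section ProjectiveSpace.
Variables (k : fieldType) (n : nat).

(* Rank one direct summands L of A^(n+1): the elements of L are pairwise
   proportional and their coordinates generate the unit ideal.  Where the
   coordinate u_i of some u in L is invertible, proportionality
   u_i v = v_i u shows that L is free on u, with complement u_i = 0. *)
Definition is_line (A : comAlgType k) (L : set 'rV[A]_n.+1) : Prop :=
  [/\ submodule L,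
      forall u v, L u -> L v -> forall i j, u 0 i * v 0 j = u 0 j * v 0 i &
      ideal_gen [set a | exists u i, L u /\ a = u 0 i] 1].

Definition line_image (A B : comAlgType k) (f : {lrmorphism A -> B})
  (L : set 'rV[A]_n.+1) : set 'rV[B]_n.+1 := span (map_mx f @` L).

Lemma line_image_line (A B : comAlgType k) (f : {lrmorphism A -> B}) L :
  is_line L -> is_line (line_image f L).
Proof.
move=> [Lsub Lmin Lunit]; split; first exact: span_submodule.
- suff H : forall u v, line_image f L u -> line_image f L v ->
      [set w : 'rV[B]_n.+1 | forall i j, u 0 i * w 0 j = u 0 j * w 0 i] v by [].
  move=> u v Lu Lv; move: v Lv.
  apply: span_sub.
    split=> [i j|c v w /= Hv Hw i j]; first by rewrite !mxE !mulr0.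
    by rewrite !mxE !mulrDr Hw (mulrCA _ c) Hv (mulrCA _ c).
  move=> _ [v Lv <-] /= i j.
  have : [set w : 'rV[B]_n.+1 | forall i j,
      w 0 i * map_mx f v 0 j = w 0 j * map_mx f v 0 i] u.
    move: u Lu; apply: span_sub.
      split=> [p q|c w1 w2 /= H1 H2 p q]; first by rewrite !mxE !mul0r.
      have := H1 p q; have := H2 p q.
      by rewrite !mxE !mulrDl -!mulrA => -> ->.
    by move=> _ [u Lu <-] /= p q; rewrite !mxE -!rmorphM Lmin.
  exact.
- pose J := ideal_gen [set a | exists u i, line_image f L u /\ a = u 0 i].
  have Jsub : submodule (J : set B^o) by exact: span_submodule.
  suff : J (f 1) by rewrite rmorph1.
  apply: (Lunit (fun a => J (f a))).
    split=> [|c u v Ju Jv]; first by rewrite /= rmorph0; exact: Jsub.1.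
    by rewrite /= rmorphD rmorphM; exact: Jsub.2.
  move=> _ [u [i [Lu ->]]]; apply: sub_span => /=.
  exists (map_mx f u), i; split; last by rewrite mxE.
  by apply: sub_span; exists u.
Qed.

Definition Pn_pts (A : comAlgType k) : Type :=
  {L : set 'rV[A]_n.+1 | is_line L}.

Definition Pn_map (A B : comAlgType k) (f : {lrmorphism A -> B})
  (L : Pn_pts A) : Pn_pts B :=
  exist _ (line_image f (sval L)) (line_image_line f (svalP L)).

Lemma Pn_map_id (A : comAlgType k) (f : {lrmorphism A -> A}) (L : Pn_pts A) :
  f =1 id -> Pn_map f L = L.
Proof.
move=> fid; apply: sval_inj_prop => /=; case: L => L [Lsub _ _] /=.
have mapid u : map_mx f u = u :> 'rV_n.+1.
  by apply/matrixP => i j; rewrite mxE fid.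
rewrite eqEsubset; split=> [|v Lv].
  by apply: span_sub => // _ [u Lu <-]; rewrite mapid.
by apply: sub_span; exists v.
Qed.

Lemma Pn_map_comp (A B D : comAlgType k) (f : {lrmorphism A -> B})
    (g : {lrmorphism B -> D}) (h : {lrmorphism A -> D}) (L : Pn_pts A) :
  h =1 g \o f -> Pn_map h L = Pn_map g (Pn_map f L).
Proof.
move=> hgf; apply: sval_inj_prop => /=; case: L => L /= _.
have mapc u : map_mx h u = map_mx g (map_mx f u) :> 'rV_n.+1.
  by apply/matrixP => i j; rewrite !mxE hgf.
have [G0 GD] := span_submodule (map_mx h @` L).
rewrite eqEsubset; split.
  apply: span_sub; first exact: span_submodule.
  move=> _ [u Lu <-]; rewrite mapc; apply: sub_span.
  by exists (map_mx f u) => //; apply: sub_span; exists u.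
apply: span_sub => // _ [w + <-].
move: w; apply: (@span_sub _ _ _
  [set w : 'rV[B]_n.+1 | line_image h L (map_mx g w)]).
  split=> /= [|c u v Hu Hv]; first by rewrite map_mx0.
  by rewrite map_mxD map_mxZ; exact: GD.
by move=> _ [u Lu <-] /=; rewrite -mapc; apply: sub_span; exists u.
Qed.

Definition projective_space : kfunctor k :=
  @KFunctor k Pn_pts Pn_map Pn_map_id Pn_map_comp.

End ProjectiveSpace.

Definition projective (k : fieldType) (X Y : kfunctor k) (pi : kmor X Y) :
  Prop :=
  exists (n : nat) (j : kmor X (projective_space k n)),
    closed_immersion (kpair j pi).

Definition affine_plane (k : fieldType) : kfunctor k := Spec (mpoly 2 k).

Definition coord_alpha (k : fieldType) : mpoly 2 k := mpolyX k (mnm1 (ord0 : 'I_2)).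
Definition coord_beta (k : fieldType) : mpoly 2 k := mpolyX k (mnm1 (ord_max : 'I_2)).

Section Fibre.
Variables (k : fieldType) (X : kfunctor k) (pi : kmor X (affine_plane k)).
Variables (a b : k).

Definition over_point (A : comAlgType k) (x : X A) : Prop :=
  let y : {lrmorphism mpoly 2 k -> A} := pi _ x in
  y (coord_alpha k) = a%:A /\ y (coord_beta k) = b%:A.

Lemma over_point_map (A B : comAlgType k) (f : {lrmorphism A -> B}) (x : X A) :
  over_point x -> over_point (kmap X f x).
Proof.
by rewrite /over_point kapp_nat /= => -[-> ->]; rewrite !linearZ /= !rmorph1.
Qed.

Definition fibre_map (A B : comAlgType k) (f : {lrmorphism A -> B})
  (x : {x : X A | over_point x}) : {x : X B | over_point x} :=
  exist _ (kmap X f (sval x)) (over_point_map f (svalP x)).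

Lemma fibre_map_id (A : comAlgType k) (f : {lrmorphism A -> A}) x :
  f =1 id -> fibre_map f x = x.
Proof. by move=> e; apply: sval_inj_prop; rewrite /= kmap_id. Qed.

Lemma fibre_map_comp (A B D : comAlgType k) (f : {lrmorphism A -> B})
    (g : {lrmorphism B -> D}) (h : {lrmorphism A -> D}) x :
  h =1 g \o f -> fibre_map h x = fibre_map g (fibre_map f x).
Proof. by move=> e; apply: sval_inj_prop; rewrite /= -(kmap_comp _ e). Qed.

(* Scheme-theoretic fibre of pi over the k-point (alpha, beta) = (a, b). *)
Definition fibre : kfunctor k := KFunctor fibre_map_id fibre_map_comp.

End Fibre.

(* N = Z^2 is represented by integer row vectors, N_R by real row vectors and
   M = Hom(N, Z) by integer column vectors. *)

Section Polygons.
Variable R : realType.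

Local Notation N := 'rV[int]_2.
Local Notation NR := 'rV[R]_2.
Local Notation M := 'cV[int]_2.

Definition lattice_pt (p : N) : NR := map_mx intr p.

Definition pairing (u : M) (x : NR) : R := (x *m map_mx intr u) 0 0.

Definition primitive (m n : nat) (u : 'M[int]_(m, n)) : Prop :=
  forall (d : int) (v : 'M[int]_(m, n)), u = d *: v -> `|d| = 1.

Definition conv_hull (A : set NR) : set NR :=
  [set x | exists (n : nat) (c : 'I_n -> R) (a : 'I_n -> NR),
    [/\ forall i, 0 <= c i, forall i, A (a i), \sum_i c i = 1
      & x = \sum_i c i *: a i]].

Definition polytope (P : set NR) : Prop :=
  exists s : seq NR, P = conv_hull [set` s].

Definition lattice_polytope (P : set NR) : Prop :=
  exists s : seq N, P = conv_hull (lattice_pt @` [set` s]).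

Definition vertex (P : set NR) : set NR :=
  [set x | P x /\ forall y z (t : R), P y -> P z -> 0 < t < 1 ->
    x = t *: y + (1 - t) *: z -> y = x /\ z = x].

Definition fano_polygon (P : set NR) : Prop :=
  [/\ polytope P,
      forall x, vertex P x -> exists2 p : N, primitive p & x = lattice_pt p &
      interior P (0 : NR)].

Definition minkowski_sum (A B : set NR) : set NR :=
  [set x + y | x in A & y in B].

Definition dilate (t : R) (A : set NR) : set NR := [set t *: x | x in A].

Definition segment (f : N) : set NR := conv_hull [set 0; lattice_pt f].

Definition slice (w : M) (P : set NR) (h : int) : set NR :=
  conv_hull (lattice_pt @`
    [set p : N | P (lattice_pt p) /\ pairing w (lattice_pt p) = h%:~R]).

Definition vertices_at (w : M) (P : set NR) (h : int) : set NR :=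
  [set x | vertex P x /\ pairing w x = h%:~R].

Definition mutation (w : M) (f : N) (G : int -> set NR) (P : set NR) : set NR :=
  conv_hull
    ((\bigcup_(h in [set h : int | h < 0]) G h) `|`
     (\bigcup_(h in [set h : int | 0 <= h])
        minkowski_sum (slice w P h) (dilate h%:~R (segment f)))).

Definition combinatorial_mutation (P P' : set NR) : Prop :=
  exists (w : M) (f : N) (G : int -> set NR),
    [/\ primitive w,
        primitive f /\ pairing w (lattice_pt f) = 0,
        forall h : int, h < 0 ->
          [/\ lattice_polytope (G h),
              vertices_at w P h
                `<=` minkowski_sum (G h) (dilate `|h|%:~R (segment f)) &
              minkowski_sum (G h) (dilate `|h|%:~R (segment f))
                `<=` slice w P h] &
        P' = mutation w f G P].

(* The empty face is allowed; P itself is excluded. *)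
Definition proper_face (P E : set NR) : Prop :=
  E <> P /\
  exists (l : 'cV[R]_2) (c : R),
    (forall x, P x -> (x *m l) 0 0 <= c) /\
    E = [set x | P x /\ (x *m l) 0 0 = c].

(* E is convex, so nonnegative multiples of its points suffice; the cone over
   the empty face is {0}. *)
Definition cone_over (E : set NR) : set NR :=
  [set x | x = 0 \/ exists2 p, E p & exists2 t : R, 0 <= t & x = t *: p].

Definition spanning_fan (P : set NR) : set (set NR) :=
  cone_over @` [set E | proper_face P E].

Definition dual_monoid (s : set NR) : set M :=
  [set u | forall x, s x -> 0 <= pairing u x].

End Polygons.

Section ToricChart.
Variables (k : fieldType) (S : set 'cV[int]_2).

Definition monoid_hom (A : comAlgType k) (x : {u | S u} -> A) : Prop :=
  (forall u, sval u = 0 -> x u = 1) /\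
  (forall u v w, sval w = sval u + sval v -> x w = x u * x v).

Lemma monoid_hom_map (A B : comAlgType k) (f : {lrmorphism A -> B}) x :
  monoid_hom x -> monoid_hom (f \o x).
Proof.
move=> [x1 xM]; split=> [u u0|u v w e] /=; first by rewrite x1 ?rmorph1.
by rewrite (xM _ _ _ e) rmorphM.
Qed.

Definition chart_map (A B : comAlgType k) (f : {lrmorphism A -> B})
  (x : {x : {u | S u} -> A | monoid_hom x}) :
  {x : {u | S u} -> B | monoid_hom x} :=
  exist _ (f \o sval x) (monoid_hom_map f (svalP x)).

Lemma chart_map_id (A : comAlgType k) (f : {lrmorphism A -> A}) x :
  f =1 id -> chart_map f x = x.
Proof.
by move=> e; apply: sval_inj_prop; apply/funext => u /=; rewrite e.
Qed.

Lemma chart_map_comp (A B D : comAlgType k) (f : {lrmorphism A -> B})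
    (g : {lrmorphism B -> D}) (h : {lrmorphism A -> D}) x :
  h =1 g \o f -> chart_map h x = chart_map g (chart_map f x).
Proof.
by move=> e; apply: sval_inj_prop; apply/funext => u /=; rewrite e.
Qed.

(* Spec k[S] for a submonoid S of M: an algebra map k[S] -> A is the same as a
   monoid homomorphism from S to (A, * ). *)
Definition toric_chart : kfunctor k := KFunctor chart_map_id chart_map_comp.

End ToricChart.

(* The toric open immersion Spec k[S'] -> Spec k[S] attached to S included in
   S' sends z to x. *)
Definition chart_restr (k : fieldType) (S S' : set 'cV[int]_2)
  (A : comAlgType k) (z : toric_chart k S' A) (x : toric_chart k S A) : Prop :=
  forall (u' : {u | S' u}) (u : {u | S u}),
    sval u' = sval u -> sval z u' = sval x u.

(* X is obtained by gluing the affine charts U_s = Spec k[dual of s], s in the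
   fan Sigma, with U_s and U_t glued exactly along U_(s meet t).  This
   determines X up to unique isomorphism, so it expresses that X is isomorphic
   to the toric variety of Sigma. *)
Definition is_toric_variety (R : realType) (k : fieldType)
  (Sigma : set (set 'rV[R]_2)) (X : kfunctor k) : Prop :=
  zariski_sheaf X /\
  exists j : forall s : {s | Sigma s},
      kmor (toric_chart k (dual_monoid (sval s))) X,
    open_cover j /\
    forall (s t : {s | Sigma s}) (A : comAlgType k)
        (x : toric_chart k (dual_monoid (sval s)) A)
        (y : toric_chart k (dual_monoid (sval t)) A),
      j s _ x = j t _ y <->
      exists z : toric_chart k (dual_monoid (sval s `&` sval t)) A,
        chart_restr z x /\ chart_restr z y.

(* Main.v *)
(** Put h(u) = min(0, <u, f>), so that phi(u) = u - h(u) w maps the polar polygon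
    Q of P onto that of P'.  Over the plane with coordinates (alpha, beta), the
    relations chi^u chi^v = chi^(u + v) between sections of O(d) on X_P deform to
      x_u x_v = sum_(i <= m) C(m, i) alpha^i beta^(m - i) x_(u + v + i w),
    m = h(u + v) - h(u) - h(v) >= 0; formally,
    x_u = chi^u (beta + alpha chi^w)^(- h(u)).  Only the term i = 0 survives for
    alpha = 0, and only i = m for beta = 0, where it reads
    x_u x_v = alpha^m x_(u + v + m w) and becomes multiplicative in phi(u).  The
    extreme exponents lie in the right multiple of Q because Q and phi(Q) are
    convex, and hence so do those in between.  These relations, on finitely many
    lattice points of d Q, cut a family out of P^n x A^2.  Where the coordinate of
    a suitable point v of d Q is invertible, its ring is free over k[alpha, beta]
    on the lattice points of the tangent cone of d Q at v, with the same deformed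
    product; hence flatness and both fibres. *)

Require Import Defs.
From HB Require Import structures.
From mathcomp Require Import all_boot all_order all_algebra.
From mathcomp Require Import all_classical all_reals all_analysis.
From mathcomp.real_closed Require Import complex.
From mathcomp Require Import -(notations) mpoly monalg.
From mathcomp Require Import finmap.
From mathcomp Require Import zify ring lra.
(* Takes [span] back from vector.v. *)
Import Defs.
Import numFieldNormedType.Exports.
Import Order.TTheory GRing.Theory Num.Theory.
Set Implicit Arguments.
Unset Strict Implicit.
Unset Printing Implicit Defensive.
Local Open Scope classical_set_scope.
Local Open Scope ring_scope.

(** * Ideals, localization and gluing of lines *)

(** The bend of h along the wall <u, f> = 0 shapes the construction. h is additive on a list only if
    the list stays on one side of the wall. So the corners of both halves of Q join the
    representatives of the faces, and generators of tangent cones are taken on each side separately.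
    The dilation is so large that these generators, translated to their base point, land in the
    dilated polygon and h takes its linearized value there. Every chart ring is then generated by
    ratios of the chosen coordinates. The relations quantify over all expansions into monomials on
    which h is additive. On the chart of v the coordinate of v is 1, and multiplying by a high power
    of it makes room for the expansions that are needed. As phi is only piecewise linear, tangent
    cones of Q and phi(Q) are compared through the points u + N z with N large. Over (0, c) and (c,
    0) a factor c^m remains in the product; m is a coboundary of h, so rescaling x_u by c^(- h(u))
    removes it. *)

Lemma submodule0 (A : comNzRingType) (V : lmodType A) (W : set V) :
  submodule W -> W 0.
Proof. by case. Qed.

Lemma submoduleD (A : comNzRingType) (V : lmodType A) (W : set V) u v :
  submodule W -> W u -> W v -> W (u + v).
Proof. by move=> [_ H] Wu Wv; rewrite -[u]scale1r; exact: H. Qed.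

Lemma submoduleZ (A : comNzRingType) (V : lmodType A) (W : set V) c u :
  submodule W -> W u -> W (c *: u).
Proof. by move=> [W0 H] Wu; rewrite -[_ *: _]addr0; exact: H. Qed.

Definition is_ideal (A : comNzRingType) (J : set A) : Prop :=
  submodule (J : set A^o).

Section IdealTheory.
Variables (A : comNzRingType) (J : set A).
Hypothesis idJ : is_ideal J.

Lemma ideal0 : J 0. Proof. exact: (@submodule0 A A^o J). Qed.

Lemma idealD a b : J a -> J b -> J (a + b).
Proof. exact: (@submoduleD A A^o J). Qed.

Lemma idealM c a : J a -> J (c * a).
Proof. exact: (@submoduleZ A A^o J). Qed.

Lemma ideal_sum (I : Type) (s : seq I) (F : I -> A) :
  (forall i, J (F i)) -> J (\sum_(i <- s) F i).
Proof.
by move=> JF; elim/big_ind : _ => //; [exact: ideal0|exact: idealD].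
Qed.

End IdealTheory.

Lemma ideal_gen_ideal (A : comNzRingType) (G : set A) : is_ideal (ideal_gen G).
Proof. exact: (@span_submodule A A^o). Qed.

Lemma sub_ideal_gen (A : comNzRingType) (G : set A) : G `<=` ideal_gen G.
Proof. exact: (@sub_span A A^o). Qed.

Lemma ideal_gen_min (A : comNzRingType) (G J : set A) :
  is_ideal J -> G `<=` J -> ideal_gen G `<=` J.
Proof. exact: (@span_sub A A^o). Qed.

(** By the binomial theorem the elements with a power in J form an ideal; it contains 1 as soon as
    it contains generators of the unit ideal. *)
Lemma radical_unit (A : comNzRingType) (J : set A) (G : set A) :
  is_ideal J -> ideal_gen G 1 ->
  (forall g, G g -> exists n, J (g ^+ n)) -> J 1.
Proof.
move=> Jid G1 GJ.
pose W : set A^o := [set a : A^o | exists n, J ((a : A) ^+ n)].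
suff [n] : W 1 by rewrite expr1n.
apply: G1 => [|a Ga]; last exact: GJ.
split=> [|c a b [n Ja] [m Jb]] /=.
  by exists 1%N; rewrite expr1; exact: ideal0.
exists (n + m)%N; rewrite exprDn; apply: ideal_sum => // i.
rewrite -mulr_natl; apply: idealM => //.
have [le_m_i|lt_i_m] := leqP m i.
  by rewrite -(subnK le_m_i) exprD mulrA; exact: idealM.
rewrite -(subnK (_ : n <= n + m - i)%N); last by lia.
rewrite [(c *: a) ^+ _]exprD mulrC mulrA [c *: a]/(c * a) [_ ^+ n]exprMn mulrA.
exact: idealM.
Qed.

Lemma torsion_unit (A : comNzRingType) (G : set A) (z : A) :
  ideal_gen G 1 -> (forall g, G g -> exists n, g ^+ n * z = 0) -> z = 0.
Proof.
move=> G1 Gz; rewrite -[z]mul1r.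
apply: (@radical_unit _ [set a | a * z = 0] _ _ G1) => //.
split=> [|c u v /= Hu Hv] /=; first by rewrite mul0r.
by rewrite mulrDl [c *: u]/(c * u) -mulrA Hu Hv mulr0 addr0.
Qed.

Section Localization.
Variables (k : fieldType) (A : comAlgType k) (r : A).

(** The localization is A[X]/(rX - 1). The proof that r is not nilpotent is an argument so that the
    quotient can be registered as a nonzero ring. *)
Definition loc_ideal (r_nn : forall n, r ^+ n != 0) : {pred {poly A}} :=
  fun p => `[< exists q, p = (r *: 'X - 1) * q >].

(** Comparison of coefficients determines q; as q has finitely many of them, r^i a = 0 for large i.
    Both the properness of the ideal and the kernel of the localization map come from this. *)
Lemma loc_coef (p q : {poly A}) a : p = a%:P -> p = (r *: 'X - 1) * q ->
  forall i, q`_i = - (r ^+ i * a).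
Proof.
move=> -> e; elim=> [|i IH].
  have := congr1 (fun p : {poly A} => p`_0) e.
  rewrite coefC /= mulrBl mul1r -scalerAl coefB coefZ coefXM /= mulr0 sub0r.
  by move=> ->; rewrite expr0 mul1r opprK.
have := congr1 (fun p : {poly A} => p`_i.+1) e.
rewrite coefC /= mulrBl mul1r -scalerAl coefB coefZ coefXM /= IH => /eqP.
by rewrite eq_sym subr_eq0 => /eqP <-; rewrite exprS mulrN mulrA.
Qed.

Variable r_nn : forall n, r ^+ n != 0.

Lemma loc_idealP : idealr_closed (loc_ideal r_nn).
Proof.
split; first by apply/asboolP; exists 0; rewrite mulr0.
  apply/asboolP => -[q e].
  have := loc_coef (erefl : 1 = 1%:P) e (size q).
  rewrite nth_default // mulr1 => /eqP.
  by rewrite eq_sym oppr_eq0; exact/negP/r_nn.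
move=> a u v /asboolP[q ->] /asboolP[q' ->]; apply/asboolP.
by exists (a * q + q'); rewrite mulrDr mulrCA.
Qed.

HB.instance Definition _ := isIdealr.Build {poly A} (loc_ideal r_nn) loc_idealP.

Definition loc := {ideal_quot (loc_ideal r_nn)}.
HB.instance Definition _ := GRing.ComNzRing.on loc.

Local Open Scope quotient_scope.

Definition loc_emb (a : A) : loc := \pi_loc (a%:P).

Lemma pi_locD (p q : {poly A}) : \pi_loc (p + q) = \pi_loc p + \pi_loc q.
Proof. exact: rmorphD. Qed.
Lemma pi_locM (p q : {poly A}) : \pi_loc (p * q) = \pi_loc p * \pi_loc q.
Proof. exact: rmorphM. Qed.
Lemma pi_loc1 : \pi_loc (1 : {poly A}) = 1.
Proof. exact: rmorph1. Qed.

Lemma loc_embD a b : loc_emb (a + b) = loc_emb a + loc_emb b.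
Proof. by rewrite /loc_emb polyCD pi_locD. Qed.
Lemma loc_embM a b : loc_emb (a * b) = loc_emb a * loc_emb b.
Proof. by rewrite /loc_emb polyCM pi_locM. Qed.
Lemma loc_emb1 : loc_emb 1 = 1.
Proof. by rewrite /loc_emb pi_loc1. Qed.

Definition loc_scale (c : k) (x : loc) : loc := loc_emb c%:A * x.

Lemma loc_scaleA c d x : loc_scale c (loc_scale d x) = loc_scale (c * d) x.
Proof. by rewrite /loc_scale mulrA -loc_embM -scalerAl mul1r scalerA. Qed.
Lemma loc_scale1 : left_id 1 loc_scale.
Proof. by move=> x; rewrite /loc_scale scale1r loc_emb1 mul1r. Qed.
Lemma loc_scaleDr : right_distributive loc_scale +%R.
Proof. by move=> c x y; rewrite /loc_scale mulrDr. Qed.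
Lemma loc_scaleDl v : {morph loc_scale^~ v : a b / a + b}.
Proof. by move=> a b; rewrite /loc_scale scalerDl loc_embD mulrDl. Qed.

HB.instance Definition _ := GRing.Zmodule_isLmodule.Build k loc
  loc_scaleA loc_scale1 loc_scaleDr loc_scaleDl.

Lemma loc_scaleAl (c : k) (x y : loc) : c *: (x * y) = (c *: x) * y.
Proof. exact: mulrA. Qed.
HB.instance Definition _ := GRing.Lmodule_isLalgebra.Build k loc loc_scaleAl.
Lemma loc_scaleAr (c : k) (x y : loc) : c *: (x * y) = x * (c *: y).
Proof. exact: mulrCA. Qed.
HB.instance Definition _ := GRing.Lalgebra_isAlgebra.Build k loc loc_scaleAr.

Lemma loc_emb_zmod : zmod_morphism loc_emb.
Proof. by move=> a b; rewrite /loc_emb polyCB; exact: rmorphB. Qed.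
HB.instance Definition _ := GRing.isZmodMorphism.Build A loc loc_emb loc_emb_zmod.
HB.instance Definition _ := GRing.isMonoidMorphism.Build A loc loc_emb
  (loc_emb1, loc_embM).
Lemma loc_emb_scal : scalable loc_emb.
Proof. by move=> c a; rewrite -[c *: a]mulr_algl loc_embM. Qed.
HB.instance Definition _ := GRing.isScalable.Build k A loc *:%R loc_emb loc_emb_scal.

Lemma loc_is_loc : is_localization r (loc_emb : {lrmorphism A -> loc}).
Proof.
have rX : loc_emb r * \pi_loc 'X = 1.
  rewrite /loc_emb -pi_locM -pi_loc1; apply/eqP; rewrite -Quotient.idealrBE.
  by apply/asboolP; exists 1; rewrite mulr1 mul_polyC.
split; first by exists (\pi_loc 'X).
  move=> b; rewrite -[b]reprK; elim/poly_ind: (repr b) => [|p c [a [m e]]].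
    by exists 0, 0%N; rewrite (rmorph0 (\pi_loc)) mulr0 (rmorph0 loc_emb).
  exists (a + r ^+ m.+1 * c), m.+1.
  rewrite pi_locD pi_locM mulrDr rmorphD /= -e exprS -!mulrA; congr (_ + _).
    by rewrite mulrCA; congr (_ * _); rewrite mulrCA rX mulr1.
  by rewrite mulrA -exprS rmorphM rmorphXn.
move=> a /eqP; rewrite /= /loc_emb -(rmorph0 (\pi_loc)) -Quotient.idealrBE subr0.
move=> /asboolP[q e]; exists (size q).
have := loc_coef erefl e (size q); rewrite nth_default // => /eqP.
by rewrite eq_sym oppr_eq0 => /eqP.
Qed.

End Localization.

Lemma localization_exists (k : fieldType) (A : comAlgType k) (r : A) :
  (forall n, r ^+ n != 0) ->
  exists (B : comAlgType k) (f : {lrmorphism A -> B}), is_localization r f.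
Proof. by move=> r_nn; exists (loc r_nn), (@loc_emb _ _ _ r_nn); exact: loc_is_loc. Qed.

Section RowSubmodules.
Variables (k : fieldType) (A : comAlgType k) (n : nat) (W : set 'rV[A]_n).

Lemma rowsub0 : submodule W -> W 0.
Proof. by case. Qed.

Lemma rowsubZ c u : submodule W -> W u -> W (c *: u).
Proof. exact: submoduleZ. Qed.

Lemma rowsubZD c u v : submodule W -> W u -> W v -> W (c *: u + v).
Proof. by case=> _; exact. Qed.

End RowSubmodules.

Lemma lrmorphism_build (k : fieldType) (A B : comAlgType k) (g : A -> B) :
  zmod_morphism g -> monoid_morphism g -> scalable g ->
  exists h : {lrmorphism A -> B}, h =1 g.
Proof.
move=> gB gM gZ.
pose Z := GRing.isZmodMorphism.Build A B g gB.
pose M := GRing.isMonoidMorphism.Build A B g gM.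
pose S := GRing.isScalable.Build k A B *:%R g gZ.
pose h : {lrmorphism A -> B} := HB.pack g Z M S.
by exists h.
Qed.

(** The universal property: an element b with f(r)^m b = f(a) has to go to phi(a) s^m. Two such
    fractions differ by r-torsion, which phi kills because phi(r) is a unit. *)
Lemma loc_lift (k : fieldType) (A B D : comAlgType k) (r : A)
    (f : {lrmorphism A -> B}) (phi : {lrmorphism A -> D}) (s : D) :
  is_localization r f -> phi r * s = 1 ->
  exists g : {lrmorphism B -> D}, g \o f =1 phi.
Proof.
move=> [[t ft] fsurj fker] rs.
have rsX m : phi r ^+ m * s ^+ m = 1 by rewrite -exprMn rs expr1n.
have key a a' m m' b : f r ^+ m * b = f a -> f r ^+ m' * b = f a' ->
    phi a * s ^+ m = phi a' * s ^+ m'.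
  move=> ea ea'; have [|N] := fker (r ^+ m' * a - r ^+ m * a').
    by rewrite rmorphB !rmorphM !rmorphXn /= -ea -ea' mulrCA subrr.
  move=> /(congr1 phi); rewrite rmorph0 rmorphM rmorphB !rmorphM !rmorphXn.
  move=> /(congr1 (fun x => s ^+ N * x)); rewrite mulrA [s ^+ N * _]mulrC rsX.
  rewrite mul1r mulr0 => /eqP; rewrite subr_eq0 => /eqP e.
  transitivity (phi r ^+ m' * phi a * (s ^+ m * s ^+ m')).
    by rewrite -[LHS]mulr1 -(rsX m'); ring.
  by rewrite e -[RHS]mulr1 -(rsX m); ring.
have /choice[rep repP] : forall b, exists am : A * nat, f r ^+ am.2 * b = f am.1.
  by move=> b; have [a [m e]] := fsurj b; exists (a, m).
pose g b := phi (rep b).1 * s ^+ (rep b).2.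
have gP b a m : f r ^+ m * b = f a -> g b = phi a * s ^+ m.
  by move=> e; apply: key e; exact: repP.
have gf a : g (f a) = phi a.
  by rewrite (gP _ a 0%N) ?expr0 ?mul1r ?mulr1.
have gB : zmod_morphism g.
  move=> b b'; rewrite (gP _ (r ^+ (rep b').2 * (rep b).1 -
    r ^+ (rep b).2 * (rep b').1) ((rep b).2 + (rep b').2)%N).
    rewrite /g rmorphB !rmorphM !rmorphXn exprD mulrBl; congr (_ - _).
      by rewrite -[RHS]mulr1 -(rsX (rep b').2); ring.
    by rewrite -[RHS]mulr1 -(rsX (rep b).2); ring.
  by rewrite rmorphB !rmorphM !rmorphXn /= -!repP exprD mulrBr; ring.
have gM : monoid_morphism g.
  split; first by rewrite -(rmorph1 f) gf rmorph1.
  move=> b b'; rewrite (gP _ ((rep b).1 * (rep b').1) ((rep b).2 + (rep b').2)%N).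
    by rewrite rmorphM exprD /g mulrACA.
  by rewrite rmorphM /= -!repP exprD mulrACA.
have gZ : scalable g.
  move=> c b; rewrite (gP _ (c *: (rep b).1) (rep b).2).
    by rewrite linearZ /= -scalerAl.
  by rewrite linearZ /= -repP scalerAr.
have [h hg] := lrmorphism_build gB gM gZ.
by exists h => a; rewrite /= hg gf.
Qed.

Lemma fin_bound (I : finType) (P : I -> nat -> Prop) :
  (forall i, exists m, forall m', (m <= m')%N -> P i m') ->
  exists m, forall m', (m <= m')%N -> forall i, P i m'.
Proof.
move=> /choice[F FP]; exists (\max_i F i) => m' le i.
by apply: FP; apply: leq_trans le; exact: leq_bigmax.
Qed.

Lemma map_mxZD (A B : comNzRingType) (f : {rmorphism A -> B}) n c
    (u v : 'rV[A]_n) :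
  map_mx f (c *: u + v) = f c *: map_mx f u + map_mx f v.
Proof. by rewrite map_mxD map_mxZ. Qed.

Section LineOf.
Variables (k : fieldType) (n : nat).

Lemma line_image_submodule (A B : comAlgType k) (f : {lrmorphism A -> B})
  (L : set 'rV[A]_n.+1) : submodule (line_image f L).
Proof. exact: span_submodule. Qed.

Lemma sub_line_image (A B : comAlgType k) (f : {lrmorphism A -> B})
  (L : set 'rV[A]_n.+1) v : L v -> line_image f L (map_mx f v).
Proof. by move=> Lv; apply: sub_span; exists v. Qed.

Definition line_of (A : comAlgType k) (u : 'rV[A]_n.+1) : set 'rV[A]_n.+1 :=
  [set v | exists c, v = c *: u].

Lemma line_of_submodule (A : comAlgType k) (u : 'rV[A]_n.+1) :
  submodule (line_of u).
Proof.
split; first by exists 0; rewrite scale0r.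
by move=> c _ _ [a ->] [b ->]; exists (c * a + b); rewrite scalerDl scalerA.
Qed.

Lemma line_of_self (A : comAlgType k) (u : 'rV[A]_n.+1) : line_of u u.
Proof. by exists 1; rewrite scale1r. Qed.

Lemma line_of_line (A : comAlgType k) (u : 'rV[A]_n.+1) i :
  u 0 i = 1 -> is_line (line_of u).
Proof.
move=> ui; split; first exact: line_of_submodule.
  by move=> _ _ [a ->] [b ->] p q; rewrite !mxE; ring.
apply: sub_ideal_gen; exists u, i; split=> //; exact: line_of_self.
Qed.

Lemma line_image_of (A B : comAlgType k) (f : {lrmorphism A -> B}) u :
  line_image f (line_of u) = line_of (map_mx f u).
Proof.
rewrite eqEsubset; split.
  apply: span_sub; first exact: line_of_submodule.
  by move=> _ [_ [c ->] <-]; rewrite map_mxZ; exists (f c).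
move=> _ [c ->]; apply rowsubZ; first exact: line_image_submodule.
by apply: sub_line_image; exact: line_of_self.
Qed.

Lemma line_eq_of (A : comAlgType k) (L : set 'rV[A]_n.+1) u i :
  is_line L -> L u -> u 0 i = 1 -> L = line_of u.
Proof.
move=> [Lsub Lmin _] Lu ui; rewrite eqEsubset; split=> [v Lv|_ [c ->]].
  exists (v 0 i); apply/rowP => j; rewrite !mxE.
  by have := Lmin _ _ Lu Lv i j; rewrite ui mul1r mulrC => ->; rewrite mulrC.
by apply rowsubZ.
Qed.

Lemma line_of_inj (A : comAlgType k) (u v : 'rV[A]_n.+1) i :
  u 0 i = 1 -> v 0 i = 1 -> line_of u = line_of v -> u = v.
Proof.
move=> ui vi e; have [c uc] : line_of v u by rewrite -e; exact: line_of_self.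
by move: ui; rewrite uc mxE vi mulr1 => ->; rewrite scale1r.
Qed.

End LineOf.

Section LocalizedLines.
Variables (k : fieldType) (n : nat) (A B : comAlgType k) (r : A).
Variables (f : {lrmorphism A -> B}).
Hypothesis floc : is_localization r f.

(** A common denominator turns a combination of images of vectors of L into the image of a single
    vector, up to a power of r. *)
Lemma line_image_loc (L : set 'rV[A]_n.+1) w : submodule L ->
  line_image f L w <-> exists m v, L v /\ f r ^+ m *: w = map_mx f v.
Proof.
case: floc => [[s rs] fsurj fker] Lsub.
have sr m : s ^+ m * f r ^+ m = 1 by rewrite -exprMn mulrC rs expr1n.
split; last first.
  move=> [m [v [Lv e]]]; rewrite -[w]scale1r -(sr m) -scalerA e.
  apply rowsubZ; first exact: line_image_submodule.
  exact: sub_line_image.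
move: w; apply: (@span_sub _ _ _
  [set w | exists m v, L v /\ f r ^+ m *: w = map_mx f v]); last first.
  by move=> _ [v Lv <-]; exists 0%N, v; rewrite expr0 scale1r.
split=> [|c w1 w2 [m1 [v1 [L1 e1]]] [m2 [v2 [L2 e2]]]] /=.
  by exists 0%N, 0; split; [exact: (rowsub0 Lsub)|rewrite map_mx0 scaler0].
have [a [m0 e0]] := fsurj c.
exists (m0 + m1 + m2)%N, ((r ^+ m2 * a) *: v1 + (r ^+ (m0 + m1)) *: v2); split.
  by apply rowsubZD => //; by apply rowsubZ.
rewrite map_mxD !map_mxZ -e1 -e2 rmorphM !rmorphXn /= -e0 scalerDr !scalerA.
by congr (_ *: _ + _ *: _); rewrite !exprD; ring.
Qed.

Lemma loc_row_eq (u v : 'rV[A]_n.+1) : map_mx f u = map_mx f v ->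
  exists m, r ^+ m *: u = r ^+ m *: v.
Proof.
case: floc => [_ _ fker] e.
have [|m mP] := @fin_bound 'I_n.+1 (fun j m => r ^+ m * (u 0 j - v 0 j) = 0).
  move=> j; have [|m e0] := fker (u 0 j - v 0 j).
    by rewrite rmorphB /=; move/rowP: e => /(_ j); rewrite !mxE => ->; rewrite subrr.
  by exists m => m' le; rewrite -(subnK le) exprD -mulrA e0 mulr0.
exists m; apply/rowP => j; rewrite !mxE; apply/eqP; rewrite -subr_eq0 -mulrBr.
exact/eqP/mP.
Qed.

End LocalizedLines.

Section Gluing.
Variables (k : fieldType) (A : comAlgType k) (n : nat) (r : 'I_n -> A).
Variables (B : 'I_n -> comAlgType k) (f : forall i, {lrmorphism A -> B i}).
Hypothesis r1 : ideal_gen (range r) 1.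
Hypothesis floc : forall i, is_localization (r i) (f i).

Lemma loc_separated (a b : A) : (forall i, f i a = f i b) -> a = b.
Proof.
move=> e; apply/eqP; rewrite -subr_eq0; apply/eqP.
apply: (torsion_unit r1) => _ [i _ <-].
by have [_ _] := floc i; apply; rewrite rmorphB /= e subrr.
Qed.

Lemma loc_ideal_unit (J : set A) : is_ideal J ->
  (forall i, exists m, J (r i ^+ m)) -> J 1.
Proof. by move=> Jid H; apply: (radical_unit Jid r1) => _ [i _ <-]. Qed.

Section GlueLines.
Variables (N : nat) (Ls : forall i, projective_space k N (B i)).
Hypothesis Lagree : forall i j (D : comAlgType k) (g : {lrmorphism B i -> D})
        (h : {lrmorphism B j -> D}),
      g \o f i =1 h \o f j ->
      kmap (projective_space k N) g (Ls i) = kmap (projective_space k N) h (Ls j).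

Definition glued : set 'rV[A]_N.+1 :=
  [set v | forall i, sval (Ls i) (map_mx (f i) v)].

(** The overlap is the localization of [B j] at the image of [r i]; [B i] maps to it by the
    universal property. Agreement there puts v into the j-th line after localization, hence after
    multiplication by a power of [r i]. *)
Lemma glue_overlap i j v : sval (Ls i) (map_mx (f i) v) ->
  exists M, forall m, (M <= m)%N -> sval (Ls j) (map_mx (f j) (r i ^+ m *: v)).
Proof.
move=> Lv; have [Ljsub _ _] := svalP (Ls j).
suff [M HM] : exists M, sval (Ls j) (map_mx (f j) (r i ^+ M *: v)).
  exists M => m le; rewrite -(subnK le) exprD -scalerA map_mxZ.
  by apply rowsubZ.
(* If [r i] is nilpotent in [B j] the overlap is empty and is not an algebra of the nonzero kind;
   but then a power of [r i] already kills v. *)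
have [[m rm0]|nn] := pselect (exists m, f j (r i) ^+ m = 0).
  exists m; rewrite (_ : map_mx _ _ = 0); first exact: (rowsub0 Ljsub).
  by apply/rowP => l; rewrite !mxE rmorphM rmorphXn /= rm0 mul0r.
have [|D [h hloc]] := @localization_exists k (B j) (f j (r i)).
  by move=> m; apply/eqP => e; apply: nn; exists m.
have [[s rs] _ _] := hloc.
have [g gP] := @loc_lift k A (B i) D (r i) (f i) (h \o f j) s (floc i) rs.
have e := congr1 (@sval _ _) (@Lagree i j D g h gP); rewrite /= in e.
have : line_image h (sval (Ls j)) (map_mx g (map_mx (f i) v)).
  by rewrite -e; exact: sub_line_image.
have -> : map_mx g (map_mx (f i) v) = map_mx h (map_mx (f j) v).
  by apply/rowP => l; rewrite !mxE; exact: gP.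
move=> /(line_image_loc hloc _ Ljsub)[m [v' [Lv' e']]].
have [|M eM] := loc_row_eq hloc (u := f j (r i) ^+ m *: map_mx (f j) v) (v := v').
  by rewrite map_mxZ rmorphXn.
exists (M + m)%N; rewrite map_mxZ rmorphXn exprD -scalerA eM.
by apply rowsubZ.
Qed.

(** Clearing denominators gives a vector over A that lies in the i-th line; a further power of
    [r i], uniform over the finitely many j, puts it into all the others. *)
Lemma glued_dense i w : sval (Ls i) w ->
  exists m v, glued v /\ f i (r i) ^+ m *: w = map_mx (f i) v.
Proof.
move=> Lw; have [Lisub _ _] := svalP (Ls i).
have [[s rs] fsurj _] := floc i.
have [|m mP] := @fin_bound 'I_N.+1
    (fun j m => exists a, f i (r i) ^+ m * w 0 j = f i a).
  move=> j; have [a [m e]] := fsurj (w 0 j); exists m => m' le.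
  exists (r i ^+ (m' - m) * a).
  by rewrite rmorphM rmorphXn /= -e mulrA -exprD subnK.
have /choice[a aP] := mP m (leqnn m).
pose v := \row_j a j.
have ev : map_mx (f i) v = f i (r i) ^+ m *: w.
  by apply/rowP => j; rewrite !mxE.
have [|M MP] := @fin_bound 'I_n
    (fun j M => sval (Ls j) (map_mx (f j) (r i ^+ M *: v))).
  by move=> j; apply: glue_overlap; rewrite ev; by apply rowsubZ.
exists (M + m)%N, (r i ^+ M *: v); split; first by move=> j; exact: MP.
by rewrite map_mxZ ev scalerA rmorphXn exprD.
Qed.

Lemma glued_submodule : submodule glued.
Proof.
split=> [i|c u v Hu Hv i]; have [Lsub _ _] := svalP (Ls i).
  by rewrite map_mx0; exact: (rowsub0 Lsub).
by rewrite map_mxZD; exact: (rowsubZD _ Lsub).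
Qed.

Lemma glued_line : is_line glued.
Proof.
split; first exact: glued_submodule.
  move=> u v Hu Hv p q; apply: loc_separated => i.
  have [_ Lmin _] := svalP (Ls i).
  by have := Lmin _ _ (Hu i) (Hv i) p q; rewrite !mxE !rmorphM.
set G := [set _ | _].
have idJ : is_ideal (ideal_gen G) by exact: ideal_gen_ideal.
apply: (loc_ideal_unit idJ) => i.
have [_ _ Lunit] := svalP (Ls i).
have [[s rs] fsurj fker] := floc i.
have sr m : s ^+ m * f i (r i) ^+ m = 1 by rewrite -exprMn mulrC rs expr1n.
(* The elements that a power of [r i] brings into the ideal of coordinates of the glued line. They
   form an ideal containing all coordinates of [Ls i], hence 1. *)
pose W : set (B i)^o := [set b | exists m a, ideal_gen G a /\
  f i (r i) ^+ m * (b : B i) = f i a].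
have : W 1.
  apply: Lunit; last first.
    move=> _ [w [j [Lw ->]]]; have [m [v [Hv e]]] := glued_dense Lw.
    exists m, (v 0 j); split; first by apply: sub_ideal_gen; exists v, j.
    by move/rowP: e => /(_ j); rewrite !mxE.
  split; first by exists 0%N, 0; rewrite mulr0 rmorph0; split=> //; exact: (ideal0 idJ).
  move=> c b1 b2 [m1 [a1 [J1 e1]]] [m2 [a2 [J2 e2]]].
  have [a [m0 e0]] := fsurj c.
  exists (m0 + m1 + m2)%N, (r i ^+ m2 * a * a1 + r i ^+ (m0 + m1) * a2); split.
    by apply: (idealD idJ); apply: (idealM idJ).
  rewrite rmorphD !rmorphM !rmorphXn /= -e0 -e1 -e2 !exprD.
  have aux (x y : B i) : f i (r i) ^+ m0 * f i (r i) ^+ m1 * f i (r i) ^+ m2 *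
      (c * x + y) = f i (r i) ^+ m2 * (f i (r i) ^+ m0 * c) *
      (f i (r i) ^+ m1 * x) + f i (r i) ^+ m0 * f i (r i) ^+ m1 *
      (f i (r i) ^+ m2 * y) by ring.
  exact: aux.
move=> [m [a [Ja]]]; rewrite mulr1 -rmorphXn => e.
have [|M eM] := fker (r i ^+ m - a); first by rewrite rmorphB /= e subrr.
exists (M + m)%N; rewrite exprD.
by move/eqP: eM; rewrite mulrBr subr_eq0 => /eqP ->; exact: (idealM idJ).
Qed.

Lemma glued_image i : line_image (f i) glued = sval (Ls i).
Proof.
have [Lsub _ _] := svalP (Ls i).
rewrite eqEsubset; split.
  by apply: span_sub => // _ [v Hv <-]; exact: Hv.
move=> w /glued_dense H; apply/line_image_loc => //; exact: glued_submodule.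
Qed.

Lemma glued_unique (L : set 'rV[A]_N.+1) : is_line L ->
  (forall i, line_image (f i) L = sval (Ls i)) -> L = glued.
Proof.
move=> [Lsub _ _] LE; rewrite eqEsubset; split=> v Hv.
  by move=> i; rewrite -LE; exact: sub_line_image.
pose J : set A := [set a | L (a *: v)].
suff : J 1 by rewrite /J /= scale1r.
apply: loc_ideal_unit.
  split=> [|c a b Ha Hb]; rewrite /J /=; first by rewrite scale0r; exact: (rowsub0 Lsub).
  by rewrite scalerDl [c *: a]/(c * a) -scalerA; exact: (rowsubZD _ Lsub).
move=> i; have := Hv i; rewrite -LE => /(line_image_loc (floc i) _ Lsub).
move=> [m [v' [Lv' e]]].
have [|M eM] := loc_row_eq (floc i) (u := r i ^+ m *: v) (v := v').
  by rewrite map_mxZ rmorphXn.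
by exists (M + m)%N; rewrite /J /= exprD -scalerA eM; by apply rowsubZ.
Qed.

End GlueLines.

(** An element t is encoded as the line spanned by (1, t), so that gluing of elements is an instance
    of gluing of lines in the projective line. *)
Lemma glue_elements (xs : forall i, B i) :
  (forall i j (D : comAlgType k) (g : {lrmorphism B i -> D})
        (h : {lrmorphism B j -> D}),
      g \o f i =1 h \o f j -> g (xs i) = h (xs j)) ->
  exists a, forall i, f i a = xs i.
Proof.
move=> agree.
pose u i : 'rV[B i]_2 := \row_(j < 2) if j == ord0 then 1 else xs i.
have u0 i : u i 0 ord0 = 1 by rewrite mxE.
pose Ls i : projective_space k 1 (B i) :=
  exist _ (line_of (u i)) (line_of_line (u0 i)).
have uM i (D : comAlgType k) (g : {lrmorphism B i -> D}) :
    map_mx g (u i) = \row_(j < 2) if j == ord0 then 1 else g (xs i).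
  by apply/rowP => l; rewrite !mxE; case: ifP => // _; rewrite rmorph1.
have Lagree i j (D : comAlgType k) (g : {lrmorphism B i -> D})
    (h : {lrmorphism B j -> D}) : g \o f i =1 h \o f j ->
    kmap (projective_space k 1) g (Ls i) = kmap (projective_space k 1) h (Ls j).
  move=> e; apply: sval_inj_prop; rewrite /= !line_image_of !uM.
  by rewrite (agree _ _ _ _ _ e).
have [Lsub _ _] := glued_line Lagree.
(* A global vector with first coordinate exactly 1 is wanted. The first coordinates of glued vectors
   form an ideal, and it contains a power of each [r i]. *)
pose J : set A := [set a | exists2 v, glued Ls v & a = v 0 ord0].
have : J 1.
  apply: loc_ideal_unit.
    split=> [|c a b [v Hv ->] [v' Hv' ->]].
      by exists 0; rewrite ?mxE //; exact: (rowsub0 Lsub).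
    by exists (c *: v + v'); [exact: (rowsubZD _ Lsub)|rewrite !mxE].
  move=> i; have [m [v [Hv e]]] := glued_dense Lagree (line_of_self (u i)).
  have [_ _ fker] := floc i.
  have [|M eM] := fker (r i ^+ m - v 0 ord0).
    move/rowP: e => /(_ ord0); rewrite !mxE mulr1 rmorphB rmorphXn /= => ->.
    exact: subrr.
  exists (M + m)%N; exists (r i ^+ M *: v); first by apply rowsubZ.
  by move/eqP: eM; rewrite mulrBr subr_eq0 -exprD !mxE => /eqP ->.
move=> [v Hv v0]; exists (v 0 ord_max) => i.
have [c ec] := Hv i; move/rowP: ec => ec.
have c1 : c = 1 by have := ec ord0; rewrite !mxE -v0 rmorph1 mulr1.
by have := ec ord_max; rewrite !mxE c1 mul1r.
Qed.

End Gluing.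

(** * The deformed product *)

(* [br a b n g] is the sum over i <= n of 'C(n, i) a^i b^(n - i) g i, written so
   that Pascal's rule is its definition. *)
Section Bracket.
Variables (A : comNzRingType) (V : lmodType A) (a b : A).

Fixpoint brm n (g : nat -> V) : V :=
  if n is m.+1 then b *: brm m g + a *: brm m (fun i => g i.+1) else g 0%N.

Lemma eq_brm n g g' : (forall i, (i <= n)%N -> g i = g' i) -> brm n g = brm n g'.
Proof.
elim: n g g' => [|n IH] g g' e /=; first exact: e.
by congr (_ *: _ + _ *: _); apply: IH => i le; apply: e; lia.
Qed.

Lemma brmZ n c g : brm n (fun i => c *: g i) = c *: brm n g.
Proof.
elim: n g => [|n IH] g //=; rewrite !IH scalerDr !scalerA.
by rewrite (mulrC b) (mulrC a).
Qed.

(** With S the shift of g, the bracket is (b + a S)^n applied to g at 0, so nested brackets multiply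
    these powers. *)
Lemma brm_brm m n (g : nat -> V) :
  brm m (fun i => brm n (fun j => g (i + j)%N)) = brm (m + n) g.
Proof.
elim: m g => [|m IH] g //=.
by rewrite -!IH.
Qed.

End Bracket.

Lemma brm_linear (A : comNzRingType) (V W : lmodType A) (a b : A) (F : V -> W) n g :
  (forall c u v, F (c *: u + v) = c *: F u + F v) ->
  F (brm a b n g) = brm a b n (fun i => F (g i)).
Proof.
move=> Flin; elim: n g => [|n IH] g //=.
have F0 : F 0 = 0.
  have := Flin 1 0 0; rewrite !scale1r addr0 => /eqP.
  by rewrite -subr_eq subrr eq_sym => /eqP.
have FZ c u : F (c *: u) = c *: F u by rewrite -[c *: u]addr0 Flin F0 addr0.
by rewrite Flin FZ !IH.
Qed.

Definition br (A : comNzRingType) (a b : A) n (g : nat -> A) : A :=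
  @brm A A^o a b n g.

Section RingBracket.
Variables (A : comNzRingType) (a b : A).

Lemma br0 g : br a b 0 g = g 0%N. Proof. by []. Qed.

Lemma brS n g : br a b n.+1 g = b * br a b n g + a * br a b n (fun i => g i.+1).
Proof. by []. Qed.

Lemma eq_br n g g' :
  (forall i, (i <= n)%N -> g i = g' i) -> br a b n g = br a b n g'.
Proof. exact: (@eq_brm A A^o). Qed.

Lemma brMl n c g : br a b n (fun i => c * g i) = c * br a b n g.
Proof. exact: (@brmZ A A^o). Qed.

Lemma brMr n c g : br a b n (fun i => g i * c) = br a b n g * c.
Proof. by rewrite mulrC -brMl; apply: eq_br => i _; rewrite mulrC. Qed.

Lemma br_br m n g :
  br a b m (fun i => br a b n (fun j => g (i + j)%N)) = br a b (m + n) g.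
Proof. exact: (@brm_brm A A^o). Qed.

Lemma br_rmorph (B : comNzRingType) (f : {rmorphism A -> B}) n g :
  f (br a b n g) = br (f a) (f b) n (fun i => f (g i)).
Proof.
by elim: n g => [|n IH] g //; rewrite !brS rmorphD !rmorphM !IH.
Qed.

Lemma br_a0 n g : a = 0 -> br a b n g = b ^+ n * g 0%N.
Proof.
move=> a0; elim: n g => [|n IH] g; first by rewrite mul1r.
by rewrite brS IH a0 mul0r addr0 mulrA exprS.
Qed.

Lemma br_b0 n g : b = 0 -> br a b n g = a ^+ n * g n.
Proof.
move=> b0; elim: n g => [|n IH] g; first by rewrite mul1r.
by rewrite brS !IH b0 mul0r add0r mulrA exprS.
Qed.

End RingBracket.

(* A tangent cone [dT] of the polar polygon and the slope [dh] of h along it;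
   by [dTD], the exponents of the deformed product of x_u and x_v stay in the
   cone. *)
Record deform (M : zmodType) := Deform {
  dw : M;
  dh : M -> int;
  dT : pred M;
  dh0 : dh 0 = 0;
  dhw : forall u, dh (u + dw) = dh u;
  dhD : forall u v, dh u + dh v <= dh (u + v);
  dT0 : dT 0;
  dTD : forall u v i, dT u -> dT v ->
    (i <= `|(dh (u + v) - dh u - dh v)%R|)%N -> dT (u + v + dw *+ i) }.

Section DeformTheory.
Variables (M : zmodType) (d : deform M).
Local Notation w := (dw d).
Local Notation h := (dh d).
Local Notation T := (dT d).

Definition dmu (u v : M) : nat := `|(h (u + v) - h u - h v)%R|%N.

Lemma dmuE u v : (dmu u v : int) = h (u + v) - h u - h v.
Proof. by rewrite /dmu gez0_abs // -addrA -opprD subr_ge0 dhD. Qed.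

Lemma dhwn u i : h (u + w *+ i) = h u.
Proof. by elim: i => [|i IH]; rewrite ?mulr0n ?addr0 // mulrS addrCA addrC dhw. Qed.

Lemma dmuC u v : dmu u v = dmu v u.
Proof. by rewrite /dmu [u + v]addrC addrAC. Qed.

Lemma dmu_w u v i j : dmu (u + w *+ i) (v + w *+ j) = dmu u v.
Proof. by rewrite /dmu addrACA -mulrnDr !dhwn. Qed.

Lemma dmuwl u v i : dmu (u + w *+ i) v = dmu u v.
Proof. by have := dmu_w u v i 0; rewrite mulr0n addr0. Qed.

Lemma dmu0 u : dmu 0 u = 0%N.
Proof. by rewrite /dmu dh0 add0r subr0 subrr. Qed.

(** [dmu] is the coboundary of h, hence a cocycle; the associativity of the deformed product rests
    on this identity. *)
Lemma dmuA u v z : (dmu u v + dmu (u + v) z = dmu v z + dmu u (v + z))%N.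
Proof.
apply/eqP; rewrite -eqz_nat !PoszD !dmuE (addrA u v z); apply/eqP; ring.
Qed.

(** A point of the chart with values in A. x is a total function to avoid dependent types, but only
    its values on the cone T matter. *)
Definition dhom (A : comNzRingType) (a b : A) (x : M -> A) : Prop :=
  x 0 = 1 /\ forall u v, T u -> T v ->
    x u * x v = br a b (dmu u v) (fun i => x (u + v + w *+ i)).

Section Dhom.
Variables (A : comNzRingType) (a b : A) (x : M -> A).
Hypothesis xhom : dhom a b x.

(** Formally (beta + alpha chi^w)^n x_u. *)
Definition dbr n u : A := br a b n (fun i => x (u + w *+ i)).

Lemma dbr0 u : dbr 0 u = x u.
Proof. by rewrite /dbr br0 mulr0n addr0. Qed.

Lemma dbr_dbr m n u :
  br a b m (fun i => dbr n (u + w *+ i)) = dbr (m + n) u.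
Proof.
rewrite /dbr -br_br; apply: eq_br => i _; apply: eq_br => j _.
by rewrite -addrA mulrnDr.
Qed.

(** In the formal reading the powers of beta + alpha chi^w add up, and the product of x_u and x_v
    contributes [dmu u v] more of them. *)
Lemma dbrM n m u v :
  (forall i, (i <= n)%N -> T (u + w *+ i)) ->
  (forall i, (i <= m)%N -> T (v + w *+ i)) ->
  dbr n u * dbr m v = dbr (n + m + dmu u v) (u + v).
Proof.
move=> Tu Tv; rewrite {1}/dbr -brMr.
transitivity (br a b n (fun i => dbr (m + dmu u v) (u + v + w *+ i))); last first.
  by rewrite dbr_dbr addnA.
apply: eq_br => i le_i_n; rewrite {1}/dbr -brMl -dbr_dbr.
apply: eq_br => j le_j_m; rewrite xhom.2; [|exact: Tu|exact: Tv].
rewrite dmu_w /dbr; apply: eq_br => l _; congr (x (_ + _)).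
by rewrite addrACA addrA.
Qed.

Lemma dbr_prod (I : Type) (s : seq I) (n : I -> nat) (u : I -> M) :
  (forall j i, (i <= n j)%N -> T (u j + w *+ i)) ->
  \prod_(j <- s) dbr (n j) (u j) =
  dbr `|(\sum_(j <- s) (n j : int) + h (\sum_(j <- s) u j)
        - \sum_(j <- s) h (u j))%R|%N (\sum_(j <- s) u j).
Proof.
move=> Tu.
suff [N [eN [-> _]]] : exists N : nat,
   (N : int) = \sum_(j <- s) (n j : int) + h (\sum_(j <- s) u j)
        - \sum_(j <- s) h (u j) /\
   (\prod_(j <- s) dbr (n j) (u j) = dbr N (\sum_(j <- s) u j) /\
   forall i, (i <= N)%N -> T (\sum_(j <- s) u j + w *+ i)).
  by rewrite -eN absz_nat.
elim: s => [|j s [N [eN [IH TN]]]].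
  exists 0%N; rewrite !big_nil dh0 dbr0 xhom.1; split=> //; split=> // i.
  by rewrite leqn0 => /eqP ->; rewrite mulr0n addr0 dT0.
exists (n j + N + dmu (u j) (\sum_(j <- s) u j))%N; rewrite !big_cons.
rewrite !PoszD eN dmuE; split; first by ring.
rewrite IH dbrM //; last exact: Tu.
split=> // i le.
(* The shift by i w is distributed over the first factor, the product of the others, and the product
   of the two; each share stays within the range for which membership in T is known. *)
have [i1 [i2 [i3 [-> le1 le2 le3]]]] : exists i1 i2 i3, [/\ i = (i1 + i2 + i3)%N,
    (i1 <= n j)%N, (i2 <= N)%N & (i3 <= dmu (u j) (\sum_(j <- s) u j))%N].
  have [l1|l1] := leqP i (n j); first by exists i, 0%N, 0%N; split=> //; lia.
  have [l2|l2] := leqP i (n j + N)%N.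
    by exists (n j), (i - n j)%N, 0%N; split=> //; lia.
  by exists (n j), N, (i - (n j + N))%N; split=> //; lia.
rewrite 2!mulrnDr !addrA -[_ + w *+ i1 + _]addrA [w *+ i1 + _]addrC.
have -> : u j + \sum_(j0 <- s) u j0 + (w *+ i2 + w *+ i1) =
   (u j + w *+ i1) + (\sum_(j0 <- s) u j0 + w *+ i2).
  by rewrite [w *+ i2 + _]addrC addrACA.
by apply: dTD; [exact: Tu|exact: TN|rewrite -/(dmu _ _) dmu_w].
Qed.

End Dhom.

End DeformTheory.

(** * The algebra of finitely supported functions with the deformed product *)

Section LinearExtension.
Variables (M : choiceType) (K : comNzRingType) (V : lmodType K).
Implicit Types (F : M -> V) (a : malg M K).

Definition lext F a : V := \sum_(u <- monalg.msupp a) mcoeff u a *: F u.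

Lemma lextEw (D : {fset M}) F a : fsubset (monalg.msupp a) D ->
  lext F a = \sum_(u <- D) mcoeff u a *: F u.
Proof.
move=> le; rewrite [LHS](big_fset_incl _ le) => //= x xd /mcoeff_outdom ->.
by rewrite scale0r.
Qed.

Lemma lext_linear F c a b : lext F (c *: a + b) = c *: lext F a + lext F b.
Proof.
pose D := fsetU (monalg.msupp (c *: a + b)) (fsetU (monalg.msupp a) (monalg.msupp b)).
rewrite !(@lextEw D) /D; first last.
- exact: fsubsetUl.
- exact: (fsubset_trans (fsubsetUl _ _) (fsubsetUr _ _)).
- exact: (fsubset_trans (fsubsetUr _ _) (fsubsetUr _ _)).
rewrite scaler_sumr -big_split /=; apply: eq_bigr => u _.
by rewrite mcoeffD mcoeffZ scalerDl scalerA.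
Qed.

Lemma lextU F u : lext F (mkmalgU u 1) = F u.
Proof.
by rewrite (lextEw _ msuppU_le) big_seq_fset1 mcoeffUU scale1r.
Qed.

Lemma lext0 F : lext F 0 = 0.
Proof. by rewrite /lext msupp0 big_seq_fset0. Qed.

Lemma lext_addF F G a : lext (fun u => F u + G u) a = lext F a + lext G a.
Proof. by rewrite -big_split; apply: eq_bigr => u _; rewrite scalerDr. Qed.

Lemma lext_scaleF F c a : lext (fun u => c *: F u) a = c *: lext F a.
Proof.
by rewrite scaler_sumr; apply: eq_bigr => u _; rewrite !scalerA mulrC.
Qed.

Lemma eq_lext F G a :
  (forall u, mcoeff u a != 0 -> F u = G u) -> lext F a = lext G a.
Proof.
move=> e; rewrite /lext big_seq [RHS]big_seq; apply: eq_bigr => u.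
by rewrite -mcoeff_neq0 => /e ->.
Qed.

End LinearExtension.

Section MalgInd.
Variables (M : choiceType) (K : comNzRingType).

Lemma malg_lext (a : malg M K) : a = lext (fun u => mkmalgU u 1) a.
Proof.
rewrite {1}[a]monalgE; apply: eq_bigr => u _.
by apply/malgP => v; rewrite mcoeffZ !mcoeffU mulr_natr.
Qed.

Lemma malg_ind (P : malg M K -> Prop) (a : malg M K) : P 0 ->
  (forall c u b, mcoeff u a != 0 -> P b -> P (c *: mkmalgU u 1 + b)) -> P a.
Proof.
move=> P0 PS; rewrite [a]malg_lext /lext big_seq.
elim/big_rec: _ => // u b; rewrite -mcoeff_neq0 => ua Pb; exact: PS.
Qed.

End MalgInd.

Lemma scalerD_congr (K : comNzRingType) (V : lmodType K) (c : K) (x x' y : V) :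
  x = x' -> c *: x + y = c *: x' + y.
Proof. by move->. Qed.

Section DeformProduct.
Variables (K : comNzRingType) (alpha beta : K) (M : zmodType) (d : deform M).
Local Notation w := (dw d).
Local Notation U u := (mkmalgU u (1 : K)).
Implicit Types a b : malg M K.

Definition dbrU n u : malg M K := brm alpha beta n (fun i => U (u + w *+ i)).

(* Locked: otherwise conversion unfolds products of finitely supported
   functions. *)
Fact dmul_key : unit. Proof. by []. Qed.
Definition dmul := locked_with dmul_key (fun a b : malg M K =>
  lext (fun u => lext (fun v => dbrU (dmu d u v) (u + v)) b) a).

Lemma dmulE a b :
  dmul a b = lext (fun u => lext (fun v => dbrU (dmu d u v) (u + v)) b) a.
Proof. by rewrite /dmul unlock. Qed.

Lemma dmul_linl c a a' b : dmul (c *: a + a') b = c *: dmul a b + dmul a' b.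
Proof. by rewrite !dmulE; exact: lext_linear. Qed.

Lemma dmul_linr c a b b' : dmul a (c *: b + b') = c *: dmul a b + dmul a b'.
Proof.
rewrite !dmulE -lext_scaleF -lext_addF.
by apply: eq_lext => u _; exact: lext_linear.
Qed.

Lemma dmulUU u v : dmul (U u) (U v) = dbrU (dmu d u v) (u + v).
Proof. by rewrite dmulE lextU lextU. Qed.

Lemma dmul0l b : dmul 0 b = 0. Proof. by rewrite dmulE; exact: lext0. Qed.

Lemma dmul0r a : dmul a 0 = 0.
Proof.
have := dmul_linr 1 a 0 0; rewrite !scale1r addr0 => /eqP.
by rewrite -subr_eq subrr eq_sym => /eqP.
Qed.

Lemma malg_full_ind (P : malg M K -> Prop) : P 0 ->
  (forall c u b, P b -> P (c *: U u + b)) -> forall a, P a.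
Proof. by move=> P0 PS a; apply: malg_ind => // c u b _; exact: PS. Qed.

Lemma dmulC : commutative dmul.
Proof.
elim/malg_full_ind => [|c u a IH] b; first by rewrite dmul0l dmul0r.
rewrite dmul_linl dmul_linr IH; apply: scalerD_congr.
elim/malg_full_ind: b => [|c' v b IHb]; first by rewrite dmul0l dmul0r.
rewrite dmul_linl dmul_linr IHb; apply: scalerD_congr.
by rewrite !dmulUU dmuC [u + v]addrC.
Qed.

Lemma dmul_brU n u v : dmul (dbrU n u) (U v) = dbrU (n + dmu d u v) (u + v).
Proof.
transitivity (brm alpha beta n (fun i => dbrU (dmu d u v) (u + v + w *+ i))).
  rewrite /dbrU (brm_linear _ _ (F := fun a => dmul a (U v))); last first.
    by move=> c a b; exact: dmul_linl.
  apply: eq_brm => i _; rewrite dmulUU dmuwl.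
  by apply: eq_brm => j _; rewrite [u + _ + v]addrAC.
rewrite /dbrU -brm_brm; apply: eq_brm => i _; apply: eq_brm => j _.
by rewrite -addrA mulrnDr.
Qed.

(** By trilinearity basis elements suffice; there both sides are brackets at the same exponent, of
    equal length by the cocycle identity [dmuA]. *)
Lemma dmulA : associative dmul.
Proof.
move=> a b z; elim/malg_full_ind: a => [|c u a IHa]; first by rewrite !dmul0l.
rewrite !dmul_linl {}IHa; apply: scalerD_congr.
elim/malg_full_ind: b => [|c' v b IHb]; first by rewrite dmul0l !dmul0r dmul0l.
rewrite !(dmul_linl, dmul_linr) {}IHb; apply: scalerD_congr.
elim/malg_full_ind: z => [|c'' t z IHz]; first by rewrite !dmul0r.
rewrite !dmul_linr {}IHz; apply: scalerD_congr.
rewrite dmulC !dmulUU !dmul_brU.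
by rewrite (dmuC _ (v + t) u) dmuA [v + t + u]addrC addrA.
Qed.

Lemma dmul1l : left_id (U 0) dmul.
Proof.
elim/malg_full_ind => [|c u a IH]; first by rewrite dmul0r.
rewrite dmul_linr IH; apply: scalerD_congr.
by rewrite dmulUU dmu0 /dbrU /= add0r mulr0n addr0.
Qed.

Lemma dmulDl : left_distributive dmul +%R.
Proof. by move=> a a' b; have := dmul_linl 1 a a' b; rewrite !scale1r. Qed.

End DeformProduct.

Section DeformAlgebra.
Variables (k : fieldType) (M : zmodType).

(* The ring of the chart with exponents in all of M; [K] will be k[alpha, beta]. *)
Record dalg (K : comAlgType k) (alpha beta : K) (d : deform M) :=
  DAlg { dval : malg M K }.
HB.instance Definition _ (K : comAlgType k) (alpha beta : K) (d : deform M) := [isNew for @dval K alpha beta d].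
HB.instance Definition _ (K : comAlgType k) (alpha beta : K) (d : deform M) := [Choice of dalg alpha beta d by <:].

Variables (K : comAlgType k) (alpha beta : K) (d : deform M).
Local Notation w := (dw d).
Local Notation T := (dT d).
Implicit Types a b : dalg alpha beta d.

Lemma dval_inj : injective (@dval K alpha beta d).
Proof. by case=> a [b] /= ->. Qed.

Definition dadd a b := DAlg alpha beta d (dval a + dval b).
Definition dopp a := DAlg alpha beta d (- dval a).

Lemma daddA : associative dadd.
Proof. by move=> a b c; rewrite /dadd /= addrA. Qed.
Lemma daddC : commutative dadd.
Proof. by move=> a b; rewrite /dadd addrC. Qed.
Lemma dadd0 : left_id (DAlg alpha beta d 0) dadd.
Proof. by move=> a; apply: dval_inj; rewrite /= add0r. Qed.
Lemma daddN : left_inverse (DAlg alpha beta d 0) dopp dadd.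
Proof. by move=> a; rewrite /dadd /= addNr. Qed.

HB.instance Definition _ := GRing.isZmodule.Build (dalg alpha beta d) daddA daddC dadd0 daddN.

Definition dmulr a b := DAlg alpha beta d (dmul alpha beta d (dval a) (dval b)).
Definition dU (u : M) : dalg alpha beta d := DAlg alpha beta d (mkmalgU u 1).

Lemma dmulrA : associative dmulr.
Proof. by move=> a b c; rewrite /dmulr /= dmulA. Qed.
Lemma dmulrC : commutative dmulr.
Proof. by move=> a b; rewrite /dmulr dmulC. Qed.
Lemma dmulr1 : left_id (dU 0) dmulr.
Proof. by move=> a; apply: dval_inj; rewrite /= dmul1l. Qed.
Lemma dmulrDl : left_distributive dmulr +%R.
Proof. by move=> a b c; rewrite /dmulr /= dmulDl. Qed.
Lemma dU_neq0 : dU 0 != 0.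
Proof.
apply/eqP => /(congr1 (@dval K alpha beta d)) /= /eqP.
by rewrite monalgU_eq0 oner_eq0.
Qed.

HB.instance Definition _ := GRing.Zmodule_isComNzRing.Build (dalg alpha beta d)
  dmulrA dmulrC dmulr1 dmulrDl dU_neq0.

Lemma dvalD a b : dval (a + b) = dval a + dval b. Proof. by []. Qed.
Lemma dvalM a b : dval (a * b) = dmul alpha beta d (dval a) (dval b).
Proof. by []. Qed.
Lemma dval0 : dval 0 = 0. Proof. by []. Qed.

Definition dscal (c : K) a : dalg alpha beta d := DAlg alpha beta d (c *: dval a).
Definition dcoeff (u : M) a : K := mcoeff u (dval a).

Lemma dscalA c c' a : dscal c (dscal c' a) = dscal (c * c') a.
Proof. by rewrite /dscal /= scalerA. Qed.
Lemma dscal1 : left_id 1 dscal.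
Proof. by move=> a; apply: dval_inj; rewrite /= scale1r. Qed.
Lemma dscalDr : right_distributive dscal +%R.
Proof. by move=> c a b; apply: dval_inj; rewrite /= scalerDr. Qed.
Lemma dscalDl a : {morph dscal^~ a : c c' / c + c'}.
Proof. by move=> c c'; apply: dval_inj; rewrite /= scalerDl. Qed.

Lemma dscal_mull c a b : dscal c (a * b) = dscal c a * b.
Proof.
apply: dval_inj; rewrite dvalM /=.
have := dmul_linl alpha beta d c (dval a) 0 (dval b).
by rewrite dmul0l !addr0 => ->.
Qed.

Definition dscalk (c : k) a : dalg alpha beta d := dscal c%:A a.

Lemma dscalkA c c' a : dscalk c (dscalk c' a) = dscalk (c * c') a.
Proof. by rewrite /dscalk dscalA -scalerAl mul1r scalerA. Qed.
Lemma dscalk1 : left_id 1 dscalk.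
Proof. by move=> a; rewrite /dscalk scale1r dscal1. Qed.
Lemma dscalkDr : right_distributive dscalk +%R.
Proof. by move=> c a b; exact: dscalDr. Qed.
Lemma dscalkDl a : {morph dscalk^~ a : c c' / c + c'}.
Proof. by move=> c c'; rewrite /dscalk scalerDl dscalDl. Qed.
HB.instance Definition _ := GRing.Zmodule_isLmodule.Build k (dalg alpha beta d)
  dscalkA dscalk1 dscalkDr dscalkDl.

Lemma dalg_scaleAl (c : k) a b : c *: (a * b) = c *: a * b.
Proof. exact: dscal_mull. Qed.
HB.instance Definition _ := GRing.Lmodule_isLalgebra.Build k (dalg alpha beta d) dalg_scaleAl.
Lemma dalg_scaleAr (c : k) a b : c *: (a * b) = a * (c *: b).
Proof. by rewrite mulrC dalg_scaleAl mulrC. Qed.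
HB.instance Definition _ := GRing.Lalgebra_isAlgebra.Build k (dalg alpha beta d) dalg_scaleAr.

Lemma dval_br n (g : nat -> dalg alpha beta d) :
  dval (br (dscal alpha 1) (dscal beta 1) n g) =
  brm alpha beta n (fun i => dval (g i)).
Proof.
by elim: n g => [|n IH] g //; rewrite brS dvalD -!dscal_mull !mul1r /= !IH.
Qed.

Lemma dUU u v : dU u * dU v =
  br (dscal alpha 1) (dscal beta 1) (dmu d u v) (fun i => dU (u + v + dw d *+ i)).
Proof. by apply: dval_inj; rewrite dvalM dmulUU dval_br. Qed.

Definition dsupp : {pred dalg alpha beta d} := fun a => all T (monalg.msupp (dval a)).

Lemma dsuppP a : reflect (forall u, dcoeff u a != 0 -> T u) (a \in dsupp).
Proof.
apply: (iffP allP) => H u; first by rewrite mcoeff_neq0; exact: H.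
by rewrite -mcoeff_neq0; exact: H.
Qed.

Lemma dsupp0 : 0 \in dsupp.
Proof. by apply/dsuppP => u; rewrite /dcoeff mcoeff0 eqxx. Qed.

Lemma dsupp_lin (c : K) a b : a \in dsupp -> b \in dsupp -> dscal c a + b \in dsupp.
Proof.
move=> /dsuppP aT /dsuppP bT; apply/dsuppP => u.
rewrite /dcoeff dvalD mcoeffD mcoeffZ => cu.
have [au|/aT//] := eqVneq (dcoeff u a) 0.
by apply: bT; move: cu; rewrite -/(dcoeff u a) au mulr0 add0r.
Qed.

Lemma dsupp_scal (c : K) a : a \in dsupp -> dscal c a \in dsupp.
Proof. by move=> aT; rewrite -[dscal _ _]addr0 dsupp_lin ?dsupp0. Qed.

Lemma dsuppU u : T u -> dU u \in dsupp.
Proof.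
move=> Tu; apply/dsuppP => v; rewrite /dcoeff mcoeffU.
by have [<-|_] := eqVneq u v => //; rewrite mulr0n eqxx.
Qed.

Lemma dsupp_br n (g : nat -> dalg alpha beta d) : (forall i, (i <= n)%N -> g i \in dsupp) ->
  br (dscal alpha 1) (dscal beta 1) n g \in dsupp.
Proof.
elim: n g => [|n IH] g gT; first exact: gT.
rewrite brS -!dscal_mull !mul1r; apply: dsupp_lin.
  by apply: IH => i le; apply: gT; lia.
by apply: dsupp_scal; apply: (IH (fun i => g i.+1)) => i le; exact: gT.
Qed.

Lemma dsupp_ind (P : dalg alpha beta d -> Prop) : P 0 ->
  (forall c u b, T u -> P b -> P (dscal c (dU u) + b)) ->
  forall a, a \in dsupp -> P a.
Proof.
move=> P0 PS [a] /dsuppP aT.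
have := @malg_ind M K (fun x => P (DAlg alpha beta d x)) a; apply=> // c u b ua Pb.
by apply: PS Pb; exact: aT.
Qed.

Lemma dsupp_subalg : subalg_closed dsupp.
Proof.
split; first exact/dsuppU/dT0.
  by move=> c a b; exact: dsupp_lin.
move=> a b aT bT; elim/dsupp_ind: a / aT => [|c u a Tu IH].
  by rewrite mul0r dsupp0.
rewrite mulrDl -dscal_mull; apply: dsupp_lin => //.
elim/dsupp_ind: b / bT {IH} => [|c' v b Tv IH]; first by rewrite mulr0 dsupp0.
rewrite mulrDr mulrC -dscal_mull mulrC; apply: dsupp_lin; last by [].
by rewrite dUU; apply: dsupp_br => i le; apply: dsuppU; exact: dTD.
Qed.
HB.instance Definition _ := GRing.isSubalgClosed.Build k (dalg alpha beta d) dsupp dsupp_subalg.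

End DeformAlgebra.

Section DeformChart.
Variables (k : fieldType) (M : zmodType).

Record dchart (K : comAlgType k) (alpha beta : K) (d : deform M) :=
  DChart { dchart_val : dalg alpha beta d; _ : dchart_val \in @dsupp k M K alpha beta d }.

Variables (K : comAlgType k) (alpha beta : K) (d : deform M).
HB.instance Definition _ := [isSub for @dchart_val K alpha beta d].
HB.instance Definition _ := [Choice of dchart alpha beta d by <:].
HB.instance Definition _ := [SubChoice_isSubAlgebra of dchart alpha beta d by <:].
HB.instance Definition _ := [SubNzRing_isSubComNzRing of dchart alpha beta d by <:].

Local Notation w := (dw d).
Local Notation h := (dh d).
Local Notation T := (dT d).

Definition chart_alg : comAlgType k := dchart alpha beta d.

(** Scaling by k[alpha, beta] is a plain operation, as the algebra structure registered on the chart
    is the one over k. *)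
Definition cscal (c : K) (a : chart_alg) : chart_alg :=
  insubd (0 : dchart alpha beta d) (dscal c (val a)).

Lemma val_cscal c a : val (cscal c a) = dscal c (val a).
Proof.
rewrite val_insubd; have -> // : dscal c (val a) \in @dsupp k M K alpha beta d.
by rewrite -[dscal _ _]addr0; apply: dsupp_lin; [exact: valP|exact: dsupp0].
Qed.

(** The default 0 is the value for u outside the cone. *)
Definition cU (u : M) : chart_alg := insubd (0 : dchart alpha beta d) (dU alpha beta d u).

Lemma val_cU u : T u -> val (cU u) = dU alpha beta d u.
Proof. by move=> Tu; rewrite val_insubd dsuppU. Qed.

Lemma chart_ind (P : chart_alg -> Prop) : P 0 ->
  (forall c u b, T u -> P b -> P (cscal c (cU u) + b)) -> forall a, P a.
Proof.
move=> P0 PS a; rewrite -[a](valKd (0 : chart_alg)).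
pose Q b := P (insubd (0 : dchart alpha beta d) b).
suff [] : val a \in @dsupp k M K alpha beta d /\ Q (val a) by [].
apply: (@dsupp_ind k M K alpha beta d
  (fun b => b \in @dsupp k M K alpha beta d /\ Q b)) (valP a).
  split; first exact: dsupp0.
  rewrite /Q (_ : insubd _ _ = 0) //.
  by apply: val_inj; rewrite val_insubd dsupp0 rmorph0.
move=> c u b Tu [bT Qb].
have cT : dscal c (dU alpha beta d u) + b \in @dsupp k M K alpha beta d.
  by apply: dsupp_lin => //; exact: dsuppU.
split=> //; rewrite /Q (_ : insubd _ _ = cscal c (cU u) + insubd 0 b).
  exact/PS/Qb.
by apply: val_inj; rewrite val_insubd cT rmorphD /= val_cscal val_cU // val_insubd bT.
Qed.

Lemma cscalDl c c' a : cscal (c + c') a = cscal c a + cscal c' a.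
Proof. by apply: val_inj; rewrite rmorphD /= !val_cscal dscalDl. Qed.

Lemma cscalA c c' a : cscal c (cscal c' a) = cscal (c * c') a.
Proof. by apply: val_inj; rewrite !val_cscal dscalA. Qed.

Lemma cscal1 a : cscal 1 a = a.
Proof. by apply: val_inj; rewrite val_cscal dscal1. Qed.

Lemma cscal0 a : cscal 0 a = 0.
Proof.
apply: val_inj; rewrite val_cscal rmorph0; apply: dval_inj.
by rewrite /dscal /= scale0r.
Qed.

Lemma cscalMl c a b : cscal c (a * b) = cscal c a * b.
Proof. by apply: val_inj; rewrite rmorphM /= !val_cscal rmorphM /= dscal_mull. Qed.

Lemma cscal_alg (c : k) a : cscal c%:A a = c *: a.
Proof. by apply: val_inj; rewrite linearZ /= val_cscal. Qed.

Definition cst (c : K) : chart_alg := cscal c 1.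

Lemma cstM c a : cst c * a = cscal c a.
Proof. by rewrite /cst -cscalMl mul1r. Qed.

Lemma cst_lrmorphism : exists f : {lrmorphism K -> chart_alg}, f =1 cst.
Proof.
apply: lrmorphism_build.
- move=> c c'; rewrite /cst cscalDl; congr (_ + _).
  by apply/eqP; rewrite -addr_eq0 -cscalDl addNr cscal0.
- split; first exact: cscal1.
  by move=> c c'; rewrite cstM /cst cscalA.
by move=> c c'; rewrite /cst -mulr_algl -cscalA cscal_alg.
Qed.

Lemma chart_dhom : dhom d (cst alpha) (cst beta) cU.
Proof.
split; first by apply: val_inj; rewrite val_cU ?dT0 // rmorph1.
move=> u v Tu Tv; apply: val_inj.
rewrite rmorphM br_rmorph /= !val_cU // dUU /cst !val_cscal rmorph1.
by apply: eq_br => i le; rewrite val_cU //; exact: dTD.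
Qed.

Section ChartHom.
Variables (A : comAlgType k) (ev : {lrmorphism K -> A}) (x : M -> A).
Hypothesis xhom : dhom d (ev alpha) (ev beta) x.

Definition chart_ev (a : dalg alpha beta d) : A :=
  \sum_(u <- monalg.msupp (dval a)) ev (dcoeff u a) * x u.

Let chart_evEw (D : {fset M}) a : fsubset (monalg.msupp (dval a)) D ->
  chart_ev a = \sum_(u <- D) ev (dcoeff u a) * x u.
Proof.
move=> le; rewrite [LHS](big_fset_incl _ le) => //= v xd /mcoeff_outdom.
by rewrite /dcoeff => ->; rewrite rmorph0 mul0r.
Qed.

Let chart_ev_lin c a b : chart_ev (dscal c a + b) = ev c * chart_ev a + chart_ev b.
Proof.
pose D := fsetU (monalg.msupp (dval (dscal c a + b)))
  (fsetU (monalg.msupp (dval a)) (monalg.msupp (dval b))).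
rewrite !(@chart_evEw D) /D; first last.
- exact: fsubsetUl.
- exact: (fsubset_trans (fsubsetUl _ _) (fsubsetUr _ _)).
- exact: (fsubset_trans (fsubsetUr _ _) (fsubsetUr _ _)).
rewrite mulr_sumr -big_split /=; apply: eq_bigr => u _.
by rewrite /dcoeff [mcoeff _ _]mcoeffD mcoeffZ rmorphD rmorphM mulrDl mulrA.
Qed.

Let chart_ev0 : chart_ev 0 = 0.
Proof. by rewrite /chart_ev msupp0 big_seq_fset0. Qed.

Let chart_evD a b : chart_ev (a + b) = chart_ev a + chart_ev b.
Proof.
by have := chart_ev_lin 1 a b; rewrite dscal1 rmorph1 mul1r.
Qed.

Let chart_evZ c a : chart_ev (dscal c a) = ev c * chart_ev a.
Proof. by rewrite -[dscal c a]addr0 chart_ev_lin chart_ev0 addr0. Qed.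

Let chart_evU u : chart_ev (dU alpha beta d u) = x u.
Proof.
by rewrite (@chart_evEw [fset u]%fset (dU alpha beta d u) msuppU_le) big_seq_fset1 /dcoeff mcoeffUU rmorph1 mul1r.
Qed.

Let chart_evM a b : a \in @dsupp k M K alpha beta d -> b \in @dsupp k M K alpha beta d ->
  chart_ev (a * b) = chart_ev a * chart_ev b.
Proof.
move=> aT bT; elim/dsupp_ind: b / bT => [|c v b Tv IH].
  by rewrite mulr0 chart_ev0 mulr0.
rewrite mulrDr [a * dscal _ _]mulrC -dscal_mull [dU _ _ _ v * a]mulrC.
rewrite !chart_ev_lin {}IH chart_evU mulrDr [chart_ev a * (_ * _)]mulrCA.
congr (_ * _ + _).
elim/dsupp_ind: a / aT => [|c' u a Tu IH].
  by rewrite mul0r chart_ev0 mul0r.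
rewrite mulrDl -dscal_mull !chart_ev_lin mulrDl -mulrA {}IH; congr (_ * _ + _).
rewrite chart_evU xhom.2 // dUU.
have: (forall n (g : nat -> M), chart_ev (br (dscal alpha 1) (dscal beta 1) n
   (fun i => dU alpha beta d (g i))) = br (ev alpha) (ev beta) n (fun i => x (g i))).
  elim=> [|n IHn] g; first exact: chart_evU.
  rewrite !brS -!dscal_mull !mul1r chart_ev_lin chart_evZ IHn.
  by rewrite (IHn (fun i => g i.+1)).
by move=> ->.
Qed.

(** With [chart_hom_ext] this says that the chart represents the functor of solutions [dhom], the
    tautological solution being [chart_dhom]. *)
Lemma chart_hom : exists phi : {lrmorphism chart_alg -> A},
  (forall c, phi (cst c) = ev c) /\ (forall u, T u -> phi (cU u) = x u).
Proof.
have [| | |phi phiE] := @lrmorphism_build k chart_alg A (fun a => chart_ev (val a)).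
- move=> a b; rewrite rmorphB /= -[- val b](_ : dscal (-1) (val b) = _).
    by rewrite chart_evD chart_evZ rmorphN rmorph1 mulN1r.
  by apply: dval_inj; rewrite /= scaleN1r.
- split; first by rewrite rmorph1 [1]/(dU alpha beta d 0) chart_evU xhom.1.
  by move=> a b; rewrite rmorphM /= chart_evM //; exact: valP.
- move=> c a; rewrite linearZ /= chart_evZ.
  by rewrite linearZ /= rmorph1 mulr_algl.
exists phi; split=> [c|u Tu]; rewrite phiE.
  by rewrite /cst val_cscal chart_evZ rmorph1 [1]/(dU alpha beta d 0) chart_evU xhom.1 mulr1.
by rewrite val_cU // chart_evU.
Qed.

End ChartHom.

Lemma chart_hom_ext (A : comAlgType k) (f g : {lrmorphism chart_alg -> A}) :
  (forall c, f (cst c) = g (cst c)) -> (forall u, T u -> f (cU u) = g (cU u)) ->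
  f = g.
Proof.
move=> ec eU; apply: lrmorphism_ext; elim/chart_ind => [|c u b Tu IH].
  by rewrite !rmorph0.
by rewrite !rmorphD -cstM !rmorphM /= ec eU // IH.
Qed.

(** The chart is free over K on the x_u with u in T. Each coefficient function gives a bilinear map
    that reads off one coordinate of the tensor; it vanishes after g, hence before g by injectivity,
    and the coordinates determine the tensor. *)
Lemma chart_flat (f : {lrmorphism K -> chart_alg}) : f =1 cst -> flat_algebra f.
Proof.
move=> fE N N' g ginj s Hs Z b bDl bDr bZl bZr.
have b0l a : b 0 a = 0.
  by have := bDl a 0 0; rewrite addr0 => /eqP; rewrite -subr_eq subrr eq_sym => /eqP.
have b0r n : b n 0 = 0.
  by have := bDr n 0 0; rewrite addr0 => /eqP; rewrite -subr_eq subrr eq_sym => /eqP.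
pose co (u : M) (a : chart_alg) : K := dcoeff u (val a).
have key u : \sum_(p <- s) co u p.2 *: p.1 = 0.
  apply: ginj; rewrite linear_sum linear0 /=.
  rewrite -[RHS](Hs N' (fun n a => co u a *: n)).
  - by rewrite big_map; apply: eq_bigr => p _; rewrite linearZ.
  - by move=> a m n; rewrite scalerDr.
  - by move=> n a a'; rewrite /co /dcoeff rmorphD /= [mcoeff _ _]mcoeffD scalerDl.
  - by move=> c n a; rewrite !scalerA mulrC.
  - by move=> c n a; rewrite fE cstM /co val_cscal [dcoeff _ _]mcoeffZ scalerA.
pose D : {fset M} := \big[fsetU/fset0]_(p <- s) monalg.msupp (dval (val p.2)).
have bE n a : fsubset (monalg.msupp (dval (val a))) D ->
    b n a = \sum_(u <- D) co u a *: b n (cU u).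
  move=> le.
  have e : a = \sum_(u <- D) cscal (co u a) (cU u).
    apply: val_inj; rewrite rmorph_sum; apply: dval_inj.
    rewrite /= (big_morph _ (@dvalD _ _ _ _ _ d) (@dval0 _ _ _ _ _ d)).
    rewrite [LHS](monalgEw le); apply: eq_bigr => u _; rewrite val_cscal.
    have [z|nz] := eqVneq (co u a) 0.
      by rewrite z /dscal /= scale0r [mcoeff _ _]z monalgU0.
    rewrite val_cU; last by move: (valP a) => /dsuppP; apply.
    by apply/malgP => v; rewrite mcoeffZ !mcoeffU mulr_natr.
  have bsum r (F : M -> chart_alg) : b n (\sum_(u <- r) F u) = \sum_(u <- r) b n (F u).
    by elim: r => [|u r IH]; rewrite ?big_nil ?big_cons ?b0r // bDr IH.
  by rewrite {1}e bsum; apply: eq_bigr => u _; rewrite -cstM -fE bZr.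
have sD p : p \in s -> fsubset (monalg.msupp (dval (val p.2))) D.
  rewrite /D; elim: (s) => // q r IH; rewrite inE big_cons => /orP[/eqP->|/IH le].
    exact: fsubsetUl.
  exact: (fsubset_trans le (fsubsetUr _ _)).
transitivity (\sum_(u <- D) b (\sum_(p <- s) co u p.2 *: p.1) (cU u)); last first.
  by rewrite big1 // => u _; rewrite key b0l.
have bsum u (r : seq (N * chart_alg)) (F : N * chart_alg -> N) :
    b (\sum_(p <- r) F p) (cU u) = \sum_(p <- r) b (F p) (cU u).
  by elim: r => [|p r IH]; rewrite ?big_nil ?big_cons ?b0l // bDl IH.
under [RHS]eq_bigr do rewrite bsum.
rewrite exchange_big /= big_seq [RHS]big_seq; apply: eq_bigr => p ps.
by rewrite bE ?sD //; apply: eq_bigr => u _; rewrite bZl.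
Qed.

End DeformChart.

(** * The projective family and its charts *)

Lemma ideal_gen_image (A B : comNzRingType) (f : {rmorphism A -> B}) (G : set A) :
  ideal_gen G 1 -> ideal_gen (f @` G) 1.
Proof.
move=> G1; have idJ := ideal_gen_ideal (f @` G).
pose W : set A := [set a | ideal_gen (f @` G) (f a)].
suff : W 1 by rewrite /W /= rmorph1.
apply: (ideal_gen_min (J := W)) G1 => [|a Ga].
  split=> [|c a b Wa Wb]; rewrite /W /=; first by rewrite rmorph0; exact: (ideal0 idJ).
  by rewrite rmorphD [c *: a]/(c * a) rmorphM; apply: (idealD idJ) => //; apply: (idealM idJ).
by apply: sub_ideal_gen; exists a.
Qed.

Lemma dhom_rmorph (M : zmodType) (d : deform M) (A B : comNzRingType)
    (f : {rmorphism A -> B}) a b x :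
  dhom d a b x -> dhom d (f a) (f b) (f \o x).
Proof.
move=> [x1 xM]; split; first by rewrite /= x1 rmorph1.
by move=> u v Tu Tv; rewrite /= -rmorphM xM // br_rmorph.
Qed.

Section AffinePlane.
Variable k : fieldType.
Local Notation K := (mpoly 2 k).

Lemma plane_hom_exists (A : comAlgType k) (a b : A) :
  exists f : {lrmorphism K -> A}, f (coord_alpha k) = a /\ f (coord_beta k) = b.
Proof.
pose g : 'I_2 -> A := fun i => if i == ord0 then a else b.
pose phi := @mpoly.mmap 2 k A (GRing.in_alg A) g.
have [| | |f fE] := @lrmorphism_build k K A phi.
- exact: (@raddfB _ _ phi).
- by split; [exact: (@rmorph1 _ _ phi)|exact: (@rmorphM _ _ phi)].
- by move=> c p; rewrite /phi mpoly.mmapZ /= mulr_algl.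
exists f; rewrite !fE /phi /coord_alpha /coord_beta !mpoly.mmapX !mpoly.mmap1U.
by [].
Qed.

Lemma plane_hom_ext (A : comAlgType k) (f g : {lrmorphism K -> A}) :
  f (coord_alpha k) = g (coord_alpha k) -> f (coord_beta k) = g (coord_beta k) ->
  f = g.
Proof.
move=> ea eb; apply: lrmorphism_ext => p; elim/mpoly.mpolyind: p.
  by rewrite !rmorph0.
move=> c m p _ _ IH; rewrite !linearP /= IH; congr (_ *: _ + _).
rewrite mpoly.mpolyXE_id !rmorph_prod; apply: eq_bigr => i _.
rewrite !rmorphXn; congr (_ ^+ _).
case: i => [[|[|//]] lt_i_2].
  by rewrite (_ : Ordinal _ = ord0) //; exact: val_inj.
by rewrite (_ : Ordinal _ = ord_max) //; exact: val_inj.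
Qed.

Definition plane_hom (A : comAlgType k) (a b : A) : {lrmorphism K -> A} :=
  projT1 (cid (plane_hom_exists a b)).

Lemma plane_homa (A : comAlgType k) (a b : A) : plane_hom a b (coord_alpha k) = a.
Proof. by rewrite /plane_hom; case: cid => f []. Qed.

Lemma plane_homb (A : comAlgType k) (a b : A) : plane_hom a b (coord_beta k) = b.
Proof. by rewrite /plane_hom; case: cid => f []. Qed.

End AffinePlane.

Section Family.
Variables (k : fieldType) (M : zmodType) (w : M) (h : M -> int).
Variables (n : nat) (pt : 'I_n.+1 -> M).
Implicit Types c s : seq 'I_n.+1.

Definition psum c : M := \sum_(i <- c) pt i.
Definition hsum c : int := \sum_(i <- c) h (pt i).
(** In the formal picture the product of the coordinates in a balanced list is x at the sum, with no
    power of beta + alpha chi^w in front; [mus] is that power for an arbitrary list. *)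
Definition balanced c : Prop := h (psum c) = hsum c.
Definition mus c : nat := `|(h (psum c) - hsum c)%R|%N.

(* A monomial [s] is expanded in balanced monomials of the same degree.  Since
   the relations are homogeneous, they make sense on lines. *)
Definition satisfies (A : comNzRingType) (a b : A) (l : 'rV[A]_n.+1) : Prop :=
  forall s (c : nat -> seq 'I_n.+1),
    (forall i, (i <= mus s)%N ->
      [/\ size (c i) = size s, psum (c i) = psum s + w *+ i & balanced (c i)]) ->
    \prod_(i <- s) l 0 i = br a b (mus s) (fun j => \prod_(i <- c j) l 0 i).

Lemma prod_scale (A : comNzRingType) c (t : A) (l : 'rV[A]_n.+1) :
  \prod_(i <- c) (t *: l) 0 i = t ^+ size c * \prod_(i <- c) l 0 i.
Proof.
elim: c => [|i c IH]; first by rewrite !big_nil mul1r.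
by rewrite !big_cons IH mxE /= exprS mulrACA.
Qed.

Lemma satisfies_scale (A : comNzRingType) (a b t : A) l :
  satisfies a b l -> satisfies a b (t *: l).
Proof.
move=> H s c Hc; rewrite prod_scale (H s c Hc) -brMl; apply: eq_br => i le.
by rewrite prod_scale; have [-> _ _] := Hc i le.
Qed.

Lemma satisfies_map (A B : comNzRingType) (f : {rmorphism A -> B}) a b l :
  satisfies a b l -> satisfies (f a) (f b) (map_mx f l).
Proof.
move=> H s c Hc; transitivity (f (\prod_(i <- s) l 0 i)).
  by rewrite rmorph_prod; apply: eq_bigr => i _; rewrite mxE.
rewrite (H s c Hc) br_rmorph; apply: eq_br => i le.
by rewrite rmorph_prod; apply: eq_bigr => j _; rewrite mxE.
Qed.

(** Solutions are not closed under addition, so induction on the span is of no use. But for u in L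
    the vector f(u_i) l is a multiple of f(u), a solution; by homogeneity a power of f(u_i) kills
    the defect of l, and the f(u_i) generate the unit ideal. *)
Lemma satisfies_image (A B : comAlgType k) (f : {lrmorphism A -> B}) (a b : B) L :
  is_line L -> (forall l, L l -> satisfies a b (map_mx f l)) ->
  forall l, line_image f L l -> satisfies a b l.
Proof.
move=> Lline H l Ll s c Hc; apply/eqP; rewrite -subr_eq0; apply/eqP.
have [_ Lmin' _] := line_image_line f Lline.
have [_ _ L1] := Lline; have G1 := ideal_gen_image (f := f) L1.
apply: (torsion_unit G1) => _ [_ [u [i [Lu ->]] <-]].
exists (size s); set t := f (u 0 i).
have e : t *: l = (l 0 i) *: map_mx f u.
  apply/rowP => j; rewrite !mxE.
  by have := Lmin' _ _ (sub_line_image (f := f) Lu) Ll i j; rewrite !mxE => ->; rewrite mulrC.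
have := satisfies_scale (l 0 i) (H u Lu) Hc; rewrite -e prod_scale.
move=> e1; rewrite mulrBr e1 -brMl; apply/eqP; rewrite subr_eq0; apply/eqP.
by apply: eq_br => j le; rewrite prod_scale; have [-> _ _] := Hc j le.
Qed.

Definition family_point (A : comAlgType k) (t : A * A * Pn_pts n A) : Prop :=
  forall l, sval t.2 l -> satisfies t.1.1 t.1.2 l.

Definition family_pts (A : comAlgType k) : Type := {t | family_point (A := A) t}.

Lemma family_map_point (A B : comAlgType k) (f : {lrmorphism A -> B}) t :
  family_point t -> family_point ((f t.1.1, f t.1.2), Pn_map f t.2).
Proof.
move=> H l /=; apply: satisfies_image; first exact: svalP.
by move=> u Lu; apply: satisfies_map; exact: H.
Qed.

Definition family_map (A B : comAlgType k) (f : {lrmorphism A -> B})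
  (x : family_pts A) : family_pts B :=
  exist _ _ (family_map_point (f := f) (svalP x)).

Lemma family_map_id (A : comAlgType k) (f : {lrmorphism A -> A}) x :
  f =1 id -> family_map f x = x.
Proof.
move=> fid; apply: sval_inj_prop; case: x => [[[a b] L] H] /=.
by rewrite !fid Pn_map_id.
Qed.

Lemma family_map_comp (A B D : comAlgType k) (f : {lrmorphism A -> B})
    (g : {lrmorphism B -> D}) (e : {lrmorphism A -> D}) x :
  e =1 g \o f -> family_map e x = family_map g (family_map f x).
Proof.
move=> efg; apply: sval_inj_prop; case: x => [[[a b] L] H] /=.
by rewrite !efg (Pn_map_comp _ efg).
Qed.

Definition family : kfunctor k := KFunctor family_map_id family_map_comp.

Definition fam_a (A : comAlgType k) (x : family A) : A := (sval x).1.1.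
Definition fam_b (A : comAlgType k) (x : family A) : A := (sval x).1.2.
Definition fam_L (A : comAlgType k) (x : family A) : Pn_pts n A := (sval x).2.

Lemma fam_eq (A : comAlgType k) (x y : family A) :
  fam_a x = fam_a y -> fam_b x = fam_b y -> sval (fam_L x) = sval (fam_L y) ->
  x = y.
Proof.
move=> ea eb eL; apply: sval_inj_prop.
rewrite [sval x]surjective_pairing [sval y]surjective_pairing.
rewrite [(sval x).1]surjective_pairing [(sval y).1]surjective_pairing.
by rewrite -!/(fam_a _) -!/(fam_b _) -!/(fam_L _) ea eb (sval_inj_prop eL).
Qed.

Lemma fam_line_nat (A B : comAlgType k) (f : {lrmorphism A -> B}) (x : family A) :
  fam_L (kmap family f x) = kmap (projective_space k n) f (fam_L x).
Proof. by []. Qed.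

Definition fam_line : kmor family (projective_space k n) :=
  @KMor k family (projective_space k n) (fun A x => fam_L x) fam_line_nat.

Lemma fam_pi_nat (A B : comAlgType k) (f : {lrmorphism A -> B}) (x : family A) :
  plane_hom (fam_a (kmap family f x)) (fam_b (kmap family f x)) =
  kmap (affine_plane k) f (plane_hom (fam_a x) (fam_b x)).
Proof. by apply: plane_hom_ext; rewrite /= ?plane_homa ?plane_homb. Qed.

Definition fam_pi : kmor family (affine_plane k) :=
  @KMor k family (affine_plane k)
    (fun A x => plane_hom (fam_a x) (fam_b x)) fam_pi_nat.

(** The relations hold on a pulled-back line once they hold on the images of the vectors of L, so
    the closed condition is the vanishing of the defects of all relations on L itself. *)
Lemma fam_projective : projective fam_pi.
Proof.
exists n, fam_line; split.
  move=> A x y [eL /(congr1 (fun f : {lrmorphism _ -> _} => (f (coord_alpha k), f (coord_beta k))))].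
  rewrite !plane_homa !plane_homb => -[ea eb]; apply: fam_eq => //.
  by rewrite /fam_L -[(sval x).2]/(fam_L x) eL.
move=> A [L p]; pose a : A := (p : {lrmorphism _ -> A}) (coord_alpha k).
pose b : A := (p : {lrmorphism _ -> A}) (coord_beta k).
exists [set t | exists l s (c : nat -> seq _), [/\ sval L l, (forall i, (i <= mus s)%N ->
      [/\ size (c i) = size s, psum (c i) = psum s + w *+ i & balanced (c i)]) &
  t = \prod_(i <- s) l 0 i - br a b (mus s) (fun j => \prod_(i <- c j) l 0 i)]].
move=> B f; split.
  move=> [z [eL ep]] _ [l [s [c [Ll Hc ->]]]].
  have ea : fam_a z = f a.
    by have := congr1 (fun f : {lrmorphism _ -> _} => f (coord_alpha k)) ep;
      rewrite plane_homa.
  have eb : fam_b z = f b.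
    by have := congr1 (fun f : {lrmorphism _ -> _} => f (coord_beta k)) ep;
      rewrite plane_homb.
  have Ll' : sval (fam_L z) (map_mx f l) by rewrite eL; exact: sub_line_image.
  have := svalP z _ Ll' s c Hc; rewrite -/(fam_a z) -/(fam_b z) ea eb => e.
  rewrite rmorphB br_rmorph rmorph_prod.
  transitivity (\prod_(i <- s) (map_mx f l) 0 i -
     br (f a) (f b) (mus s) (fun j => \prod_(i <- c j) (map_mx f l) 0 i)).
    congr (_ - _); first by apply: eq_bigr => i _; rewrite mxE.
    by apply: eq_br => i _; rewrite rmorph_prod; apply: eq_bigr => j _; rewrite mxE.
  by rewrite e subrr.
move=> H.
have Hp : family_point ((f a, f b), Pn_map f L).
  apply: satisfies_image; first exact: svalP.
  move=> l Ll s c Hc; have := H _ (ex_intro _ l (ex_intro _ s (ex_intro _ c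
    (And3 Ll Hc erefl)))).
  rewrite rmorphB br_rmorph rmorph_prod => /eqP; rewrite subr_eq0 => /eqP e.
  transitivity (\prod_(i <- s) f (l 0 i)); first by apply: eq_bigr => i _; rewrite mxE.
  rewrite e; apply: eq_br => i _; rewrite rmorph_prod.
  by apply: eq_bigr => j _; rewrite mxE.
exists (exist _ _ Hp); congr (_, _).
by apply: plane_hom_ext; rewrite /= ?plane_homa ?plane_homb.
Qed.

Lemma fam_sheaf : zariski_sheaf family.
Proof.
move=> A m r B f xs r1 floc agree.
have [a aP] : exists a, forall i, f i a = fam_a (xs i).
  apply: (glue_elements r1 floc) => i j D g e gh.
  exact: (congr1 (fun x => fam_a x) (agree i j D g e gh)).
have [b bP] : exists b, forall i, f i b = fam_b (xs i).
  apply: (glue_elements r1 floc) => i j D g e gh.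
  exact: (congr1 (fun x => fam_b x) (agree i j D g e gh)).
have Lagree i j (D : comAlgType k) (g : {lrmorphism B i -> D})
    (e : {lrmorphism B j -> D}) : g \o f i =1 e \o f j ->
    kmap (projective_space k n) g (fam_L (xs i)) =
    kmap (projective_space k n) e (fam_L (xs j)).
  by move=> gh; exact: (congr1 (fun x => fam_L x) (agree i j D g e gh)).
pose L := glued f (fun i => fam_L (xs i)).
have Lline : is_line L by exact: (glued_line r1 floc Lagree).
have Hp : family_point ((a, b), exist _ L Lline : Pn_pts n A).
  move=> l Ll s c Hc /=; apply: (loc_separated r1 floc) => i.
  have := svalP (xs i) _ (Ll i) s c Hc; rewrite -/(fam_a _) -/(fam_b _) -aP -bP => e.
  rewrite rmorph_prod br_rmorph.
  transitivity (\prod_(j <- s) (map_mx (f i) l) 0 j).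
    by apply: eq_bigr => j _; rewrite mxE.
  rewrite e; apply: eq_br => j _; rewrite rmorph_prod.
  by apply: eq_bigr => j' _; rewrite mxE.
exists (exist _ _ Hp); split=> [i|y yP].
  by apply: fam_eq; [exact: aP|exact: bP|exact: (glued_image floc Lagree i)].
apply: fam_eq.
- apply: (loc_separated r1 floc) => i.
  exact: (etrans (aP i) (esym (congr1 (fun x => fam_a x) (yP i)))).
- apply: (loc_separated r1 floc) => i.
  exact: (etrans (bP i) (esym (congr1 (fun x => fam_b x) (yP i)))).
- apply/esym/(glued_unique r1 floc); first exact: svalP.
  by move=> i; rewrite -(yP i).
Qed.

Lemma fibre_sheaf (a b : k) : zariski_sheaf (fibre fam_pi a b).
Proof.
move=> A m r B f xs r1 floc agree.
have overE (D : comAlgType k) (x : family D) :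
    over_point fam_pi a b x <-> fam_a x = a%:A /\ fam_b x = b%:A.
  by rewrite /over_point /= plane_homa plane_homb.
have [|x [xP xU]] := @fam_sheaf A m r B f (fun i => sval (xs i)) r1 floc.
  move=> i j D g e gh; exact: (congr1 (fun x => sval x) (agree i j D g e gh)).
have xover : over_point fam_pi a b x.
  apply/overE; split; apply: (loc_separated r1 floc) => i.
    have /overE[e _] := svalP (xs i); rewrite linearZ rmorph1.
    exact: (etrans (congr1 (fun x => fam_a x) (xP i)) e).
  have /overE[_ e] := svalP (xs i); rewrite linearZ rmorph1.
  exact: (etrans (congr1 (fun x => fam_b x) (xP i)) e).
exists (exist _ x xover); split=> [i|y yP].
  by apply: sval_inj_prop; exact: xP.
by apply: sval_inj_prop; apply: xU => i; rewrite -(yP i).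
Qed.

End Family.

(** * Charts of the family at special points *)

Section FamilyCharts.
Variables (k : fieldType) (M : zmodType) (w : M) (h : M -> int).
Variables (n : nat) (pt : 'I_n.+1 -> M).
Hypothesis hD : forall u v, h u + h v <= h (u + v).
Hypothesis hw : forall u, h (u + w) = h u.
Hypothesis hn : forall u N, h (u *+ N) = h u *+ N.
Implicit Types c s : seq 'I_n.+1.
Local Notation psum := (psum pt).
Local Notation hsum := (hsum h pt).
Local Notation mus := (mus h pt).
Local Notation balanced := (balanced h pt).

(** The ratio of the coordinates of i and v is formally (beta + alpha chi^w)^n x_(pt i - pt v),
    where x now refers to the linearization [dh d] of h; this is the exponent n. *)
Definition chart_exp (v : 'I_n.+1) (d : deform M) (i : 'I_n.+1) : nat :=
  `|(dh d (pt i - pt v) + h (pt v) - h (pt i))%R|%N.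

(* On the chart where the coordinate of [v] is 1, the product of the coordinates
   in an admissible list [c] is x_u. *)
Definition admissible (v : 'I_n.+1) (d : deform M) (u : M) c : Prop :=
  psum c = u + pt v *+ size c /\ hsum c = dh d u + h (pt v) *+ size c.

(* [dh d] is the derivative of [h] at [pt v] and [dT d] the tangent cone. *)
Record special (v : 'I_n.+1) (d : deform M) : Prop := Special {
  sp_w : dw d = w;
  sp_der : forall u N, h (u + pt v *+ N) <= dh d u + h (pt v) *+ N;
  sp_lim : forall u, exists N0, forall N, (N0 <= N)%N ->
    h (u + pt v *+ N) = dh d u + h (pt v) *+ N;
  sp_T : forall i j, (j <= chart_exp v d i)%N -> dT d (pt i - pt v + w *+ j);
  sp_gen : forall u, dT d u -> exists c, admissible v d u c }.

Lemma h0 : h 0 = 0.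
Proof. by have := hn 0 0; rewrite !mulr0n. Qed.

Lemma hsum_le c : hsum c <= h (psum c).
Proof.
elim: c => [|i c IH]; first by rewrite /hsum /psum !big_nil h0.
rewrite /hsum /psum !big_cons; apply: le_trans (hD _ _).
by rewrite lerD2l.
Qed.

Lemma musE c : (mus c : int) = h (psum c) - hsum c.
Proof. by rewrite gez0_abs // subr_ge0 hsum_le. Qed.

Lemma hwn u i : h (u + w *+ i) = h u.
Proof. by elim: i => [|i IH]; rewrite ?mulr0n ?addr0 // mulrSr addrA hw. Qed.

Lemma psum_cat c s : psum (c ++ s) = psum c + psum s.
Proof. by rewrite /psum big_cat. Qed.

Lemma hsum_cat c s : hsum (c ++ s) = hsum c + hsum s.
Proof. by rewrite /hsum big_cat. Qed.

Lemma psum_nseq i N : psum (nseq N i) = pt i *+ N.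
Proof. by rewrite /psum big_nseq iter_addr_0. Qed.

Lemma hsum_nseq i N : hsum (nseq N i) = h (pt i) *+ N.
Proof. by rewrite /hsum big_nseq iter_addr_0. Qed.

Section OneChart.
Variables (v : 'I_n.+1) (d : deform M).
Hypothesis sp : special v d.
Local Notation nn := (chart_exp v d).
Local Notation T := (dT d).

Lemma chart_expE i : (nn i : int) = dh d (pt i - pt v) + h (pt v) - h (pt i).
Proof.
rewrite gez0_abs // subr_ge0.
by have := sp_der sp (pt i - pt v) 1; rewrite !mulr1n subrK.
Qed.

Lemma chart_exp_self : nn v = 0%N.
Proof. by rewrite /chart_exp subrr dh0 add0r subrr. Qed.

Section Point.
Variables (A : comAlgType k) (a b : A) (x : M -> A).

Definition chart_vec : 'rV[A]_n.+1 := \row_i dbr d a b x (nn i) (pt i - pt v).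

Hypothesis xhom : dhom d a b x.

Lemma chart_vec_self : chart_vec 0 v = 1.
Proof. by rewrite mxE chart_exp_self dbr0 subrr xhom.1. Qed.

Lemma chart_vec_prod c : \prod_(i <- c) chart_vec 0 i =
  dbr d a b x `|(dh d (psum c - pt v *+ size c) + h (pt v) *+ size c - hsum c)%R|%N
    (psum c - pt v *+ size c).
Proof.
have e : \sum_(i <- c) (pt i - pt v) = psum c - pt v *+ size c.
  by rewrite sumrB [X in _ - X]big_const_seq count_predT iter_addr_0.
under eq_bigr do rewrite mxE.
rewrite (dbr_prod xhom); last by move=> j i le; rewrite (sp_w sp); exact: sp_T.
rewrite e; congr (dbr _ _ _ _ _ _); congr absz.
under eq_bigr do rewrite chart_expE.
rewrite !(sumrB, big_split) /= [X in _ + X - _ + _ - _]big_const_seq count_predT.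
by rewrite iter_addr_0 -/(hsum c); ring.
Qed.

(** At u, the monomial s is a bracket of length [mus s + N0], and its i-th balanced expansion term
    is one of length N0 at u + i w; nesting of brackets identifies the two sides. *)
Lemma chart_vec_satisfies : satisfies w h pt a b chart_vec.
Proof.
move=> s c Hc; rewrite chart_vec_prod.
set u := psum s - _; pose N0 := `|(dh d u + h (pt v) *+ size s - h (psum s))%R|%N.
have N0E : (N0 : int) = dh d u + h (pt v) *+ size s - h (psum s).
  rewrite gez0_abs // subr_ge0.
  by have := sp_der sp u (size s); rewrite /u subrK.
transitivity (dbr d a b x (mus s + N0) u).
  congr (dbr _ _ _ _ _ _); apply/eqP; rewrite -eqz_nat PoszD N0E musE.
  rewrite gez0_abs; first by apply/eqP; ring.
  rewrite subr_ge0; apply: (le_trans (hsum_le s)).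
  by rewrite -subr_ge0 -N0E.
rewrite -(dbr_dbr d); apply: eq_br => i le; have [sz ps bal] := Hc i le.
rewrite chart_vec_prod sz ps (sp_w sp) addrAC -/u; congr (dbr _ _ _ _ _ _).
rewrite -bal ps hwn /N0; congr absz; congr (_ + _ - _).
by rewrite addrAC -(sp_w sp) dhwn.
Qed.

Lemma admissible_chart_vec u c : admissible v d u c ->
  \prod_(i <- c) chart_vec 0 i = x u.
Proof.
move=> [ps hs]; rewrite chart_vec_prod ps hs addrK subrr.
by rewrite /= dbr0.
Qed.

Lemma chart_point_subproof :
  family_point w h pt ((a, b), exist _ _ (line_of_line chart_vec_self) : Pn_pts n A).
Proof. by move=> _ [t ->] /=; apply: satisfies_scale; exact: chart_vec_satisfies. Qed.

Definition chart_point : family k w h pt A := exist _ _ chart_point_subproof.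

End Point.

Lemma chart_vec_map (A B : comAlgType k) (f : {lrmorphism A -> B}) a b x :
  map_mx f (chart_vec a b x) = chart_vec (f a) (f b) (f \o x).
Proof. by apply/rowP => i; rewrite !mxE /dbr br_rmorph. Qed.

Lemma chart_point_nat (A B : comAlgType k) (f : {lrmorphism A -> B}) a b x
    (H : dhom d a b x) (H' : dhom d (f a) (f b) (f \o x)) :
  kmap (family k w h pt) f (chart_point H) = chart_point H'.
Proof. by apply: fam_eq => //=; rewrite line_image_of chart_vec_map. Qed.

Lemma chart_vec_ext (A : comAlgType k) (a b : A) x x' :
  (forall u, T u -> x u = x' u) -> chart_vec a b x = chart_vec a b x'.
Proof.
move=> e; apply/rowP => i; rewrite !mxE; apply: eq_br => j le; apply: e.
by rewrite (sp_w sp); exact: sp_T.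
Qed.

Lemma chart_point_congr (A : comAlgType k) (a b a' b' : A) x x'
    (H : dhom d a b x) (H' : dhom d a' b' x') :
  a = a' -> b = b' -> (forall u, T u -> x u = x' u) ->
  chart_point H = chart_point H'.
Proof.
move=> ea eb; case: _ / ea H' ; case: _ / eb => H' ex; apply: fam_eq => //=.
by rewrite (chart_vec_ext _ _ ex).
Qed.

(** By [sp_gen] every x_u with u in the cone is a product of coordinates of the normalized vector,
    hence determined by the line. *)
Lemma chart_point_inj (A : comAlgType k) (a b a' b' : A) x x'
    (H : dhom d a b x) (H' : dhom d a' b' x') :
  chart_point H = chart_point H' ->
  [/\ a = a', b = b' & forall u, T u -> x u = x' u].
Proof.
move=> e; have ea : a = a' := congr1 (fun t => fam_a t) e.
have eb : b = b' := congr1 (fun t => fam_b t) e.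
split=> // u Tu; have [c adm] := sp_gen sp Tu.
rewrite -(admissible_chart_vec H adm) -(admissible_chart_vec H' adm).
have -> // : chart_vec a b x = chart_vec a' b' x'.
apply: (line_of_inj (chart_vec_self H) (chart_vec_self H')).
exact: (congr1 (fun t => sval (fam_L t)) e).
Qed.

Lemma admissible_pad u c N : admissible v d u c -> admissible v d u (c ++ nseq N v).
Proof.
move=> [ps hs]; rewrite /admissible psum_cat hsum_cat psum_nseq hsum_nseq ps hs.
by rewrite size_cat size_nseq !mulrnDr !addrA.
Qed.

Lemma admissible_balanced u c : admissible v d u c -> balanced c.
Proof.
move=> [ps hs]; apply/eqP; rewrite /balanced eq_le hsum_le andbT hs ps.
exact: (sp_der sp).
Qed.

Section Inverse.
Variables (A : comAlgType k) (a b : A) (l : 'rV[A]_n.+1).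
Hypothesis lsat : satisfies w h pt a b l.
Hypothesis lv : l 0 v = 1.

Lemma prod_pad c N : \prod_(i <- c ++ nseq N v) l 0 i = \prod_(i <- c) l 0 i.
Proof. by rewrite big_cat big_nseq lv /= iter_fix ?mulr1. Qed.

(** Padded with v to a common length, both lists are balanced with the same sum, and the relation
    between them has the single term i = 0. *)
Lemma admissible_prod u c s : admissible v d u c -> admissible v d u s ->
  \prod_(i <- c) l 0 i = \prod_(i <- s) l 0 i.
Proof.
move=> ac as_; rewrite -(prod_pad c (size s)) -(prod_pad s (size c)).
have ac' := admissible_pad (size s) ac; have as' := admissible_pad (size c) as_.
have mu0 : mus (c ++ nseq (size s) v) = 0%N.
  by rewrite /mus (admissible_balanced ac') subrr.
rewrite (lsat (c := fun=> s ++ nseq (size c) v)); rewrite mu0 //.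
move=> i; rewrite leqn0 => /eqP ->; rewrite mulr0n addr0.
have sz : size (s ++ nseq (size c) v) = size (c ++ nseq (size s) v).
  by rewrite !size_cat !size_nseq addnC.
split=> //; last exact: admissible_balanced as'.
by have [-> _] := as'; have [-> _] := ac'; rewrite sz.
Qed.

(** The inverse of [chart_vec]: x_u is the product of coordinates over any admissible list. The
    deformed product is then a relation of the family, once the monomial is padded with v until h is
    linear there and the lists of all terms fit into its degree. *)
Lemma chart_vec_exists : exists x, dhom d a b x /\ chart_vec a b x = l.
Proof.
have /choice[c cP] : forall u, exists c, T u -> admissible v d u c.
  move=> u; have [Tu|nT] := boolP (T u); last by exists [::].
  by have [c adm] := sp_gen sp Tu; exists c.
pose x u := \prod_(i <- c u) l 0 i.
have xE u s : T u -> admissible v d u s -> x u = \prod_(i <- s) l 0 i.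
  by move=> Tu as_; apply: (admissible_prod (u := u)) => //; exact: cP.
pose len m (F : nat -> M) := \max_(i < m.+1) size (c (F i)).
pose pad N u := c u ++ nseq (N - size (c u)) v.
have padP N u : T u -> admissible v d u (pad N u).
  by move=> Tu; apply: admissible_pad; exact: cP.
have pad_size N u : (size (c u) <= N)%N -> size (pad N u) = N.
  by move=> le; rewrite size_cat size_nseq subnKC.
have key s u : psum s = u + pt v *+ size s ->
    h (psum s) = dh d u + h (pt v) *+ size s ->
    (forall i, (i <= mus s)%N -> T (u + w *+ i)) ->
    (forall i, (i <= mus s)%N -> (size (c (u + w *+ i)%R) <= size s)%N) ->
    \prod_(i <- s) l 0 i = br a b (mus s) (fun i => x (u + w *+ i)).
  move=> ps hs Tu le.
  rewrite (lsat (c := fun i => pad (size s) (u + w *+ i))).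
    by apply: eq_br => i lei; rewrite (xE _ (pad (size s) (u + w *+ i))) //;
      [exact: Tu|apply: padP; exact: Tu].
  move=> i lei; have adm := padP (size s) _ (Tu i lei).
  have sz := pad_size (size s) _ (le i lei); split=> //.
    by have [-> _] := adm; rewrite sz ps addrAC.
  exact: admissible_balanced adm.
have xhom : dhom d a b x.
  split; first by rewrite (xE 0 [::]) ?dT0 ?big_nil // /admissible;
    rewrite /psum /hsum !big_nil !mulr0n dh0 !addr0.
  move=> u u' Tu Tu'.
  have [N0 N0P] := sp_lim sp (u + u').
  pose L := len (dmu d u u') (fun i => u + u' + w *+ i).
  (* N0 copies of v bring h to its linearized value, L more give the degree that the admissible
     lists of all terms require. *)
  pose s := c u ++ c u' ++ nseq (N0 + L) v.
  have ps : psum s = u + u' + pt v *+ size s.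
    rewrite /s !psum_cat psum_nseq (cP u Tu).1 (cP u' Tu').1.
    by rewrite !size_cat size_nseq !mulrnDr; rewrite -!addrA; congr (_ + _);
      rewrite addrCA.
  have hs : h (psum s) = dh d (u + u') + h (pt v) *+ size s.
    by rewrite ps N0P // !size_cat size_nseq; lia.
  have mu_s : mus s = dmu d u u'.
    apply/eqP; rewrite -eqz_nat musE dmuE hs /s !hsum_cat hsum_nseq.
    rewrite (cP u Tu).2 (cP u' Tu').2 !size_cat size_nseq !mulrnDr.
    by apply/eqP; ring.
  transitivity (\prod_(i <- s) l 0 i).
    by rewrite /s catA prod_pad big_cat.
  rewrite (key s (u + u') ps hs) ?mu_s.
  - by rewrite (sp_w sp).
  - by move=> i le; rewrite -(sp_w sp); exact: dTD.
  - move=> i le; apply: (@leq_trans L); last by rewrite !size_cat size_nseq; lia.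
    exact: (@leq_bigmax _ (fun i : 'I_(dmu d u u').+1 => size (c (u + u' + w *+ i)))
      (Ordinal (le : (i < (dmu d u u').+1)%N))).
exists x; split=> //; apply/rowP => i; rewrite mxE.
pose u := pt i - pt v.
have [N0 N0P] := sp_lim sp u.
pose L := len (nn i) (fun j => u + w *+ j).
pose s := [:: i] ++ nseq (N0 + L) v.
have ps : psum s = u + pt v *+ size s.
  rewrite /s psum_cat psum_nseq /psum big_seq1 /= size_nseq /u.
  by rewrite mulrS addrA subrK.
have hs : h (psum s) = dh d u + h (pt v) *+ size s.
  by rewrite ps N0P // size_cat size_nseq; lia.
have mu_s : mus s = nn i.
  apply/eqP; rewrite -eqz_nat musE chart_expE hs /s hsum_cat hsum_nseq.
  rewrite /hsum big_seq1 /= size_nseq -/u mulrS; apply/eqP; ring.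
transitivity (\prod_(j <- s) l 0 j); last by rewrite prod_pad big_seq1.
rewrite (key s u ps hs) ?mu_s.
- by rewrite /dbr (sp_w sp).
- by move=> j le; exact: sp_T.
- move=> j le; apply: (@leq_trans L); last by rewrite size_cat size_nseq; lia.
  exact: (@leq_bigmax _ (fun j : 'I_(nn i).+1 => size (c (u + w *+ j)))
    (Ordinal (le : (j < (nn i).+1)%N))).
Qed.

End Inverse.

Lemma chart_pointP (A : comAlgType k) (t : family k w h pt A) :
  (exists l, sval (fam_L t) l /\ l 0 v = 1) <->
  exists a b x (H : dhom d a b x), chart_point H = t.
Proof.
split=> [[l [Ll lv]]|[a [b [x [H <-]]]]]; last first.
  by exists (chart_vec a b x); split; [exact: line_of_self|exact: chart_vec_self].
have [x [H e]] := chart_vec_exists (svalP t _ Ll) lv.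
exists (fam_a t), (fam_b t), x, H; apply: fam_eq => //=.
by rewrite e; apply/esym/(line_eq_of _ Ll lv); exact: svalP.
Qed.

(** The condition describing the chart as an open subfunctor: it is stated with the v-coordinates of
    L over A and tested after base change. *)
Lemma line_unit_coord (A B : comAlgType k) (f : {lrmorphism A -> B})
    (L : Pn_pts n A) :
  (exists l, line_image f (sval L) l /\ l 0 v = 1) <->
  ideal_gen (f @` [set l 0 v | l in sval L]) 1.
Proof.
have [Lsub _ _] := svalP L; split.
  move=> [l [Ll <-]]; have idJ := ideal_gen_ideal (f @` [set l 0 v | l in sval L]).
  move: l Ll; apply: (@span_sub _ _ _
    [set l : 'rV[B]_n.+1 | ideal_gen (f @` [set l 0 v | l in sval L]) (l 0 v)]).
    split=> [|c l1 l2 H1 H2] /=; first by rewrite mxE; exact: (ideal0 idJ).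
    by rewrite !mxE; apply: (idealD idJ) => //; apply: (idealM idJ).
  move=> _ [l Ll <-]; apply: sub_ideal_gen; exists (l 0 v); last by rewrite mxE.
  by exists l.
move=> G1.
have [|_ [l Ll <-]|l Ll ->] := @ideal_gen_min _ _
  [set t : B | exists2 l, line_image f (sval L) l & t = l 0 v] _ _ _ G1.
- have Isub := line_image_submodule f (sval L).
  split=> [|c _ _ [l1 L1 ->] [l2 L2 ->]].
    by exists 0; [exact: (rowsub0 Isub)|rewrite mxE].
  by exists (c *: l1 + l2); [exact: (rowsubZD _ Isub)|rewrite !mxE].
- by case: Ll => l' Ll' <-; exists (map_mx f l'); [exact: sub_line_image|rewrite mxE].
- by exists l.
Qed.

End OneChart.

End FamilyCharts.

Lemma field_mul_neq0 (A : comNzRingType) (x y : A) :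
  is_field A -> x != 0 -> y != 0 -> x * y != 0.
Proof.
move=> fA x0 y0; have [x' xx'] := fA x x0; apply: contra y0 => /eqP xy.
by rewrite -[y]mul1r -xx' [x * x']mulrC -mulrA xy mulr0.
Qed.

Section FamilyScheme.
Variables (k : fieldType) (M : zmodType) (w : M) (h : M -> int).
Variables (n : nat) (pt : 'I_n.+1 -> M).
Hypothesis hD : forall u v, h u + h v <= h (u + v).
Hypothesis hw : forall u, h (u + w) = h u.
Hypothesis hn : forall u N, h (u *+ N) = h u *+ N.
Variables (spc : pred 'I_n.+1) (D : 'I_n.+1 -> deform M).
Hypothesis spP : forall v, spc v -> special w h pt v (D v).
Hypothesis spcover : forall i, exists c : seq 'I_n.+1, [/\ c != [::], all spc c,
  psum pt c = pt i *+ size c & hsum h pt c = h (pt i) *+ size c].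
Local Notation K := (mpoly 2 k).
Local Notation X := (family k w h pt).

(** A power of a nonzero coordinate equals a product of special coordinates, by a relation with no
    deformation term, so some special coordinate is nonzero as well. *)
Lemma field_point_special (A : comAlgType k) (t : X A) : is_field A ->
  exists v, spc v /\ exists l, sval (fam_L t) l /\ l 0 v = 1.
Proof.
move=> fA; have [Lsub _ L1] := svalP (fam_L t).
suff [v [spv [l [Ll lv]]]] : exists v, spc v /\
    exists l, sval (fam_L t) l /\ l 0 v != 0.
  exists v; split=> //; have [y ly] := fA _ lv.
  by exists (y *: l); split; [exact: (rowsubZ _ Lsub)|rewrite mxE mulrC].
apply: contrapT => H.
suff L0 l i : sval (fam_L t) l -> l 0 i = 0.
  suff /eqP : (1 : A) = 0 by rewrite oner_eq0.
  apply: (ideal_gen_min (J := [set a | a = 0])) L1.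
    by split=> [|c a b -> ->] //; rewrite scaler0 addr0.
  by move=> _ [l [i [Ll ->]]]; exact: L0.
move=> Ll; apply/eqP; apply: contrapT => /negP li.
have [c [c0 spcc ps hs]] := spcover i.
have lX m : l 0 i ^+ m != 0.
  by elim: m => [|m IH]; rewrite ?oner_eq0 // exprS field_mul_neq0.
have mu0 : mus h pt (nseq (size c) i) = 0%N.
  by rewrite /mus psum_nseq hsum_nseq hn subrr.
have := svalP t _ Ll (nseq (size c) i) (fun=> c); rewrite mu0 => e.
have {}e : l 0 i ^+ size c = \prod_(j <- c) l 0 j.
  move: e; rewrite big_nseq iter_mulr_1 br0; apply=> j; rewrite leqn0 => /eqP ->; rewrite mulr0n addr0 size_nseq psum_nseq.
  by split=> //; rewrite /balanced ps hs hn.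
have := lX (size c); rewrite e => /negP; apply; apply/eqP.
case: c c0 spcc {ps hs mu0 e} => // v c _ /= /andP[spv _].
rewrite big_cons; have [->|lv] := eqVneq (l 0 v) 0; first by rewrite mul0r.
by case: H; exists v; split=> //; exists l.
Qed.

Definition chart_ring (v : 'I_n.+1) : comAlgType k :=
  chart_alg (coord_alpha k) (coord_beta k) (D v).

Definition chart_map_fun (v : {v | spc v}) (A : comAlgType k)
  (phi : Spec (chart_ring (sval v)) A) : X A :=
  chart_point hD hw hn (spP (svalP v))
    (dhom_rmorph (phi : {lrmorphism _ -> _})
      (chart_dhom (coord_alpha k) (coord_beta k) (D (sval v)))).

Lemma chart_map_nat (v : {v | spc v}) (A B : comAlgType k)
    (f : {lrmorphism A -> B}) (phi : Spec (chart_ring (sval v)) A) :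
  chart_map_fun (kmap (Spec (chart_ring (sval v))) f phi) =
  kmap X f (chart_map_fun phi).
Proof.
by rewrite /chart_map_fun (chart_point_nat hD hw hn (spP (svalP v)) _
  (dhom_rmorph f (dhom_rmorph phi
     (chart_dhom (coord_alpha k) (coord_beta k) (D (sval v)))))); apply: fam_eq.
Qed.

Definition chart_incl (v : {v | spc v}) : kmor (Spec (chart_ring (sval v))) X :=
  KMor (@chart_map_nat v).

Lemma cst_plane v (A : comAlgType k) (phi : {lrmorphism chart_ring v -> A}) c :
  phi (cst (coord_alpha k) (coord_beta k) (D v) c) =
  plane_hom (phi (cst (coord_alpha k) (coord_beta k) (D v) (coord_alpha k)))
    (phi (cst (coord_alpha k) (coord_beta k) (D v) (coord_beta k))) c.
Proof.
have [f fE] := cst_lrmorphism (coord_alpha k) (coord_beta k) (D v).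
pose g : {lrmorphism K -> A} := phi \o f.
rewrite -!fE -!/(g _); suff <- : g = plane_hom (g (coord_alpha k)) (g (coord_beta k)) by [].
by apply: plane_hom_ext; rewrite ?plane_homa ?plane_homb.
Qed.

Lemma chart_incl_onto (v : {v | spc v}) (A : comAlgType k) (a b : A) x
    (H : dhom (D (sval v)) a b x) :
  exists phi, chart_incl v A phi = chart_point hD hw hn (spP (svalP v)) H.
Proof.
have [|phi [phic phiU]] := @chart_hom k M K (coord_alpha k) (coord_beta k)
  (D (sval v)) A (plane_hom a b) x.
  by rewrite plane_homa plane_homb.
exists phi; apply: chart_point_congr => [||u Tu]; last exact: phiU.
- exact: (etrans (phic _) (plane_homa _ _)).
- exact: (etrans (phic _) (plane_homb _ _)).
Qed.

Lemma chart_incl_open v : open_immersion (chart_incl v).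
Proof.
pose sp := spP (svalP v); split.
  move=> A phi phi' /chart_point_inj[ea eb eU].
  apply: chart_hom_ext; [move=> c|exact: eU].
  apply: (etrans (cst_plane phi c)); apply: (etrans _ (esym (cst_plane phi' c))).
  exact: (f_equal2 (fun a b => plane_hom a b c) ea eb).
move=> A t; exists [set l 0 (sval v) | l in sval (fam_L t)] => B f.
rewrite -line_unit_coord (chart_pointP hD hw hn sp (kmap X f t)).
split=> [[phi e]|[a [b [x [H e]]]]]; last first.
  by have [phi phie] := chart_incl_onto H; exists phi; exact: (etrans phie e).
by do 4 eexists; exact: e.
Qed.

Lemma chart_incl_cover : open_cover chart_incl.
Proof.
split=> [|A fA t]; first exact: chart_incl_open.
have [v [spv /(chart_pointP hD hw hn (spP spv))]] := field_point_special t fA.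
move=> [a [b [x [H <-]]]]; exists (exist _ v spv).
have [phi e] := @chart_incl_onto (exist _ v spv) A a b x H.
by exists phi; apply: (etrans e); exact: fam_eq.
Qed.

Lemma family_scheme : is_scheme X.
Proof.
split; first exact: fam_sheaf.
by exists {v | spc v}, (fun v => chart_ring (sval v)), chart_incl; exact: chart_incl_cover.
Qed.

Lemma family_flat : flat (fam_pi k w h pt).
Proof.
exists {v | spc v}, (fun v => chart_ring (sval v)), chart_incl; split.
  exact: chart_incl_cover.
move=> v; apply: chart_flat => c.
exact: (esym (@cst_plane (sval v) _ (idfun : {lrmorphism chart_ring (sval v) -> _}) c)).
Qed.

End FamilyScheme.

(** * Toric fibres *)

Ltac mxring := apply/matrixP => ? ?; rewrite !mxE; ring.

Section TotalPoint.
Variables (k : fieldType) (A : comAlgType k).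
Local Notation M := 'cV[int]_2.
Implicit Types (S : set M) (x : M -> A).

Definition mhom S x : Prop :=
  x 0 = 1 /\ forall u v, S u -> S v -> x (u + v) = x u * x v.

Definition submonoid S : Prop := S 0 /\ forall u v, S u -> S v -> S (u + v).

(** Points of a toric chart as functions on all of M, extended by 0, so that sums of exponents carry
    no membership proofs. *)
Definition total_pt S (x : toric_chart k S A) : M -> A :=
  fun u => if pselect (S u) is left p then sval x (exist _ u p) else 0.

Lemma total_ptE S (x : toric_chart k S A) (u : {u | S u}) :
  total_pt x (sval u) = sval x u.
Proof.
rewrite /total_pt; case: pselect => [p|]; last by case: u.
by congr (sval x); exact: sval_inj_prop.
Qed.

Lemma total_pt_mhom S (x : toric_chart k S A) : submonoid S -> mhom S (total_pt x).
Proof.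
move=> [S0 SD]; split.
  by rewrite -[0]/(sval (exist S 0 S0)) total_ptE (svalP x).1.
move=> u v Su Sv.
rewrite -[u + v]/(sval (exist S _ (SD u v Su Sv))) -[u in RHS]/(sval (exist S u Su)).
rewrite -[v in RHS]/(sval (exist S v Sv)) !total_ptE.
exact: (svalP x).2.
Qed.

Lemma mhom_chart S x : mhom S x ->
  exists y : toric_chart k S A, forall u, S u -> total_pt y u = x u.
Proof.
move=> [x1 xD].
have H : monoid_hom (fun u : {u | S u} => x (sval u)).
  split=> [u ->//|[u Su] [v Sv] t /= ->]; exact: xD.
exists (exist _ _ H) => u Su.
by rewrite -[u in LHS]/(sval (exist S u Su)) total_ptE.
Qed.

Lemma total_pt_ext S (x y : toric_chart k S A) :
  (forall u, S u -> total_pt x u = total_pt y u) -> x = y.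
Proof.
move=> e; apply: sval_inj_prop; apply/funext => u.
by rewrite -!total_ptE e //; case: u.
Qed.

Lemma mhom_sum S x (I : Type) (s : seq I) (F : I -> M) : submonoid S -> mhom S x ->
  (forall i, S (F i)) ->
  S (\sum_(i <- s) F i) /\ x (\sum_(i <- s) F i) = \prod_(i <- s) x (F i).
Proof.
move=> [S0 SD] [x1 xD] SF; elim: s => [|i s [Ss IH]]; first by rewrite !big_nil.
by rewrite !big_cons xD // IH; split=> //; exact: SD.
Qed.

End TotalPoint.

Lemma total_pt_map (k : fieldType) (S : set 'cV[int]_2) (A B : comAlgType k)
    (f : {lrmorphism A -> B}) (x : toric_chart k S A) u :
  total_pt (kmap (toric_chart k S) f x) u = f (total_pt x u).
Proof. by rewrite /total_pt; case: pselect => //; rewrite rmorph0. Qed.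

Lemma chart_restrP (k : fieldType) (S S' : set 'cV[int]_2) (A : comAlgType k)
    (z : toric_chart k S' A) (x : toric_chart k S A) : S `<=` S' ->
  chart_restr z x <-> forall u, S u -> total_pt z u = total_pt x u.
Proof.
move=> SS'; split=> [H u Su|H u' u e].
  rewrite -[u in LHS]/(sval (exist S' u (SS' u Su))) -[u in RHS]/(sval (exist S u Su)).
  by rewrite !total_ptE; exact: H.
by rewrite -!total_ptE e; apply: H; case: u {e}.
Qed.

Section ToricFibre.
Variables (k : fieldType).
Local Notation M := 'cV[int]_2.
Variables (w : M) (h : M -> int) (n : nat) (pt : 'I_n.+1 -> M).
Hypothesis hD : forall u v, h u + h v <= h (u + v).
Hypothesis hw : forall u, h (u + w) = h u.
Hypothesis hn : forall u N, h (u *+ N) = h u *+ N.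
Variables (c : k) (eps : bool).
Hypothesis c0 : c != 0.
Local Notation X := (family k w h pt).

(* [eps = false] is the fibre over (0, c), the toric surface of the polygon;
   [eps = true] the fibre over (c, 0), the one of its mutation. *)
Definition fib_a : k := if eps then c else 0.
Definition fib_b : k := if eps then 0 else c.
(** This choice makes [psi] the identity for [eps = false] and phi for [eps = true], so that one
    argument serves both fibres. [dpsi] is its derivative at a special point, and [ipsi] the inverse
    of the derivative. *)
Definition ew : M := if eps then w else 0.
Definition psi (u : M) : M := u - h u *: ew.
Definition dpsi (d : deform M) (u : M) : M := u - dh d u *: ew.
Definition ipsi (d : deform M) (u : M) : M := u + dh d u *: ew.

Section Powers.
Variable A : comAlgType k.

Definition cz (z : int) : A := (c ^ z)%:A.

Lemma czD z z' : cz (z + z') = cz z * cz z'.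
Proof. by rewrite /cz expfzDr // -scalerAl mul1r scalerA. Qed.

Lemma cz0 : cz 0 = 1.
Proof. by rewrite /cz expr0z scale1r. Qed.

Lemma czK z : cz z * cz (- z) = 1.
Proof. by rewrite -czD subrr cz0. Qed.

Lemma czMn z N : cz (z *+ N) = cz z ^+ N.
Proof. by elim: N => [|N IH]; rewrite ?mulr0n ?cz0 // mulrS czD IH exprS. Qed.

Lemma cz_nat (N : nat) : cz N = c%:A ^+ N.
Proof.
by elim: N => [|N IH]; rewrite ?cz0 // intS czD IH exprS /cz expr1z.
Qed.

Lemma cz_sum (I : Type) (s : seq I) (F : I -> int) :
  \prod_(i <- s) cz (F i) = cz (\sum_(i <- s) F i).
Proof. by rewrite (big_morph _ czD cz0). Qed.

Lemma cz_inj z (s t : A) : cz z * s = cz z * t -> s = t.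
Proof.
by move=> e; rewrite -[s]mul1r -[t]mul1r -(czK (- z)) opprK -!mulrA e.
Qed.

End Powers.

Lemma cz_map (A B : comAlgType k) (f : {lrmorphism A -> B}) z : f (cz A z) = cz B z.
Proof. by rewrite /cz linearZ rmorph1. Qed.

Section OneChart.
Variables (v : 'I_n.+1) (d : deform M).
Hypothesis sp : special w h pt v d.
Local Notation T := (dT d).
Local Notation dpsi := (dpsi d).
Local Notation ipsi := (ipsi d).

Lemma dh_ew u (z : int) : dh d (u + z *: ew) = dh d u.
Proof.
rewrite /ew; case: eps; last by rewrite scaler0 addr0.
have e x i : dh d (x + w *+ i) = dh d x by rewrite -(sp_w sp) dhwn.
case: z => i; first by rewrite -natz scaler_nat e.
by rewrite NegzE scaleNr -natz scaler_nat -[in RHS](subrK (w *+ i.+1) u) e.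
Qed.

Lemma dh_ewB u (z : int) : dh d (u - z *: ew) = dh d u.
Proof. by rewrite -scaleNr dh_ew. Qed.

Lemma ew_natE N : ew *+ N = (N : int) *: ew.
Proof. by rewrite -scaler_nat natz. Qed.

Lemma dpsiK u : ipsi (dpsi u) = u.
Proof. by rewrite /ipsi /dpsi dh_ewB subrK. Qed.

Lemma ipsiK u : dpsi (ipsi u) = u.
Proof. by rewrite /ipsi /dpsi dh_ew addrK. Qed.

Variable S : set M.
Hypothesis ST : forall u, S u <-> T (ipsi u).

Lemma dpsi_in u : T u -> S (dpsi u).
Proof. by move=> Tu; apply/ST; rewrite dpsiK. Qed.

(** On the fibre the product of x_u and x_v carries the factor c^m with m the coboundary of [dh d].
    The factor c^(- dh d u) absorbs it, and [dpsi] straightens the exponents. *)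
Definition twist (A : comAlgType k) (x : M -> A) : M -> A :=
  fun u => cz A (- dh d u) * x (dpsi u).

Lemma dbr_fibre (A : comAlgType k) (x : M -> A) N u :
  dbr d fib_a%:A fib_b%:A x N u = cz A N * x (u + ew *+ N).
Proof.
rewrite /dbr /fib_a /fib_b /ew; case: eps.
  by rewrite br_b0 ?scale0r // cz_nat (sp_w sp).
by rewrite br_a0 ?scale0r // cz_nat mul0rn mulr0n.
Qed.

Lemma twist_dbr (A : comAlgType k) (x : M -> A) N u :
  dbr d fib_a%:A fib_b%:A (twist x) N u =
  cz A (N%:Z - dh d u) * x (u - (dh d u - N%:Z) *: ew).
Proof.
rewrite dbr_fibre /twist mulrA -czD ew_natE dh_ew; congr (_ * x _).
by rewrite /dpsi dh_ew; mxring.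
Qed.

Lemma twist_dhom (A : comAlgType k) (x : M -> A) : mhom S x ->
  dhom d fib_a%:A fib_b%:A (twist x).
Proof.
move=> [x1 xD]; split.
  by rewrite /twist dh0 oppr0 cz0 /dpsi dh0 scale0r subr0 x1 mulr1.
move=> u u' Tu Tu'; rewrite -[RHS]/(dbr d _ _ _ _ _) twist_dbr dmuE.
rewrite /twist mulrACA -czD -xD; [|exact: dpsi_in|exact: dpsi_in].
by congr (cz _ _ * x _); [ring|rewrite /dpsi; mxring].
Qed.

Lemma untwist_mhom (A : comAlgType k) (x : M -> A) :
  dhom d fib_a%:A fib_b%:A x ->
  exists y, mhom S y /\ forall u, T u -> twist y u = x u.
Proof.
move=> [x1 xM]; exists (fun u => cz A (dh d u) * x (ipsi u)); split; last first.
  move=> u Tu; rewrite /twist dpsiK mulrA -czD /dpsi dh_ewB.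
  by rewrite addNr cz0 mul1r.
split; first by rewrite dh0 cz0 /ipsi dh0 scale0r addr0 x1 mulr1.
move=> u u' /ST Tu /ST Tu'.
have := xM _ _ Tu Tu'; rewrite -[X in _ = X]/(dbr d _ _ _ _ _) dbr_fibre ew_natE dmuE.
rewrite mulrACA => ->; rewrite mulrA -!czD.
have e : dh d (ipsi u + ipsi u') = dh d (u + u').
  by rewrite /ipsi addrACA -scalerDl dh_ew.
by rewrite e; congr (cz _ _ * x _); rewrite /ipsi !dh_ew; [ring|mxring].
Qed.

Section ToricVec.
Variables (A : comAlgType k) (x : M -> A).
Hypothesis xhom : mhom S x.

Definition toric_vec : 'rV[A]_n.+1 :=
  chart_vec h pt v d fib_a%:A fib_b%:A (twist x).

Lemma toric_vecE i :
  toric_vec 0 i = cz A (h (pt v) - h (pt i)) * x (psi (pt i) - psi (pt v)).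
Proof.
rewrite mxE twist_dbr (chart_expE sp) /psi.
by congr (cz _ _ * x _); [ring|mxring].
Qed.

End ToricVec.

(** The two fibres use the two ends of the range in [sp_T]: j = 0 when alpha = 0, and j =
    [chart_exp] when beta = 0. *)
Lemma psi_in i : S (psi (pt i) - psi (pt v)).
Proof.
have -> : psi (pt i) - psi (pt v) =
    dpsi (pt i - pt v + ew *+ chart_exp h pt v d i).
  by rewrite /dpsi ew_natE dh_ew (chart_expE sp) /psi; mxring.
apply: dpsi_in; rewrite /ew; case: eps; first exact: (sp_T sp (leqnn _)).
by rewrite mul0rn -[X in _ + X](mulr0n w); exact: (sp_T sp (leq0n _)).
Qed.

End OneChart.

Section Fan.
Variables (spc : pred 'I_n.+1) (D : 'I_n.+1 -> deform M).
Hypothesis spP : forall v, spc v -> special w h pt v (D v).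
Hypothesis spcover : forall i, exists c : seq 'I_n.+1, [/\ c != [::], all spc c,
  psum pt c = pt i *+ size c & hsum h pt c = h (pt i) *+ size c].
Variables (R : realType) (Sigma : set (set 'rV[R]_2)).
Local Notation cone := {s | Sigma s}.
Variable vs : cone -> 'I_n.+1.
Hypothesis vs_spc : forall s, spc (vs s).
Local Notation dual s := (dual_monoid (sval s)).
Local Notation dualI s t := (dual_monoid (sval s `&` sval t)).
Local Notation shift s t := (psi (pt (vs t)) - psi (pt (vs s))).
Hypothesis dualE : forall (s : cone) u, dual s u <-> dT (D (vs s)) (ipsi (D (vs s)) u).
Hypothesis dual_shift : forall s t : cone, dualI s t (shift s t).
Hypothesis dual_conduct : forall (s t : cone) u, dualI s t u ->
  exists K, dual s (u + shift s t *+ K).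
(** Together with [psi_in] this makes the coordinate of [vs s] invertible on the fibre of the chart
    of v, which therefore lies in the chart of the cone s. *)
Hypothesis cone_of : forall v, spc v -> exists s : cone,
  dT (D v) (ipsi (D v) (psi (pt v) - psi (pt (vs s)))).
Local Notation F := (fibre (fam_pi k w h pt) fib_a fib_b).

Let sps s := spP (vs_spc s).

Lemma dual_submonoid (U : set 'rV[R]_2) : submonoid (dual_monoid U).
Proof.
have pairingD (u v : M) (x : 'rV[R]_2) : pairing (u + v) x = pairing u x + pairing v x.
  by rewrite /pairing map_mxD mulmxDr mxE.
split=> [x _|u v Hu Hv x Ux]; first by rewrite /pairing map_mx0 mulmx0 mxE.
by rewrite pairingD addr_ge0 ?Hu ?Hv.
Qed.

Definition fibre_dhom (s : cone) (A : comAlgType k) (x : toric_chart k (dual s) A) :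
    dhom (D (vs s)) fib_a%:A fib_b%:A (twist (D (vs s)) (total_pt x)) :=
  twist_dhom (sps s) (dualE s) (total_pt_mhom x (dual_submonoid (sval s))).

Lemma over_fibP (A : comAlgType k) (t : X A) :
  over_point (fam_pi k w h pt) fib_a fib_b t <->
  fam_a t = fib_a%:A /\ fam_b t = fib_b%:A.
Proof. by rewrite /over_point /= plane_homa plane_homb. Qed.

Lemma fibre_pt_over (s : cone) (A : comAlgType k) (x : toric_chart k (dual s) A) :
  over_point (fam_pi k w h pt) fib_a fib_b
    (chart_point hD hw hn (sps s) (fibre_dhom x)).
Proof. exact/over_fibP. Qed.

Definition fibre_pt (s : cone) (A : comAlgType k) (x : toric_chart k (dual s) A) : F A :=
  exist _ _ (fibre_pt_over x).

Lemma fibre_pt_nat (s : cone) (A B : comAlgType k) (f : {lrmorphism A -> B})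
    (x : toric_chart k (dual s) A) :
  fibre_pt (kmap (toric_chart k (dual s)) f x) = kmap F f (fibre_pt x).
Proof.
apply: sval_inj_prop; apply: (etrans _ (esym (chart_point_nat hD hw hn (sps s)
  (fibre_dhom x) (dhom_rmorph f (fibre_dhom x))))).
apply: chart_point_congr => [||u Tu] /=; rewrite ?linearZ ?rmorph1 //.
by rewrite /twist rmorphM /= cz_map total_pt_map.
Qed.

Definition fibre_chart s : kmor (toric_chart k (dual s)) F :=
  KMor (@fibre_pt_nat s).

Lemma fibre_chart_onto (s : cone) (A : comAlgType k) (t : F A) :
  (exists l, sval (fam_L (sval t)) l /\ l 0 (vs s) = 1) <->
  exists x, fibre_chart s A x = t.
Proof.
rewrite (chart_pointP hD hw hn (sps s)); split=> [[a [b [x [H e]]]]|[x <-]].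
  have /over_fibP[ta tb] := svalP t.
  have ea : a = fib_a%:A by rewrite -ta -e.
  have eb : b = fib_b%:A by rewrite -tb -e.
  have H' : dhom (D (vs s)) fib_a%:A fib_b%:A x by rewrite -ea -eb.
  have [y [yhom ye]] := untwist_mhom (sps s) (dualE s) H'.
  have [z ze] := mhom_chart yhom; exists z; apply: sval_inj_prop.
  rewrite -e; apply: chart_point_congr => // u Tu.
  rewrite -ye // /twist ze //; apply: (dpsi_in (sps s) (dualE s)) => //.
by do 4 eexists; reflexivity.
Qed.

Lemma fibre_chart_inj (s : cone) (A : comAlgType k) :
  injective (@kapp _ _ _ (fibre_chart s) A).
Proof.
move=> x y /(congr1 sval) /chart_point_inj[_ _ e]; apply: total_pt_ext => u Su.
have Tu : dT (D (vs s)) (ipsi (D (vs s)) u) by apply/dualE.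
have := e _ Tu; rewrite /twist => /cz_inj.
by rewrite (ipsiK (sps s)).
Qed.

Lemma fibre_chart_open s : open_immersion (fibre_chart s).
Proof.
split; first exact: fibre_chart_inj.
move=> A t; exists [set l 0 (vs s) | l in sval (fam_L (sval t))] => B f.
by rewrite -line_unit_coord -(fibre_chart_onto s (kmap F f t)).
Qed.

Lemma fibre_cover : open_cover fibre_chart.
Proof.
split=> [s|A fA t]; first exact: fibre_chart_open.
have [v [spv]] := field_point_special hn spcover (sval t) fA.
move=> /(chart_pointP hD hw hn (spP spv))[a [b [x [H e]]]].
have /over_fibP[ta tb] := svalP t.
have ea : a = fib_a%:A by rewrite -ta -e.
have eb : b = fib_b%:A by rewrite -tb -e.
have H' : dhom (D v) fib_a%:A fib_b%:A x by rewrite -ea -eb.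
pose S : set M := [set u | dT (D v) (ipsi (D v) u)].
have ST u : S u <-> dT (D v) (ipsi (D v) u) by [].
have [y [yhom ye]] := untwist_mhom (spP spv) ST H'.
have [s Ss] := cone_of spv.
exists s; apply/fibre_chart_onto.
have Lt : sval (fam_L (sval t)) (toric_vec v (D v) y).
  have -> : toric_vec v (D v) y = chart_vec h pt v (D v) a b x.
    by rewrite /toric_vec ea eb; apply: (chart_vec_ext (spP spv)); exact: ye.
  by rewrite -e; exact: line_of_self.
have Si := psi_in (spP spv) ST (vs s).
have y1 : y (psi (pt (vs s)) - psi (pt v)) * y (psi (pt v) - psi (pt (vs s))) = 1.
  by rewrite -yhom.2 // addrA subrK subrr yhom.1.
have [Lsub _ _] := svalP (fam_L (sval t)).
(* The scalar is the inverse of the coordinate of [vs s] in the toric vector, which normalizes this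
   coordinate to 1. *)
exists ((cz A (- (h (pt v) - h (pt (vs s)))) * y (psi (pt v) - psi (pt (vs s)))) *:
  toric_vec v (D v) y); split; first exact: (rowsubZ _ Lsub).
rewrite mxE (toric_vecE (spP spv) y) mulrACA -czD addNr cz0 mul1r mulrC //.
Qed.

Section Overlap.
Variables (s t : cone) (A : comAlgType k).
Variables (x : toric_chart k (dual s) A) (y : toric_chart k (dual t) A).
Local Notation e := (shift s t).
Local Notation U := (dualI s t).

Let sub_s : dual s `<=` U. Proof. by move=> u Hu p [sp _]; exact: Hu. Qed.
Let sub_t : dual t `<=` U. Proof. by move=> u Hu p [_ tp]; exact: Hu. Qed.
Let xhom := total_pt_mhom x (dual_submonoid (sval s)).
Let yhom := total_pt_mhom y (dual_submonoid (sval t)).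
Local Notation vx := (toric_vec (vs s) (D (vs s)) (total_pt x)).
Local Notation vy := (toric_vec (vs t) (D (vs t)) (total_pt y)).

(** The normalized vectors of the two charts differ by the factor c^(h(pt(vs s)) - h(pt(vs t))) z_e,
    a unit because both e and -e lie in the monoid of the intersection. *)
Lemma overlap_glue (z : toric_chart k U A) : chart_restr z x -> chart_restr z y ->
  fibre_chart s A x = fibre_chart t A y.
Proof.
move=> /(chart_restrP _ _ sub_s) zx /(chart_restrP _ _ sub_t) zy.
have [z1 zD] := total_pt_mhom z (dual_submonoid (sval s `&` sval t)).
have Ue : U e by exact: dual_shift.
have UeN : U (- e) by rewrite opprB setIC; exact: dual_shift.
have ze : total_pt z e * total_pt z (- e) = 1 by rewrite -zD // subrr.
apply: sval_inj_prop; apply: fam_eq => //=.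
pose r := cz A (h (pt (vs s)) - h (pt (vs t))) * total_pt z e.
pose r' := cz A (h (pt (vs t)) - h (pt (vs s))) * total_pt z (- e).
have rr' : r' * r = 1.
  by rewrite /r /r' mulrACA -czD mulrC addrA subrK subrr cz0 mulr1 mulrC.
have exy : vx = r *: vy.
  apply/rowP => i; rewrite [RHS]mxE.
  rewrite (toric_vecE (sps s)) (toric_vecE (sps t)) /r mulrACA -czD.
  have St := psi_in (sps t) (dualE t) i; have Ss := psi_in (sps s) (dualE s) i.
  rewrite -zx // -zy // -zD //; last exact: sub_t.
  by congr (cz _ _ * total_pt z _); [ring|mxring].
rewrite eqEsubset; split=> _ [a ->].
  by exists (a * r); rewrite -[chart_vec _ _ _ _ _ _ _]/vx exy scalerA.
exists (a * r'); rewrite -[chart_vec _ _ _ _ _ _ _ in RHS]/vx exy scalerA.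
by rewrite -mulrA rr' mulr1.
Qed.

(* The two lines can only agree where x_e is a unit, and inverting e in the dual
   of s gives the dual of the intersection. *)
Lemma overlap_glued : fibre_chart s A x = fibre_chart t A y ->
  exists z : toric_chart k U A, chart_restr z x /\ chart_restr z y.
Proof.
move=> /(congr1 (fun p => sval (fam_L (sval p)))) exy.
have [r er] : exists r, vy = r *: vx.
  have : line_of vx vy by rewrite [line_of _]exy; exact: line_of_self.
  by [].
have Se : dual s e by exact: (psi_in (sps s) (dualE s)).
have vyt : vy 0 (vs t) = 1 by apply: chart_vec_self; exact: fibre_dhom.
have : r * (cz A (h (pt (vs s)) - h (pt (vs t))) * total_pt x e) = 1.
  by rewrite -vyt er [RHS]mxE (toric_vecE (sps s)).
set q := cz A (h (pt (vs s)) - h (pt (vs t))) => r1.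
pose ei := r * q; have eei : total_pt x e * ei = 1.
  by rewrite /ei mulrC -mulrA r1.
have rE : r = cz A (h (pt (vs t)) - h (pt (vs s))) * ei.
  by rewrite /ei mulrCA /q -czD addrA subrK subrr cz0 mulr1.
clearbody ei; have [x1 xD] := xhom.
have [S0 SD] := dual_submonoid (sval s).
have SeK N u : dual s u -> dual s (u + e *+ N).
  by move=> Su; elim: N => [|N IH]; rewrite ?addr0 // mulrSr (addrA u); exact: SD.
have xeK N u : dual s u -> total_pt x (u + e *+ N) = total_pt x u * total_pt x e ^+ N.
  move=> Su; elim: N => [|N IH]; first by rewrite addr0 mulr1.
  rewrite mulrSr (addrA u) (xD _ _ (SeK N u Su) Se).
  by rewrite IH exprSr mulrA.
have /choice[K KP] : forall u, exists K, U u -> dual s (u + e *+ K).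
  move=> u; have [Uu|nU] := pselect (U u); last by exists 0%N.
  by have [K HK] := dual_conduct Uu; exists K.
(* The extension of x to the localized monoid: u is moved into the dual of s by adding e, and the
   move is undone by the inverse of x_e. [zE] is the independence of the number of moves. *)
pose z u := total_pt x (u + e *+ K u) * ei ^+ K u.
have eeiX N : total_pt x e ^+ N * ei ^+ N = 1 by rewrite -exprMn eei expr1n.
have zE u N : U u -> dual s (u + e *+ N) -> z u = total_pt x (u + e *+ N) * ei ^+ N.
  move=> Uu SN; have SK := KP u Uu.
  have aux (a b p p' r1' r2' : A) : a * p = b * p' -> p * r2' = 1 -> p' * r1' = 1 ->
      b * r2' = a * r1'.
    move=> e1 e2 e3.
    transitivity (b * p' * (r1' * r2')).
      by rewrite -[LHS]mulr1 -e3; ring.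
    by rewrite -e1 -[RHS]mulr1 -e2; ring.
  rewrite /z; apply: (aux _ _ (total_pt x e ^+ K u) (total_pt x e ^+ N)) => //.
  by rewrite -!xeK // addrAC.
have zhom : mhom U z.
  split; first by rewrite (zE 0 0%N) ?addr0 ?x1 ?mulr1 //; apply: (dual_submonoid _).1.
  move=> u v Uu Uv; have SK := KP u Uu; have SL := KP v Uv.
  have Suv : dual s (u + v + e *+ (K u + K v)).
    by rewrite mulrnDr addrACA; exact: SD.
  rewrite (zE _ (K u + K v)%N) //; last exact: (dual_submonoid _).2.
  by rewrite /z mulrACA -xD // -exprD mulrnDr addrACA.
have [Z ZE] := mhom_chart zhom; exists Z; split.
  apply/(chart_restrP _ _ sub_s) => u Su; have Uu := sub_s Su.
  by rewrite ZE // (zE u 0%N) ?addr0 ?mulr1.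
apply/(chart_restrP _ _ sub_t) => u Su; have Uu := sub_t Su.
rewrite ZE //.
have Tu : dT (D (vs t)) (ipsi (D (vs t)) u) by apply/dualE.
have [l adm] := sp_gen (sps t) Tu.
have [ps hs] := adm.
(* An admissible list for u in the chart of t also writes u, after [size l] moves by e, as a sum of
   exponents of coordinates in the chart of s. The same product of coordinates of the common line
   thus computes both x and y. *)
have sumE : \sum_(i <- l) (psi (pt i) - psi (pt (vs s))) = u + e *+ size l.
  have bc (V : zmodType) (a : V) : \sum_(i <- l) a = a *+ size l.
    by rewrite big_const_seq count_predT iter_addr_0.
  rewrite sumrB bc; have -> : \sum_(i <- l) psi (pt i) = psum pt l - hsum h pt l *: ew.
    by rewrite /psi sumrB -scaler_suml.
  have zM (a : M) : a *+ size l = (size l : int) *: a by rewrite -scaler_nat natz.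
  have zZ (a : int) : a *+ size l = a * (size l : int) by rewrite -mulr_natr natz.
  rewrite ps hs zZ !zM /ipsi /psi (dh_ew (sps t)).
  by mxring.
have [Su' xsum] := mhom_sum l (dual_submonoid (sval s)) xhom
   (psi_in (sps s) (dualE s)).
rewrite sumE in Su' xsum.
have := admissible_chart_vec (sps t) (fibre_dhom y) adm.
rewrite -[chart_vec _ _ _ _ _ _ _]/vy er prod_scale.
rewrite (_ : \prod_(i <- l) vx 0 i = cz A (h (pt (vs s)) *+ size l - hsum h pt l) *
   total_pt x (u + e *+ size l)); last first.
  under eq_bigr do rewrite (toric_vecE (sps s)).
  rewrite big_split /= cz_sum xsum; congr (cz _ _ * _).
  by rewrite sumrB big_const_seq count_predT iter_addr_0.
move=> e1; rewrite (zE u (size l)) //.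
move: e1; rewrite /twist (ipsiK (sps t)) (dh_ew (sps t)) => e1.
apply: (@cz_inj A (- dh (D (vs t)) u)); rewrite -e1 hs (dh_ew (sps t)).
rewrite rE exprMn -czMn mulrACA -czD; congr (cz _ _ * _); last by rewrite mulrC.
have zZ (a : int) : a *+ size l = a * (size l : int) by rewrite -mulr_natr natz.
by rewrite !zZ; ring.
Qed.

End Overlap.

Lemma fibre_toric : is_toric_variety Sigma F.
Proof.
split; first exact: fibre_sheaf.
exists fibre_chart; split; first exact: fibre_cover.
move=> s t A x y; split; first exact: overlap_glued.
by move=> [z [zx zy]]; exact: (overlap_glue zx zy).
Qed.

End Fan.

End ToricFibre.

(** * Cones and polygons in the plane *)

Section Pairing.
Variable F : comNzRingType.
Implicit Types (u v : 'cV[F]_2) (p q : 'rV[int]_2).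

(** Here the lattice point is integral and the functional has coefficients in F, the reverse of
    [pairing]; it is used over the integers, the rationals and the reals. *)
Definition pr u p : F := (map_mx intr p *m u) 0 0.

Lemma prE u p : pr u p = (p 0 0)%:~R * u 0 0 + (p 0 1)%:~R * u 1 0.
Proof.
rewrite /pr mxE big_ord_recl big_ord1 !mxE; congr (_ + _%:~R * _).
  by congr (p _ _); apply: val_inj.
by congr (u _ _); apply: val_inj.
Qed.

Lemma prD u v p : pr (u + v) p = pr u p + pr v p.
Proof. by rewrite /pr mulmxDr mxE. Qed.

Lemma prN u p : pr (- u) p = - pr u p.
Proof. by rewrite /pr mulmxN mxE. Qed.

Lemma prB u v p : pr (u - v) p = pr u p - pr v p.
Proof. by rewrite prD prN. Qed.

Lemma prZ a u p : pr (a *: u) p = a * pr u p.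
Proof. by rewrite /pr -scalemxAr mxE. Qed.

Lemma pr0 p : pr 0 p = 0.
Proof. by rewrite /pr mulmx0 mxE. Qed.

Lemma prMn u n p : pr (u *+ n) p = pr u p *+ n.
Proof. by rewrite -scaler_nat prZ mulr_natl. Qed.

Lemma prNr u p : pr u (- p) = - pr u p.
Proof. by rewrite !prE !mxE !rmorphN; ring. Qed.

End Pairing.

Lemma pr_map (F F' : comNzRingType) (f : {rmorphism F -> F'}) u p :
  pr (map_mx f u) p = f (pr u p).
Proof. by rewrite !prE !mxE rmorphD !rmorphM !rmorph_int. Qed.

(** Induction on m: a finite set s minimal for the first m functions also dominates every t whose
    m-th value exceeds those on s. Only finitely many lower values remain, and each level is handled
    by the induction hypothesis. *)
Lemma dickson (T : eqType) (F : T -> nat -> nat) (m : nat) (S : set T) :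
  exists s : seq T, (forall t, t \in s -> S t) /\
    forall t, S t -> exists2 t', t' \in s & forall i, (i < m)%N -> (F t' i <= F t i)%N.
Proof.
elim: m S => [|m IH] S.
  have [[t St]|nS] := pselect (exists t, S t); last first.
    by exists [::]; split=> // t St; case: nS; exists t.
  exists [:: t]; split=> [t'|t' _]; first by rewrite inE => /eqP ->.
  by exists t; rewrite ?inE.
have [s [sS sP]] := IH S.
pose H := \max_(t <- s) F t m.
have /choice[r rP] : forall j, exists r : seq T,
    (forall t, t \in r -> S t /\ F t m = j) /\
    forall t, S t /\ F t m = j ->
      exists2 t', t' \in r & forall i, (i < m)%N -> (F t' i <= F t i)%N.
  by move=> j; exact: (IH [set t | S t /\ F t m = j]).
exists (s ++ flatten [seq r j | j <- iota 0 H]); split=> [t|t St].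
  rewrite mem_cat => /orP[/sS//|/flatten_mapP[j _ tj]].
  by have [/(_ t tj)[]] := rP j.
have [le|lt] := leqP H (F t m).
  have [t' t's t'P] := sP t St; exists t'; first by rewrite mem_cat t's.
  move=> i; rewrite ltnS leq_eqVlt => /orP[/eqP ->|]; last exact: t'P.
  by apply: leq_trans le; rewrite /H (big_rem t') //= leq_maxl.
have [t' t'r t'P] := (rP (F t m)).2 t (conj St erefl).
exists t'.
  by rewrite mem_cat; apply/orP; right; apply/flatten_mapP; exists (F t m);
    rewrite ?mem_iota.
move=> i; rewrite ltnS leq_eqVlt => /orP[/eqP ->|]; last exact: t'P.
by rewrite ((rP (F t m)).1 t' t'r).2.
Qed.

Definition dual_cone (L : seq 'rV[int]_2) (u : 'cV[int]_2) : bool :=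
  all (fun p => 0 <= pr u p) L.

Lemma dual_coneP L u : reflect (forall p, p \in L -> 0 <= pr u p) (dual_cone L u).
Proof. exact: allP. Qed.

(** The elements minimal for the values on L generate: subtracting a minimal one stays in the cone
    and lowers the total of these values, strictly because a nonzero element has a nonzero value
    somewhere. *)
Lemma gordan_pointed (L : seq 'rV[int]_2) :
  (forall u : 'cV[int]_2, (forall p, p \in L -> pr u p = 0) -> u = 0) ->
  exists B : seq 'cV[int]_2, all (dual_cone L) B /\
    forall u, dual_cone L u -> exists2 c, {subset c <= B} & u = \sum_(b <- c) b.
Proof.
move=> Linj; pose F (u : 'cV[int]_2) i := `|(pr u (nth 0 L i))%R|%N.
have [B [BS BP]] := dickson F (size L) [set u | dual_cone L u /\ u != 0].
exists B; split; first by apply/allP => b /BS[].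
have FE u i : dual_cone L u -> (i < size L)%N -> (F u i : int) = pr u (nth 0 L i).
  by move=> /dual_coneP Lu lt; rewrite /F gez0_abs // Lu // mem_nth.
move=> u; have [N] := ubnP (\sum_(i < size L) F u i)%N.
elim: N u => // N IH u lt Lu.
have [->|u0] := eqVneq u 0; first by exists [::]; rewrite ?big_nil.
have [b bB bP] := BP u (conj Lu u0); have [Lb b0] := BS b bB.
have Lub : dual_cone L (u - b).
  apply/dual_coneP => p pL; rewrite -(nth_index 0 pL) prB subr_ge0 -!FE ?index_mem //.
  by rewrite lez_nat; apply: bP; rewrite index_mem.
have Fub i : (i < size L)%N -> (F (u - b)%R i + F b i = F u i)%N.
  by move=> lti; apply/eqP; rewrite -eqz_nat PoszD !FE // prB subrK.
have bpos : (0 < \sum_(i < size L) F b i)%N.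
  rewrite lt0n; apply: contra b0; rewrite sum_nat_eq0 => /forallP H.
  apply/eqP/Linj => p pL; rewrite -(nth_index 0 pL) -FE ?index_mem //.
  by have := H (Ordinal (etrans (index_mem p L) pL : is_true _)) => /eqP ->.
have [|c cB ec] := IH (u - b) _ Lub.
  move: lt; rewrite ltnS => le; apply: leq_trans le.
  rewrite (_ : (\sum_(i < size L) F u i = \sum_(i < size L) F (u - b)%R i +
    \sum_(i < size L) F b i)%N).
    by rewrite -addn1 leq_add2l.
  by rewrite -big_split /=; apply: eq_bigr => i _; rewrite Fub.
exists (b :: c); first by move=> x; rewrite inE => /orP[/eqP ->//|/cB].
by rewrite big_cons -ec addrC subrK.
Qed.

Definition row2 (a b : int) : 'rV[int]_2 := \row_(j < 2) if j == 0 then a else b.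

Lemma pr_row2 (F : comNzRingType) (u : 'cV[F]_2) a b :
  pr u (row2 a b) = a%:~R * u 0 0 + b%:~R * u 1 0.
Proof. by rewrite prE !mxE. Qed.

Lemma col2_eq (F : comNzRingType) (u v : 'cV[F]_2) :
  u 0 0 = v 0 0 -> u 1 0 = v 1 0 -> u = v.
Proof.
move=> e0 e1; apply/matrixP => i j; rewrite (ord1 j).
case: i => [[|[|//]] lt].
  by rewrite (_ : Ordinal lt = 0) //; exact: val_inj.
by rewrite (_ : Ordinal lt = 1) //; exact: val_inj.
Qed.

(* Each quadrant cuts out a pointed cone, to which Dickson's lemma applies. *)
Lemma gordan (L : seq 'rV[int]_2) :
  exists B : seq 'cV[int]_2, all (dual_cone L) B /\
    forall u, dual_cone L u -> exists2 c, {subset c <= B} & u = \sum_(b <- c) b.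
Proof.
pose quad (e : bool * bool) := L ++ [:: row2 ((-1) ^+ e.1) 0; row2 0 ((-1) ^+ e.2)].
have /choice[B BP] : forall e, exists B : seq 'cV[int]_2, all (dual_cone (quad e)) B /\
    forall u, dual_cone (quad e) u -> exists2 c, {subset c <= B} & u = \sum_(b <- c) b.
  move=> [e1 e2]; apply: gordan_pointed => u Hu.
  have := Hu (row2 ((-1) ^+ e1) 0); have := Hu (row2 0 ((-1) ^+ e2)).
  rewrite !mem_cat !inE !eqxx !orbT => /(_ isT) + /(_ isT).
  rewrite !pr_row2 /= => u1 u0; apply: col2_eq; rewrite mxE.
    by move: u0; case: (e1) => /=; rewrite ?expr0 ?expr1 ?intz; lia.
  by move: u1; case: (e2) => /=; rewrite ?expr0 ?expr1 ?intz; lia.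
have quadL e u : dual_cone (quad e) u -> dual_cone L u.
  by rewrite /dual_cone all_cat => /andP[].
exists (flatten [seq B e | e <- [:: (true, true); (true, false); (false, true);
  (false, false)]]); split.
  apply/allP => b /flatten_mapP[e _ be].
  by have [/allP/(_ b be)/quadL] := BP e.
move=> u Lu; pose e := (u 0 0 < 0, u 1 0 < 0).
have [|c cB ec] := (BP e).2 u.
  rewrite /dual_cone all_cat -/(dual_cone L u) Lu /= !pr_row2 /e /=.
  apply/and3P; split=> //; case: ltP => /=; rewrite ?expr0 ?expr1 ?intz; lia.
exists c => // b /cB be; apply/flatten_mapP; exists e => //.
by case: (e) => [[] []].
Qed.

(** * Half-planes, corners and rational convex combinations *)

Section HalfPlanes.
Variable F : realFieldType.
Implicit Types (s : 'rV[int]_2 * int) (S : seq ('rV[int]_2 * int)) (z r : 'cV[F]_2).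

Definition feasible S z : bool := all (fun s => s.2%:~R <= pr z s.1) S.

Lemma feasibleP S z :
  reflect (forall s, s \in S -> s.2%:~R <= pr z s.1) (feasible S z).
Proof. exact: allP. Qed.

(** The first constraint to become tight along the ray. In the induction, the stopping point for the
    remaining constraints is kept unless s stops the ray earlier. *)
Lemma line_hit S z r : feasible S z -> has (fun s => pr r s.1 < 0) S ->
  exists t s, [/\ 0 <= t, s \in S, feasible S (z + t *: r), pr r s.1 < 0 &
    pr (z + t *: r) s.1 = s.2%:~R].
Proof.
have first_hit s : s.2%:~R <= pr z s.1 -> pr r s.1 < 0 ->
    exists t, 0 <= t /\ pr (z + t *: r) s.1 = s.2%:~R.
  move=> zs rs; exists ((s.2%:~R - pr z s.1) / pr r s.1); split.
    by rewrite mulr_le0 // ?subr_le0 // invr_le0 ltW.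
  by rewrite prD prZ divfK ?lt_eqF // addrC subrK.
elim: S => // s S IH /= /andP[zs zS]; have [hasS _|noS] := boolP (has _ S).
  have [t [s1 [t0 s1S ztS rs1 zs1]]] := IH zS hasS.
  have [zts|zts] := leP s.2%:~R (pr (z + t *: r) s.1).
    by exists t, s1; rewrite inE s1S orbT zts ztS.
  have rs : pr r s.1 < 0.
    rewrite ltNge; apply/negP => r0.
    by move: zts; rewrite prD prZ; have := mulr_ge0 t0 r0; lra.
  have [t' [t'0 e]] := first_hit s zs rs.
  exists t', s; rewrite inE eqxx; split=> //; rewrite e lexx /=.
  have t't : t' <= t.
    rewrite leNgt; apply/negP => lt.
    move: e zts; rewrite !prD !prZ => <-; apply/negP; rewrite -leNgt lerD2l.
    by rewrite ler_nM2r // ltW.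
  apply/feasibleP => s' s'S; have /feasibleP/(_ s' s'S) := zS.
  have /feasibleP/(_ s' s'S) := ztS; rewrite !prD !prZ.
  have [r0|r0] := leP 0 (pr r s'.1); first by have := mulr_ge0 t'0 r0; lra.
  have : t * pr r s'.1 <= t' * pr r s'.1 by rewrite ler_nM2r.
  lra.
rewrite orbF => rs; have [t [t0 e]] := first_hit s zs rs.
exists t, s; rewrite inE eqxx e lexx /=; split=> //.
apply/feasibleP => s' s'S; have /feasibleP/(_ s' s'S) := zS.
move/hasPn: noS => /(_ s' s'S); rewrite -leNgt prD prZ => r0.
by have := mulr_ge0 t0 r0; lra.
Qed.

Definition det2 (p q : 'rV[int]_2) : int := p 0 0 * q 0 1 - p 0 1 * q 0 0.

Definition cramer s s' : 'cV[F]_2 := \col_(i < 2)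
  ((if i == 0 then s.2 * s'.1 0 1 - s'.2 * s.1 0 1
    else s.1 0 0 * s'.2 - s'.1 0 0 * s.2)%:~R / (det2 s.1 s'.1)%:~R).

Lemma cramerP s s' z : det2 s.1 s'.1 != 0 ->
  pr z s.1 = s.2%:~R -> pr z s'.1 = s'.2%:~R -> z = cramer s s'.
Proof.
move=> d0; rewrite !prE => e e'.
have D0 : (det2 s.1 s'.1)%:~R != 0 :> F by rewrite intr_eq0.
by apply: col2_eq; rewrite mxE /=; apply: (mulIf D0); rewrite divfK // /det2
  !(rmorphB, rmorphM) /= -e -e'; ring.
Qed.

Definition perp (p : 'rV[int]_2) : 'cV[F]_2 :=
  \col_(i < 2) (if i == 0 then - p 0 1 else p 0 0)%:~R.

Lemma pr_perp p q : pr (perp p) q = (det2 p q)%:~R.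
Proof. by rewrite prE !mxE /= /det2 !(rmorphB, rmorphM, rmorphN); ring. Qed.

Lemma perp_neq0 p : p != 0 -> perp p != 0.
Proof.
apply: contra => /eqP e; apply/eqP/matrixP => i j; rewrite (ord1 i) mxE.
have e0 := congr1 (fun u : 'cV[F]_2 => u 0 0) e.
have e1 := congr1 (fun u : 'cV[F]_2 => u 1 0) e.
move: e0 e1; rewrite !mxE /= => /eqP + /eqP; rewrite !intr_eq0 oppr_eq0 => /eqP p1 /eqP p0.
case: j => [[|[|//]] lt].
  by rewrite -[RHS]p0; congr (p _ _); exact: val_inj.
by rewrite -[RHS]p1; congr (p _ _); exact: val_inj.
Qed.

End HalfPlanes.

Section VertexCover.
Implicit Types (S : seq ('rV[int]_2 * int)) (z r : 'cV[rat]_2) (W : seq 'cV[rat]_2).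

(** The rational convex hull of W, with weights cleared to multiplicities in a list, the form in
    which monomials use it. *)
Definition covered W z : Prop := exists c : seq 'cV[rat]_2,
  [/\ c != [::], {subset c <= W} & \sum_(x <- c) x = z *+ size c].

Lemma covered_mem W z : z \in W -> covered W z.
Proof.
by move=> zW; exists [:: z]; rewrite big_seq1; split=> // x; rewrite inE => /eqP ->.
Qed.

Lemma covered_mix W z z1 z2 (a b : nat) : (0 < a + b)%N ->
  z *+ (a + b) = z1 *+ a + z2 *+ b -> covered W z1 -> covered W z2 -> covered W z.
Proof.
move=> ab e [c1 [c1n c1W c1E]] [c2 [c2n c2W c2E]].
pose rep N (c : seq 'cV[rat]_2) := flatten (nseq N c).
have repW N c x : x \in rep N c -> x \in c.
  by elim: N => //= N IH; rewrite mem_cat => /orP[].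
have repS N c : size (rep N c) = (N * size c)%N.
  by elim: N => //= N IH; rewrite size_cat IH mulSn.
have repE N c : \sum_(x <- rep N c) x = (\sum_(x <- c) x) *+ N.
  by elim: N => [|N IH]; rewrite ?big_nil // /rep /= big_cat /= IH mulrS.
have s1 : (0 < size c1)%N by rewrite lt0n size_eq0.
have s2 : (0 < size c2)%N by rewrite lt0n size_eq0.
exists (rep (a * size c2)%N c1 ++ rep (b * size c1)%N c2); split.
- rewrite -size_eq0 size_cat !repS -lt0n addn_gt0 !muln_gt0 s1 s2 !andbT.
  by rewrite -addn_gt0.
- by move=> x; rewrite mem_cat => /orP[/repW/c1W|/repW/c2W].
rewrite big_cat /= !repE c1E c2E size_cat !repS -!mulrnA.
have -> : (size c1 * (a * size c2) = a * (size c1 * size c2))%N by rewrite mulnCA.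
have -> : (size c2 * (b * size c1) = b * (size c1 * size c2))%N.
  by rewrite mulnCA [(size c2 * _)%N]mulnC.
have -> : (a * size c2 * size c1 + b * size c1 * size c2 =
   (a + b) * (size c1 * size c2))%N.
  by rewrite mulnDl -!mulnA [(size c2 * size c1)%N]mulnC.
by move: (size c1 * size c2)%N => K; rewrite !mulrnA -mulrnDl e.
Qed.

Lemma covered_between W z r t1 t2 : 0 <= t1 -> 0 <= t2 ->
  covered W (z + t1 *: r) -> covered W (z + t2 *: (- r)) -> covered W z.
Proof.
move=> t10 t20; have [->|t1n] := eqVneq t1 0; first by rewrite scale0r addr0.
have natE (t : rat) : 0 <= t -> exists a b : nat, (0 < b)%N /\ t = a%:R / b%:R.
  move=> t0; exists `|numq t|%N, `|denq t|%N; rewrite absz_gt0 denq_neq0; split=> //.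
  have posE (x : int) : 0 <= x -> x%:~R = (`|x|%N)%:R :> rat.
    by move=> x0; rewrite -{1}(gez0_abs x0).
  by rewrite -[LHS]divq_num_den !posE ?denq_ge0 ?numq_ge0.
have [a1 [b1 [b10 e1]]] := natE t1 t10; have [a2 [b2 [b20 e2]]] := natE t2 t20.
have a10 : (0 < a1)%N.
  by rewrite lt0n; apply: contra t1n => /eqP a0; rewrite e1 a0 mul0r.
(* The weights are in the ratio t2 : t1, with denominators cleared. *)
apply: (covered_mix (a := a2 * b1) (b := a1 * b2)); first by nia.
have c1 : b1%:R != 0 :> rat by rewrite pnatr_eq0 -lt0n.
have c2 : b2%:R != 0 :> rat by rewrite pnatr_eq0 -lt0n.
rewrite -!scaler_nat e1 e2; apply/matrixP => i j; rewrite !mxE !natrD !natrM.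
by field; rewrite c1 c2.
Qed.

(** Pairs of parallel constraints produce meaningless quotients; these do no harm, since only
    feasible points are kept. *)
Definition candidates S : seq 'cV[rat]_2 :=
  [seq z <- [seq cramer rat s s' | s <- S, s' <- S] | feasible S z].

(** A chord through z ends on two edges, and a point of an edge lies between the two corners reached
    by moving along it. *)
Lemma vertex_cover S W : {subset candidates S <= W} ->
  (forall r, r != 0 -> has (fun s => pr r s.1 < 0) S) ->
  forall z, feasible S z -> covered W z.
Proof.
move=> candW bounded.
have tight_cov z s : feasible S z -> s \in S -> s.1 != 0 -> pr z s.1 = s.2%:~R ->
    covered W z.
  move=> zS sS s0 zs; pose r := perp rat s.1.
  have half r' t : r' = r \/ r' = - r -> feasible S (z + t *: r') ->
      (exists s', [/\ s' \in S, pr r' s'.1 < 0 & pr (z + t *: r') s'.1 = s'.2%:~R]) ->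
      covered W (z + t *: r').
    move=> r'E zt [s' [s'S rs' zs']]; apply: covered_mem; apply: candW.
    rewrite mem_filter zt; apply/allpairsP; exists (s, s'); split=> //=.
    apply: (cramerP _ _ zs').
      by move: rs'; case: r'E => ->; rewrite ?prN pr_perp;
        apply: contraTneq => ->; rewrite ?oppr0 ltxx.
    rewrite prD prZ zs (_ : pr r' s.1 = 0) ?mulr0 ?addr0 //.
    by case: r'E => ->; rewrite ?prN pr_perp /det2 mulrC subrr ?oppr0.
  have rn : r != 0 by exact: perp_neq0.
  have rn' : - r != 0 by rewrite oppr_eq0.
  have [t1 [s1 [t10 s1S zt1 rs1 zs1]]] := line_hit zS (bounded _ rn).
  have [t2 [s2 [t20 s2S zt2 rs2 zs2]]] := line_hit zS (bounded _ rn').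
  have c1 := half r t1 (or_introl erefl) zt1 (ex_intro _ s1 (And3 s1S rs1 zs1)).
  have c2 := half (- r) t2 (or_intror erefl) zt2 (ex_intro _ s2 (And3 s2S rs2 zs2)).
  exact: (covered_between t10 t20 c1 c2).
move=> z zS.
(* Any nonzero direction would serve for the chord. *)
pose r : 'cV[rat]_2 := \col_i (1 : rat).
have rn : r != 0.
  by apply/eqP => /matrixP/(_ 0 0); rewrite !mxE => /eqP; rewrite oner_eq0.
have rn' : - r != 0 by rewrite oppr_eq0.
have nonzero (r' : 'cV[rat]_2) p : pr r' p < 0 -> p != 0.
  by apply: contraTneq => ->; rewrite prE !mxE !mul0r addr0 ltxx.
have [t1 [s1 [t10 s1S zt1 rs1 zs1]]] := line_hit zS (bounded _ rn).
have [t2 [s2 [t20 s2S zt2 rs2 zs2]]] := line_hit zS (bounded _ rn').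
have c1 := tight_cov _ _ zt1 s1S (nonzero _ _ rs1) zs1.
have c2 := tight_cov _ _ zt2 s2S (nonzero _ _ rs2) zs2.
exact: (covered_between t10 t20 c1 c2).
Qed.

End VertexCover.

Section RationalFace.
Variable R : realType.

Lemma ratr_col_inj_pr (z : 'cV[rat]_2) p : pr (map_mx ratr z) p = ratr (pr z p) :> R.
Proof. exact: pr_map. Qed.

(* Two independent tight constraints make [l] rational; otherwise move [l] along
   the line cut out by the only one. *)
Lemma rational_face (V : seq 'rV[int]_2) (l : 'cV[R]_2) :
  (forall p, p \in V -> -1 <= pr l p) ->
  exists z : 'cV[rat]_2, forall p, p \in V ->
    -1 <= pr z p /\ (pr l p = -1 <-> pr z p = -1).
Proof.
move=> lV.
have lift (z : 'cV[rat]_2) : (forall p, p \in V -> -1 <= pr (map_mx ratr z) p :> R /\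
     (pr l p = -1 <-> pr (map_mx ratr z) p = -1 :> R)) ->
   exists z : 'cV[rat]_2, forall p, p \in V ->
    -1 <= pr z p /\ (pr l p = -1 <-> pr z p = -1).
  move=> H; exists z => p pV; have [] := H p pV; rewrite ratr_col_inj_pr.
  have m1 : -1 = ratr (-1) :> R by rewrite rmorphN rmorph1.
  rewrite {1}m1 ler_rat => zp e; split=> //; rewrite e m1; split=> [/fmorph_inj //|-> //].
have [[p [q [pV qV lp lq d0]]]|nA] := pselect (exists p q,
    [/\ p \in V, q \in V, pr l p = -1, pr l q = -1 & det2 p q != 0]).
  apply: (lift (cramer rat (p, -1) (q, -1))).
  have -> : map_mx ratr (cramer rat (p, -1) (q, -1)) = l.
    rewrite [RHS](@cramerP R (p, -1) (q, -1)) ?rmorphN1 //.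
    by apply/matrixP => i j; rewrite !mxE fmorph_div !rmorph_int.
  by move=> p' p'V; split=> //; exact: lV.
have [[p [pV lp]]|nB] := pselect (exists p, p \in V /\ pr l p = -1); last first.
  exists 0 => p pV; rewrite pr0; split; first by rewrite lerN10.
  split=> [lp|/eqP]; first by case: nB; exists p.
  by rewrite eq_sym oppr_eq0 oner_eq0.
have pn : (p 0 0)%:~R != 0 :> R \/ (p 0 1)%:~R != 0 :> R.
  have [p0|] := eqVneq ((p 0 0)%:~R : R) 0; last by left.
  right; apply/eqP => p1; move: lp; rewrite prE p0 p1 !mul0r addr0 => /eqP.
  by rewrite eq_sym oppr_eq0 oner_eq0.
pose N : int := p 0 0 * p 0 0 + p 0 1 * p 0 1.
have N0 : N%:~R != 0 :> R.
  rewrite /N rmorphD !rmorphM /= -!expr2 paddr_eq0 ?sqr_ge0 // !sqrf_eq0 negb_and.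
  exact/orP.
(* All active constraints are multiples of [p], hence equal to [p]. *)
have active q : q \in V -> pr l q = -1 -> forall u : 'cV[R]_2, pr u q = pr u p.
  move=> qV lq u.
  have d0 : det2 p q = 0.
    by apply/eqP; apply: contrapT => /negP d0; case: nA; exists p, q.
  have D0 : (p 0 0)%:~R * (q 0 1)%:~R = (p 0 1)%:~R * (q 0 0)%:~R :> R.
    by rewrite -!intrM; congr _%:~R; apply/eqP; rewrite -subr_eq0; apply/eqP.
  move: lp lq; rewrite !prE => lp lq.
  have q0 : (q 0 0)%:~R = (p 0 0)%:~R :> R.
    apply: oppr_inj; rewrite -mulN1r -{1}lp -[in RHS]mulN1r -lq.
    by rewrite !mulrDl; congr (_ + _); [ring|move: D0 => /(congr1 (fun x => x * l 1 0)) D0; lra].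
  have q1 : (q 0 1)%:~R = (p 0 1)%:~R :> R.
    apply: oppr_inj; rewrite -mulN1r -{1}lp -[in RHS]mulN1r -lq.
    by rewrite !mulrDl; congr (_ + _); [move: D0 => /(congr1 (fun x => x * l 0 0)) D0; lra|ring].
  by rewrite q0 q1.
pose z0 : 'cV[rat]_2 := \col_(i < 2) (- (p 0 i)%:~R / N%:~R).
pose r := perp rat p.
have lE : exists t : R, l = map_mx ratr z0 + t *: map_mx ratr r.
  exists (((p 0 0)%:~R * l 1 0 - (p 0 1)%:~R * l 0 0) / N%:~R).
  move: lp; rewrite prE; set a := (p 0 0)%:~R; set b := (p 0 1)%:~R => lp.
  have NE : N%:~R = a * a + b * b :> R by rewrite /N rmorphD !rmorphM.
  have e0 : l 0 0 * N%:~R = - a + (a * l 1 0 - b * l 0 0) * - b.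
    by rewrite NE -[- a]mulN1r -lp; ring.
  have e1 : l 1 0 * N%:~R = - b + (a * l 1 0 - b * l 0 0) * a.
    by rewrite NE -[- b]mulN1r -lp; ring.
  apply: col2_eq; rewrite !mxE /= !(fmorph_div, rmorphN) /= !rmorph_int -/a -/b.
    by rewrite -[LHS](mulfK N0) e0; field.
  by rewrite -[LHS](mulfK N0) e1; field.
have [t lt] := lE.
(* Strict inequalities persist for t' near t. The slack [pr l q + 1] is divided by the rate of
   change, enlarged by 1 to be positive. *)
have near (W : seq 'rV[int]_2) : exists e : R, 0 < e /\ forall q, q \in W ->
    -1 < pr l q -> forall t', `|t' - t| < e ->
    -1 < pr (map_mx ratr z0 + t' *: map_mx ratr r) q.
  elim: W => [|q W [e [e0 IH]]]; first by exists 1; split.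
  have [lq|lq] := leP (pr l q) (-1).
    exists e; split=> // q'; rewrite inE => /orP[/eqP ->|]; last exact: IH.
    by move=> /lt_le_trans/(_ lq); rewrite ltxx.
  pose b : R := pr (map_mx ratr r) q.
  exists (Order.min e ((pr l q + 1) / (`|b| + 1))); split.
    by rewrite lt_min e0 /= divr_gt0 //; have := normr_ge0 b; lra.
  move=> q'; rewrite inE => /orP[/eqP -> _|q'W lq'] t'; rewrite lt_min => /andP[te].
    have b1 : 0 < `|b| + 1 by have := normr_ge0 b; lra.
    rewrite ltr_pdivlMr // => te'.
    rewrite (_ : _ + _ = l + (t' - t) *: map_mx ratr r); last first.
      by rewrite lt; apply/matrixP => i j; rewrite !mxE; ring.
    rewrite prD prZ -/b.
    have : `|(t' - t) * b| <= `|t' - t| * (`|b| + 1).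
      by rewrite normrM ler_wpM2l // lerDl ler01.
    have := ler_norm (- ((t' - t) * b)); rewrite normrN; lra.
  by move=> _; exact: IH.
have [e [e0 He]] := near V.
have [t' tt'] : exists t' : rat, `|ratr t' - t| < e.
  have [|t'] := @rat_in_itvoo R (t - e) (t + e); first by lra.
  by rewrite in_itv /= => /andP[h1 h2]; exists t'; rewrite ltr_norml; lra.
apply: (lift (z0 + t' *: r)) => q qV.
have -> : map_mx ratr (z0 + t' *: r) = map_mx ratr z0 + ratr t' *: map_mx ratr r :> 'cV[R]_2.
  by rewrite map_mxD map_mxZ.
have pE : pr (map_mx ratr z0 + ratr t' *: map_mx ratr r) p = -1 :> R.
  have pr_r : pr (map_mx ratr r) p = 0 :> R.
    by rewrite ratr_col_inj_pr pr_perp /det2 mulrC subrr rmorph0.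
  by move: lp; rewrite lt !prD !prZ pr_r !mulr0.
have [lq|lq] := eqVneq (pr l q) (-1).
  by rewrite !(active q qV lq) pE lp lexx.
have lq' : -1 < pr l q by rewrite lt_neqAle eq_sym lq lV.
have H := He q qV lq' _ tt'; split; first exact: ltW.
by split=> [/eqP|e1]; [rewrite (negPf lq)|move: H; rewrite e1 ltxx].
Qed.

End RationalFace.

(** * Convex hulls and the vertices of a Fano polygon *)

Section ConvexHull.
Variable R : realType.
Implicit Types (x y : 'rV[R]_2) (u : 'cV[R]_2) (A : set 'rV[R]_2) (s : seq 'rV[R]_2).

Definition dot x u : R := (x *m u) 0 0.

Lemma dotDl x y u : dot (x + y) u = dot x u + dot y u.
Proof. by rewrite /dot mulmxDl mxE. Qed.
Lemma dotZl a x u : dot (a *: x) u = a * dot x u.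
Proof. by rewrite /dot -scalemxAl mxE. Qed.
Lemma dot0l u : dot 0 u = 0. Proof. by rewrite /dot mul0mx mxE. Qed.
Lemma dotBr x u u' : dot x (u - u') = dot x u - dot x u'.
Proof. by rewrite /dot mulmxBr !mxE. Qed.
Lemma dotZr a x u : dot x (a *: u) = a * dot x u.
Proof. by rewrite /dot -scalemxAr mxE. Qed.
Lemma dot_suml (I : Type) (r : seq I) (G : I -> 'rV[R]_2) u :
  dot (\sum_(i <- r) G i) u = \sum_(i <- r) dot (G i) u.
Proof. by rewrite (big_morph (dot^~ u) (fun x y => dotDl x y u) (dot0l u)). Qed.

Lemma sub_conv A : A `<=` conv_hull A.
Proof.
move=> x Ax; exists 1%N, (fun=> 1), (fun=> x); split=> //.
  by rewrite big_ord1.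
by rewrite big_ord1 scale1r.
Qed.

Lemma conv_ge A u t : (forall x, A x -> t <= dot x u) ->
  forall x, conv_hull A x -> t <= dot x u.
Proof.
move=> H _ [n [c [a [c0 Aa c1 ->]]]]; rewrite dot_suml.
rewrite -[t]mul1r -c1 mulr_suml; apply: ler_sum => i _.
by rewrite dotZl ler_wpM2l // H.
Qed.

Lemma conv_eq A u t : (forall x, A x -> dot x u = t) ->
  forall x, conv_hull A x -> dot x u = t.
Proof.
move=> H _ [n [c [a [c0 Aa c1 ->]]]]; rewrite dot_suml.
rewrite -[t]mul1r -c1 mulr_suml; apply: eq_bigr => i _.
by rewrite dotZl H.
Qed.

Lemma conv_mix A x y t : 0 <= t <= 1 -> conv_hull A x -> conv_hull A y ->
  conv_hull A (t *: x + (1 - t) *: y).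
Proof.
move=> /andP[t0 t1] [n [c [a [c0 Aa c1 ->]]]] [m [d [b [d0 Ab d1 ->]]]].
exists (n + m)%N, (fun i => match fintype.split i with inl j => t * c j | inr j => (1 - t) * d j end),
  (fun i => match fintype.split i with inl j => a j | inr j => b j end); split.
- by move=> i; case: fintype.split => j; rewrite mulr_ge0 // subr_ge0.
- by move=> i; case: fintype.split => j.
- rewrite big_split_ord /=.
  under eq_bigr do rewrite (unsplitK (inl _)).
  under [X in _ + X]eq_bigr do rewrite (unsplitK (inr _)).
  by rewrite -!mulr_sumr c1 d1; ring.
- rewrite big_split_ord /= !scaler_sumr; congr (_ + _); apply: eq_bigr => i _.
    by rewrite (unsplitK (inl _)) scalerA.
  by rewrite (unsplitK (inr _)) scalerA.
Qed.

Lemma conv_cons x a s : conv_hull [set` a :: s] x ->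
  x = a \/ exists t y, [/\ 0 <= t < 1, conv_hull [set` s] y & x = t *: a + (1 - t) *: y].
Proof.
move=> [n [c [b [c0 bs c1 ->]]]].
pose t := \sum_(i | b i == a) c i.
have tc : t + \sum_(i | b i != a) c i = 1 by rewrite -c1 [RHS](bigID (fun i => b i == a)).
have t0 : 0 <= t by rewrite sumr_ge0.
have r0 : 0 <= \sum_(i | b i != a) c i by rewrite sumr_ge0.
have bE : \sum_i c i *: b i = t *: a + \sum_(i | b i != a) c i *: b i.
  rewrite (bigID (fun i => b i == a)) /= scaler_suml; congr (_ + _).
  by apply: eq_bigr => i /eqP ->.
have [t1|t1] := eqVneq t 1.
  left; rewrite bE t1 scale1r big1 ?addr0 // => i bi.
  have : \sum_(i | b i != a) c i = 0 by lra.
  by move=> /eqP; rewrite psumr_eq0 // => /allP/(_ i (mem_index_enum i));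
    rewrite bi /= => /eqP ->; rewrite scale0r.
right; have t1' : 0 < 1 - t by rewrite subr_gt0 lt_neqAle t1; lra.
have [i0 bi0] : exists i, b i != a.
  apply: contrapT => H; move: t1; rewrite -c1 => /eqP; apply.
  by apply: eq_bigl => i; apply/eqP; apply: contrapT => /eqP bi; case: H; exists i.
have bs' i : b i != a -> b i \in s.
  by have := bs i; rewrite /= inE => /orP[->|].
exists t, (\sum_i ((if b i == a then 0 else c i) / (1 - t)) *:
   (if b i == a then b i0 else b i)); split.
- by rewrite t0 /= -subr_gt0.
- exists n, (fun i => (if b i == a then 0 else c i) / (1 - t)),
     (fun i => if b i == a then b i0 else b i); split=> //.
  + by move=> i; rewrite divr_ge0 ?(ltW t1') //; case: ifP.
  + by move=> i; case: eqVneq => /= [_|]; exact: bs'.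
  + rewrite -mulr_suml (eq_bigr (fun i => if b i != a then c i else 0)); last first.
      by move=> i _; case: eqP.
    rewrite -big_mkcond /= (_ : \sum_(i | b i != a) c i = 1 - t); last by lra.
    by rewrite divff // gt_eqF.
- rewrite bE; congr (_ + _); rewrite scaler_sumr big_mkcond /=.
  apply: eq_bigr => i _; case: eqVneq => //= _; first by rewrite mul0r scale0r scaler0.
  by rewrite scalerA mulrC divfK // gt_eqF.
Qed.

Lemma conv_rem a s : a \in s -> conv_hull [set` rem a s] a ->
  conv_hull [set` rem a s] = conv_hull [set` s].
Proof.
move=> sa ra; rewrite eqEsubset; split=> x.
  by move=> [n [c [b [c0 bs c1 ->]]]]; exists n, c, b; split=> // i; apply: mem_rem (bs i).
move=> [n [c [b [c0 bs c1 ->]]]].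
have : conv_hull [set` a :: rem a s] (\sum_i c i *: b i).
  exists n, c, b; split=> // i; have := bs i; rewrite /= inE.
  have [-> //|bia] := eqVneq (b i) a.
  by rewrite (perm_mem (perm_to_rem sa)) inE (negPf bia).
move=> /conv_cons[-> //|[t [y [/andP[t0 t1] ry ->]]]].
by apply: conv_mix => //; rewrite t0 ltW.
Qed.

(** If a lies inside a segment yz of the hull, moving the weights of a in y and z to the left side
    expresses a through the other points, unless y or z is a itself. *)
Lemma vertex_or_redundant a s : a \in s ->
  vertex (conv_hull [set` s]) a \/ conv_hull [set` rem a s] a.
Proof.
move=> sa; have [|nr] := pselect (conv_hull [set` rem a s] a); [by right|left].
split=> [|y z t Py Pz /andP[t0 t1] e]; first exact: sub_conv.
have sub : conv_hull [set` s] `<=` conv_hull [set` a :: rem a s].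
  move=> x [n [c [b [c0 bs c1 ->]]]]; exists n, c, b; split=> // i.
  by have := bs i; rewrite /= (perm_mem (perm_to_rem sa)).
have t1n : 1 - t != 0 by rewrite subr_eq0 gt_eqF.
have tn : t != 0 by rewrite gt_eqF.
have ya : y = a -> z = a.
  move=> ya; apply: (scalerI t1n); apply/matrixP => i j.
  by have := congr1 (fun m : 'rV[R]_2 => m i j) e; rewrite ya !mxE; lra.
have za : z = a -> y = a.
  move=> za; apply: (scalerI tn); apply/matrixP => i j.
  by have := congr1 (fun m : 'rV[R]_2 => m i j) e; rewrite za !mxE; lra.
have [ey|[m [y' [/andP[m0 m1] ry ey]]]] := conv_cons (sub y Py).
  by split=> //; exact: ya.
have [ez|[q [z' [/andP[q0 q1] rz ez]]]] := conv_cons (sub z Pz).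
  by split=> //; exact: za.
case: nr.
(* The total weight of a in t y + (1 - t) z; it is less than 1, so the rest can be renormalized by 1
   - om. *)
pose om := t * m + (1 - t) * q.
have om1 : 0 < 1 - om.
  rewrite /om; have : t * m < t by rewrite gtr_pMr.
  have : (1 - t) * q < 1 - t by rewrite gtr_pMr // subr_gt0.
  lra.
pose lam := t * (1 - m) / (1 - om).
have l1 : (1 - om) * lam = t * (1 - m) by rewrite /lam mulrC divfK ?gt_eqF.
have l2 : (1 - om) * (1 - lam) = (1 - t) * (1 - q).
  by rewrite mulrBr l1 mulr1 /om; ring.
have aE : a = lam *: y' + (1 - lam) *: z'.
  apply: (scalerI (lt0r_neq0 om1)); rewrite scalerDr !scalerA l1 l2.
  by rewrite scalerBl scale1r {1}e ey ez /om; apply/matrixP => i j; rewrite !mxE; ring.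
have p1 : 0 <= t * (1 - m) by rewrite mulr_ge0 ?(ltW t0) // subr_ge0 ltW.
have p2 : 0 <= (1 - t) * (1 - q) by rewrite mulr_ge0 // subr_ge0 ltW.
have lam0 : 0 <= lam by rewrite divr_ge0 // ltW.
have lam1 : lam <= 1 by rewrite -subr_ge0 -(pmulr_rge0 _ om1) l2.
by rewrite [X in conv_hull _ X]aE; apply: (conv_mix _ ry rz); rewrite lam0.
Qed.

Lemma conv_vertices s : exists s', conv_hull [set` s'] = conv_hull [set` s] /\
  forall a, a \in s' -> vertex (conv_hull [set` s]) a.
Proof.
have [n] := ubnP (size s); elim: n s => // n IH s lt.
have [all_v|] := pselect (forall a, a \in s -> vertex (conv_hull [set` s]) a).
  by exists s.
move=> /existsNP[a /not_implyP[sa nv]].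
have [//|ra] := vertex_or_redundant sa.
have [|s' [e H]] := IH (rem a s).
  by rewrite size_rem //; case: (s) sa lt.
by exists s'; rewrite -(conv_rem sa ra).
Qed.

(** The dual formulation of the origin being interior to the convex hull of V. *)
Definition spans (V : seq 'rV[int]_2) : Prop :=
  forall l : 'cV[R]_2, l != 0 -> exists2 p, p \in V & pr l p < 0.

Lemma fano_vertices (P : set 'rV[R]_2) : fano_polygon P ->
  exists V : seq 'rV[int]_2, [/\ P = conv_hull (lattice_pt R @` [set` V]),
    forall p, p \in V -> vertex P (lattice_pt R p) & spans V].
Proof.
move=> [[s Ps] Pv Pint].
have [s' [es' vs']] := conv_vertices s.
have /choice[g gP] : forall x, exists p : 'rV[int]_2, x \in s' -> x = lattice_pt R p.
  move=> x; have [xs|] := boolP (x \in s'); last by exists 0.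
  by have [|p _ ->] := Pv x; [rewrite Ps; exact: vs'|exists p].
have PE : P = conv_hull (lattice_pt R @` [set` [seq g x | x <- s']]).
  rewrite Ps -es'; congr conv_hull; rewrite eqEsubset; split=> [x xs|_ [_ /mapP[x xs ->] <-]].
    by exists (g x); [apply/mapP; exists x|rewrite -gP].
  by rewrite /= -gP.
exists [seq g x | x <- s']; split=> // [_ /mapP[x xs ->]|l l0].
  by rewrite -gP // Ps; exact: vs'.
apply: contrapT => H.
have Pl x : P x -> 0 <= dot x l.
  rewrite PE; apply: conv_ge => _ [p pV <-].
  by rewrite leNgt; apply/negP => neg; apply: H; exists p.
have /nbhs_ballP[e /= e0 He] : nbhs (0 : 'rV[R]_2) P by exact: Pint.
pose N := 1 + `|l 0 0| + `|l 1 0|.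
have N0 : 0 < N by have := normr_ge0 (l 0 0); have := normr_ge0 (l 1 0); rewrite /N; lra.
(* Small enough for - t l^T to lie in the ball around the origin contained in P. Its pairing with l
   is - t times the sum of the squares of the entries, so nonnegativity of l on P would force l =
   0. *)
pose t := e / 2 / N.
have t0 : 0 < t by rewrite !divr_gt0.
have Px : P (- t *: l^T).
  have small (a : R) : `|a| <= N -> `|0 - - t * a| < e.
    move=> aN; rewrite sub0r mulNr opprK normrM gtr0_norm //.
    apply: (@le_lt_trans _ _ (t * N)); first by rewrite ler_wpM2l // ltW.
    by rewrite /t divfK ?gt_eqF // ltr_pdivrMr //; lra.
  apply: He; split=> // i j; rewrite !mxE; apply: small; rewrite (ord1 i).
  have n0 := normr_ge0 (l 0 0); have n1 := normr_ge0 (l 1 0).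
  case: j => [[|[|//]] lt2].
    by rewrite (_ : Ordinal lt2 = 0) /N; [lra|exact: val_inj].
  by rewrite (_ : Ordinal lt2 = 1) /N; [lra|exact: val_inj].
have := Pl _ Px; rewrite dotZl mulNr oppr_ge0 pmulr_rle0 //.
rewrite /dot mxE big_ord_recl big_ord1 !mxE -!expr2.
rewrite (_ : lift ord0 ord0 = 1); last exact: val_inj.
move=> le0; have := sqr_ge0 (l 0 0); have := sqr_ge0 (l 1 0) => s1 s0.
move/eqP: l0; apply; apply: col2_eq; rewrite mxE; apply/eqP; rewrite -sqrf_eq0;
  apply/eqP; apply/le_anti/andP; split=> //; lra.
Qed.

End ConvexHull.

Definition phi_at (F : realDomainType) (w : 'cV[int]_2) (f : 'rV[int]_2) (u : 'cV[F]_2) :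
    'cV[F]_2 :=
  u - Num.min 0 (pr u f) *: map_mx intr w.

Section MutationPolar.
Variable R : realType.

(** The number min(0, <u, f>) is the minimum of u on the segment F, attained at an end s0. At height
    h, adding h F or removing |h| F changes the minimum of u by h times this number, which is what
    phi subtracts. At negative heights the vertices of P suffice to recover the bound on P. *)
Lemma mutation_polar (P P' : set 'rV[R]_2) w f G (V V' : seq 'rV[int]_2) :
  P = conv_hull (lattice_pt R @` [set` V]) ->
  (forall p, p \in V -> vertex P (lattice_pt R p)) ->
  P' = conv_hull (lattice_pt R @` [set` V']) ->
  pairing w (lattice_pt R f) = 0 ->
  (forall h : int, h < 0 ->
     [/\ lattice_polytope (G h),
         vertices_at w P h `<=` minkowski_sum (G h) (dilate `|h|%:~R (@segment R f)) &
         minkowski_sum (G h) (dilate `|h|%:~R (@segment R f)) `<=` slice w P h]) ->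
  P' = mutation w f G P ->
  forall (t : R) u, (forall p, p \in V -> t <= pr u p) <->
    (forall p, p \in V' -> t <= pr (phi_at w f u) p).
Proof.
move=> PE PV P'E wf HG P'M t u.
pose wR : 'cV[R]_2 := map_mx intr w; pose mn := Num.min 0 (pr u f).
have fw : dot (lattice_pt R f) wR = 0 by [].
have phiE x : dot x (phi_at w f u) = dot x u - mn * dot x wR.
  by rewrite /phi_at dotBr dotZr.
have seg_w s : @segment R f s -> dot s wR = 0.
  by apply: conv_eq => x [->|->]; rewrite ?dot0l.
have seg_u s : @segment R f s -> mn <= dot s u.
  by apply: conv_ge => x [->|->]; rewrite ?dot0l /mn ge_min ?lexx ?orbT.
have [s0 [Ss0 s0u]] : exists s, @segment R f s /\ dot s u = mn.
  have [le|lt] := leP 0 (pr u f).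
    by exists 0; split; [apply: sub_conv; left|rewrite dot0l /mn min_l].
  by exists (lattice_pt R f); split; [apply: sub_conv; right|rewrite /mn min_r // ltW].
have slice_w h x : slice w P h x -> dot x wR = h%:~R.
  by apply: conv_eq => _ [p [_ e] <-].
split=> [Vu p pV'|V'u p pV].
- have Pu x : P x -> t <= dot x u.
    by rewrite PE; apply: conv_ge => _ [q qV <-]; exact: Vu.
  have slice_u h x : slice w P h x -> t <= dot x u.
    by apply: conv_ge => _ [q [Pq _] <-]; exact: Pu.
  have : P' (lattice_pt R p) by rewrite P'E; apply: sub_conv; exists p.
  rewrite P'M -[pr _ p]/(dot (lattice_pt R p) _); move: (lattice_pt R p).
  apply: conv_ge => x [[h /= h0 Gx]|[h /= h0 [y Sy [_ [s Ss <-] <-]]]].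
    have [_ _ /(_ (x + `|h|%:~R *: s0)) H] := HG h h0.
    have {H} Sx : slice w P h (x + `|h|%:~R *: s0).
      by apply: H; exists x => //; exists (`|h|%:~R *: s0) => //; exists s0.
    have := slice_u _ _ Sx; have := slice_w _ _ Sx; rewrite phiE !dotDl !dotZl.
    rewrite (seg_w _ Ss0) mulr0 addr0 s0u => ->.
    by rewrite (ltr0_norm h0) rmorphN /=; lra.
  rewrite phiE !dotDl !dotZl (seg_w _ Ss) (slice_w _ _ Sy) mulr0 addr0.
  have := slice_u _ _ Sy; have hR : 0 <= h%:~R :> R by rewrite ler0z.
  by have := ler_wpM2l hR (seg_u _ Ss); lra.
have P'u x : P' x -> t <= dot x (phi_at w f u).
  by rewrite P'E; apply: conv_ge => _ [q qV' <-]; exact: V'u.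
have Pp : P (lattice_pt R p) by rewrite PE; apply: sub_conv; exists p.
pose h : int := pr w p.
have hE : pairing w (lattice_pt R p) = h%:~R.
  by rewrite -[LHS]/(pr (map_mx intr w) p) pr_map.
rewrite -[pr u p]/(dot (lattice_pt R p) u).
have [h0|h0] := leP 0 h.
  have hR : 0 <= h%:~R :> R by rewrite ler0z.
  have : P' (lattice_pt R p + h%:~R *: s0).
    rewrite P'M; apply: sub_conv; right; exists h => //.
    exists (lattice_pt R p); first by apply: sub_conv; exists p.
    by exists (h%:~R *: s0) => //; exists s0.
  move=> /P'u; rewrite phiE !dotDl !dotZl (seg_w _ Ss0) s0u mulr0 addr0.
  rewrite -[dot _ wR]/(pairing w (lattice_pt R p)) hE; lra.
have [_ Hv _] := HG h h0.
have [g Gg [_ [s Ss <-] e]] := Hv _ (conj (PV p pV) hE).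
have := P'u g; rewrite P'M phiE => /(_ (sub_conv (or_introl (ex_intro2 _ _ h h0 Gg)))).
rewrite -e dotDl dotZl.
have -> : dot g wR = h%:~R.
  rewrite -hE -[RHS]/(dot (lattice_pt R p) wR) -e dotDl dotZl (seg_w _ Ss).
  by rewrite mulr0 addr0.
have hR : 0 <= `|h|%:~R :> R by rewrite ler0z.
have := ler_wpM2l hR (seg_u _ Ss).
rewrite (ltr0_norm h0) rmorphN /=; lra.
Qed.

Lemma mutation_polar_map (F : realDomainType) (g : {rmorphism F -> R})
    w f (V V' : seq 'rV[int]_2) : {mono g : x y / x <= y} ->
  (forall (t : R) u, (forall p, p \in V -> t <= pr u p) <->
    (forall p, p \in V' -> t <= pr (phi_at w f u) p)) ->
  forall (t : F) u, (forall p, p \in V -> t <= pr u p) <->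
    (forall p, p \in V' -> t <= pr (phi_at w f u) p).
Proof.
move=> gmono H t u.
have phi_map : map_mx g (phi_at w f u) = phi_at w f (map_mx g u).
  rewrite /phi_at pr_map map_mxB map_mxZ -map_mx_comp; congr (_ - _ *: _).
    rewrite -(rmorph0 g) !minEle !gmono; by case: ifP; rewrite ?rmorph0.
  by apply/matrixP => i j; rewrite !mxE /= rmorph_int.
have [H1 H2] := H (g t) (map_mx g u); split=> Hu p pV; rewrite -gmono -pr_map.
  by rewrite phi_map; apply: H1 => // q qV; rewrite pr_map gmono Hu.
by apply: H2 => // q qV; rewrite -phi_map pr_map gmono Hu.
Qed.

End MutationPolar.

(** * Tangent cones of the polar polygon *)

Section TangentCones.
Variables (w : 'cV[int]_2) (f : 'rV[int]_2).
Local Notation M := 'cV[int]_2.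
Implicit Types (u v z : M) (V : seq 'rV[int]_2) (d : int).

Definition lev u : int := Num.min 0 (pr u f).
Definition phi u : M := u - lev u *: w.

(* The derivative of [lev] at [z]. *)
Definition dlev z u : int :=
  if 0 < pr z f then 0 else if pr z f < 0 then pr u f else lev u.

Definition inside V (t : int) u : bool := all (fun p => t <= pr u p) V.

Lemma insideP V t u : reflect (forall p, p \in V -> t <= pr u p) (inside V t u).
Proof. exact: allP. Qed.

Definition tangent V d z u : bool :=
  all (fun p => (pr z p == - d) ==> (0 <= pr u p)) V.

Lemma tangentP V d z u :
  reflect (forall p, p \in V -> pr z p = - d -> 0 <= pr u p) (tangent V d z u).
Proof.
apply: (iffP allP) => H p pV; first by move/eqP; exact/implyP/H.
by apply/implyP => /eqP; exact: H.
Qed.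

Lemma tangent0 V d z : tangent V d z 0.
Proof. by apply/tangentP => p _ _; rewrite pr0. Qed.

Lemma tangentD V d z u v : tangent V d z u -> tangent V d z v -> tangent V d z (u + v).
Proof.
move=> /tangentP Hu /tangentP Hv; apply/tangentP => p pV zp.
by rewrite prD addr_ge0 ?Hu ?Hv.
Qed.

Lemma tangent_sub V d z u : inside V (- d) u -> tangent V d z (u - z).
Proof.
by move=> /insideP Hu; apply/tangentP => p pV zp; rewrite prB zp subr_ge0 Hu.
Qed.

Lemma seq_bound (T : eqType) (s : seq T) (P : T -> nat -> Prop) :
  (forall x, x \in s -> exists N0, forall N, (N0 <= N)%N -> P x N) ->
  exists N0, forall N, (N0 <= N)%N -> forall x, x \in s -> P x N.
Proof.
elim: s => [|x s IH] H; first by exists 0%N.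
have [N1 H1] := H x (mem_head x s).
have [|N2 H2] := IH; first by move=> y ys; apply: H; rewrite inE ys orbT.
exists (maxn N1 N2) => N; rewrite geq_max => /andP[le1 le2] y.
by rewrite inE => /orP[/eqP ->|]; [exact: H1|exact: H2].
Qed.

(** Tangency without reference to tight constraints: u + N z eventually lies in N d Q. In this form
    it can be carried through the piecewise linear map. *)
Lemma tangent_lim V d z u : inside V (- d) z ->
  tangent V d z u <->
  exists N0, forall N, (N0 <= N)%N -> inside V (- (d *+ N)) (u + z *+ N).
Proof.
move=> /insideP Hz; split=> [/tangentP Tu|[N0 HN]].
  have [|N0 HN0] := @seq_bound _ V (fun p N => - (d *+ N) <= pr (u + z *+ N) p).
    move=> p pV; have [e|ne] := eqVneq (pr z p) (- d).
      exists 0%N => N _; rewrite prD prMn e mulNrn.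
      by rewrite lerDr Tu.
    exists `|pr u p|%N => N le; rewrite prD prMn.
    have lt : - d + 1 <= pr z p by rewrite lezD1 lt_neqAle eq_sym ne Hz.
    have : (- d + 1) *+ N <= pr z p *+ N by rewrite lerMn2r lt orbT.
    rewrite mulrnDl mulNrn; have : - (N : int) <= pr u p by lia.
    by rewrite (_ : 1 *+ N = N :> int) ?natz //; lia.
  by exists N0 => N le; apply/insideP; exact: HN0.
apply/tangentP => p pV zp; have /insideP/(_ p pV) := HN N0 (leqnn _).
by rewrite prD prMn zp mulNrn lerDr.
Qed.

Lemma levD u v : lev u + lev v <= lev (u + v).
Proof. by rewrite /lev prD; lia. Qed.

Lemma levMn u N : lev (u *+ N) = lev u *+ N.
Proof.
rewrite /lev prMn; have [le|lt] := leP 0 (pr u f).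
  by rewrite mul0rn min_l // mulrn_wge0.
by rewrite min_r // mulrn_wle0 // ltW.
Qed.

Lemma natE (x : int) N : x *+ N = x * (N : int).
Proof. by rewrite -mulr_natr natz. Qed.

Lemma mulrn_scale u N : u *+ N = (N : int) *: u.
Proof. by rewrite -scaler_nat natz. Qed.

Lemma dlev_der z u N : lev (u + z *+ N) <= dlev z u + lev z *+ N.
Proof.
rewrite /dlev /lev prD prMn !natE.
have N0 : 0 <= (N : int) by [].
have [zp|zn|z0] := ltgtP (pr z f) 0.
- have := mulr_le0_ge0 (ltW zp) N0; lia.
- have := mulr_ge0 (ltW zn) N0; lia.
- by rewrite z0 !mul0r; lia.
Qed.

Lemma dlev_lim z u : exists N0, forall N, (N0 <= N)%N ->
  lev (u + z *+ N) = dlev z u + lev z *+ N.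
Proof.
exists `|pr u f|%N => N le; rewrite /dlev /lev prD prMn !natE.
have [zp|zn|z0] := ltgtP (pr z f) 0.
- have : pr z f * (N : int) <= -1 * (N : int) by rewrite ler_wpM2r //; lia.
  lia.
- have : 1 * (N : int) <= pr z f * (N : int) by rewrite ler_wpM2r //; lia.
  lia.
- by rewrite z0 !mul0r; lia.
Qed.

Lemma dlev0 z : dlev z 0 = 0.
Proof. by rewrite /dlev /lev pr0 minxx; case: ltgtP. Qed.

Lemma dlevD z u v : dlev z u + dlev z v <= dlev z (u + v).
Proof. by rewrite /dlev; case: ltgtP => _; rewrite ?prD ?levD ?addr0. Qed.

Lemma tangent_between V d z u (i m : nat) : (i <= m)%N -> tangent V d z u ->
  tangent V d z (u + w *+ m) -> tangent V d z (u + w *+ i).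
Proof.
move=> le /tangentP H0 /tangentP Hm; apply/tangentP => p pV zp.
have := H0 p pV zp; have := Hm p pV zp; rewrite !prD !prMn !natE.
have [w0|w0] := leP 0 (pr w p); first by have := mulr_ge0 w0 (isT : 0 <= (i : int)); lia.
have : pr w p * (m : int) <= pr w p * (i : int) by rewrite ler_wnM2l // ltW.
lia.
Qed.

(** The boolean e selects a side of the wall; on either closed side [dlev z] is additive. *)
Lemma dlev_sum z (e : bool) (c : seq M) :
  (forall b, b \in c -> 0 <= (-1) ^+ e * pr b f) ->
  dlev z (\sum_(b <- c) b) = \sum_(b <- c) dlev z b.
Proof.
move=> Hc; suff [] : dlev z (\sum_(b <- c) b) = \sum_(b <- c) dlev z b /\
  0 <= (-1) ^+ e * pr (\sum_(b <- c) b) f by [].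
elim: c Hc => [|b c IH] Hc; first by rewrite !big_nil dlev0 pr0 mulr0.
have [|e1 s1] := IH; first by move=> b' bc; apply: Hc; rewrite inE bc orbT.
rewrite !big_cons -e1 prD mulrDr; have := Hc b (mem_head b c) => s0.
split; last exact: addr_ge0.
rewrite /dlev; case: ltgtP => // _; rewrite ?prD // /lev prD.
by move: s0 s1; case: (e); rewrite /= ?expr0 ?expr1 ?mul1r ?mulN1r; lia.
Qed.

(* Splitting along [f] keeps the generators on one side of the wall, where
   [dlev] is additive. *)
Lemma tangent_gen V d z : exists B : seq M, [/\ 0 \in B, all (tangent V d z) B &
  forall u, tangent V d z u -> exists c : seq M, [/\ {subset c <= B},
    u = \sum_(b <- c) b & dlev z u = \sum_(b <- c) dlev z b]].
Proof.
pose E := [seq p <- V | pr z p == - d].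
have TE u : tangent V d z u = dual_cone E u.
  by rewrite /dual_cone all_filter; apply: eq_all => p.
have [Bp [Bp1 Bp2]] := gordan (f :: E); have [Bn [Bn1 Bn2]] := gordan (- f :: E).
exists (0 :: Bp ++ Bn); split=> [||u]; first exact: mem_head.
  rewrite /= tangent0 all_cat /=; apply/andP; split; apply/allP => b.
    by move=> /(allP Bp1) /= /andP[_]; rewrite TE.
  by move=> /(allP Bn1) /= /andP[_]; rewrite TE.
rewrite TE => Eu; have [le|lt] := leP 0 (pr u f).
  have Cu : dual_cone (f :: E) u by rewrite /= le.
  have [c cB uE] := Bp2 u Cu; exists c; split=> //.
    by move=> b /cB; rewrite inE mem_cat => ->; rewrite orbT.
  rewrite uE (@dlev_sum z false) // => b /cB/(allP Bp1) /= /andP[b0 _].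
  by rewrite mul1r.
have Cu : dual_cone (- f :: E) u by rewrite /= prNr oppr_ge0 ltW.
have [c cB uE] := Bn2 u Cu; exists c; split=> //.
  by move=> b /cB; rewrite inE mem_cat => ->; rewrite !orbT.
rewrite uE (@dlev_sum z true) // => b /cB/(allP Bn1) /= /andP[].
by rewrite prNr mulN1r.
Qed.

Hypothesis wf : pr w f = 0.

Lemma lev_w u (a : int) : lev (u + a *: w) = lev u.
Proof. by rewrite /lev prD prZ wf mulr0 addr0. Qed.

Lemma dlev_w z u (a : int) : dlev z (u + a *: w) = dlev z u.
Proof. by rewrite /dlev lev_w prD prZ wf mulr0 addr0. Qed.

Section Mutation.
Variables (V V' : seq 'rV[int]_2).
Hypothesis phiV : forall t u, inside V t u = inside V' t (phi u).

(** For N large, phi(u + N z) = (u - dlev z u w) + N phi(z). So the derivative of phi at z carries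
    one tangent cone onto the other. *)
Lemma tangent_phi d z u : inside V (- d) z ->
  tangent V d z u = tangent V' d (phi z) (u - dlev z u *: w).
Proof.
move=> Hz; have Hz' : inside V' (- d) (phi z) by rewrite -phiV.
have [N1 HN1] := dlev_lim z u.
have phiE N : (N1 <= N)%N ->
    phi (u + z *+ N) = u - dlev z u *: w + phi z *+ N.
  move=> le; rewrite /phi (HN1 N le) natE !mulrn_scale.
  by apply/matrixP => i j; rewrite !mxE; ring.
apply/idP/idP => [/(tangent_lim _ Hz)[N0 HN]|/(tangent_lim _ Hz')[N0 HN]].
  apply/(tangent_lim _ Hz'); exists (maxn N0 N1) => N; rewrite geq_max => /andP[l0 l1].
  rewrite -(phiE N l1) -phiV; exact: HN.
apply/(tangent_lim _ Hz); exists (maxn N0 N1) => N; rewrite geq_max => /andP[l0 l1].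
rewrite phiV (phiE N l1); exact: HN.
Qed.

Lemma tangent_mu d z u v (i : nat) : inside V (- d) z ->
  tangent V d z u -> tangent V d z v ->
  (i <= `|(dlev z (u + v) - dlev z u - dlev z v)%R|)%N ->
  tangent V d z (u + v + w *+ i).
Proof.
move=> Hz Tu Tv le; apply: (tangent_between le); first exact: tangentD.
rewrite (tangent_phi _ Hz) mulrn_scale dlev_w.
rewrite gez0_abs; last by have := dlevD z u v; lia.
move: Tu Tv; rewrite !(tangent_phi _ Hz) => Tu Tv.
(* At the extreme exponent the derivative of phi takes the deformed sum of u and v to the ordinary
   sum of their images. *)
suff -> (a b c : int) : u + v + (c - a - b) *: w - c *: w = u - a *: w + (v - b *: w).
  exact: tangentD.
by rewrite !scalerBl; apply/matrixP => i' j; rewrite !mxE; ring.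
Qed.

(** Kept transparent, as its fields have to reduce to [dlev] and [tangent]. *)
Definition deform_at d z (Hz : inside V (- d) z) : deform M.
Proof.
refine (@Deform M w (dlev z) (tangent V d z) (dlev0 z) _ (dlevD z)
  (tangent0 V d z) (fun u v i => @tangent_mu d z u v i Hz)).
by move=> u; rewrite -[w]scale1r dlev_w.
Defined.

Lemma tangent_chart d z u (i : nat) : inside V (- d) z -> inside V (- d) u ->
  (i <= `|(dlev z (u - z) + lev z - lev u)%R|)%N ->
  tangent V d z (u - z + w *+ i).
Proof.
move=> Hz Hu le; apply: (tangent_between le); first exact: tangent_sub.
rewrite (tangent_phi _ Hz) mulrn_scale dlev_w gez0_abs; last first.
  by rewrite subr_ge0; have := dlev_der z (u - z) 1; rewrite !mulr1n subrK.
suff -> (a b c : int) : u - z + (a + b - c) *: w - a *: w = u - c *: w - (z - b *: w).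
  by apply: tangent_sub; rewrite -[_ - _]/(phi u) -phiV.
by rewrite !(scalerBl, scalerDl); apply/matrixP => i' j; rewrite !mxE; ring.
Qed.

End Mutation.

End TangentCones.

(** * Choice of the lattice points *)

Section PointSelection.
Local Notation M := 'cV[int]_2.

Definition polar (V : seq 'rV[int]_2) (z : 'cV[rat]_2) : bool :=
  all (fun p => -1 <= pr z p) V.

Lemma polar0 V : polar V 0.
Proof. by apply/allP => p _; rewrite pr0. Qed.

(** A face is recorded by the constraints tight on it, a tuple of booleans; there are finitely many
    tuples, and one point is chosen for each. *)
Lemma face_reps V : exists W : seq 'cV[rat]_2, all (polar V) W /\
  forall z, polar V z -> exists2 z', z' \in W &
    forall p, p \in V -> (pr z' p == -1) = (pr z p == -1).
Proof.
pose act (z : 'cV[rat]_2) := [tuple of [seq pr z p == -1 | p <- in_tuple V]].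
have /choice[g gP] : forall m : (size V).-tuple bool, exists z, polar V z /\
    forall z', polar V z' -> act z' = m -> act z = m.
  move=> m; have [[z [Vz zm]]|H] := pselect (exists z, polar V z /\ act z = m).
    by exists z.
  (* Patterns that occur at no point of the polar polygon receive the origin as a harmless
     default. *)
  exists 0; split=> [|z Vz zm]; first exact: polar0.
  by case: H; exists z.
exists [seq g m | m : (size V).-tuple bool]; split.
  by apply/allP => _ /mapP[m _ ->]; case: (gP m).
move=> z Vz; exists (g (act z)); first by apply: map_f; rewrite mem_enum.
have [_ /(_ z Vz erefl)] := gP (act z) => /(congr1 val) /= /eq_in_map e p pV.
exact: e.
Qed.

Lemma common_denominator (W : seq 'cV[rat]_2) : exists2 d : nat, (0 < d)%N &
  forall z, z \in W -> exists u : M, map_mx intr u = z *+ d.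
Proof.
elim: W => [|z W [d d0 IH]]; first by exists 1%N.
have clear_entry (x : rat) : exists2 a : nat, (0 < a)%N & exists m : int, m%:~R = x *+ a.
  exists `|denq x|%N; first by rewrite absz_gt0 denq_neq0.
  exists (numq x); rewrite -mulr_natr natr_absz ger0_norm ?denq_ge0 //.
  by rewrite -{2}[x]divq_num_den divfK // intr_eq0 denq_neq0.
have [a a0 [m mE]] := clear_entry (z 0 0); have [b b0 [l lE]] := clear_entry (z 1 0).
exists (a * b * d)%N => [|x]; first by rewrite !muln_gt0 a0 b0.
rewrite inE => /orP[/eqP ->|/IH[u uE]]; last first.
  by exists (u *+ (a * b)); rewrite raddfMn /= uE -mulrnA mulnC.
exists (\col_(i < 2) if i == 0 then m *+ (b * d) else l *+ (a * d)).
by apply: col2_eq; rewrite mxE mulmxnE mxE /= rmorphMn /= ?mE ?lE -!mulrnA; congr (_ *+ _); lia.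
Qed.

Variables (w : M) (f : 'rV[int]_2) (V V' : seq 'rV[int]_2).
Hypothesis wf : pr w f = 0.
Hypothesis V_bounded : forall r : 'cV[rat]_2, r != 0 -> has (fun p => pr r p < 0) V.

Definition half (e : bool) : seq ('rV[int]_2 * int) :=
  ((if e then - f else f), 0) :: [seq (p, -1) | p <- V].

Definition walls : seq 'cV[rat]_2 := candidates (half false) ++ candidates (half true).

Lemma half_feasible e z :
  feasible (half e) z = (0 <= (-1) ^+ e * pr z f) && polar V z.
Proof.
rewrite /feasible /= all_map /polar; congr (_ && _).
by case: e; rewrite ?prNr ?expr1 ?mulN1r ?expr0 ?mul1r.
Qed.

Lemma walls_polar : all (polar V) walls.
Proof.
rewrite all_cat; apply/andP; split; apply/allP => z;
  by rewrite mem_filter half_feasible => /andP[/andP[]].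
Qed.

(** The decomposition is made inside one half of the polar polygon, cut along the wall, so that h is
    additive on it. *)
Lemma walls_cover z : polar V z -> exists (e : bool) (c : seq 'cV[rat]_2),
  [/\ c != [::], {subset c <= walls}, \sum_(x <- c) x = z *+ size c &
    forall x, x \in c -> 0 <= (-1) ^+ e * pr x f].
Proof.
move=> Vz; have [e ze] : exists e : bool, 0 <= (-1) ^+ e * pr z f.
  have [le|/ltW lt] := leP 0 (pr z f); first by exists false; rewrite expr0 mul1r.
  by exists true; rewrite expr1 mulN1r oppr_ge0.
have [|||c [cn cS cE]] := @vertex_cover (half e) (candidates (half e)) _ _ z.
- by [].
- move=> r /V_bounded; rewrite /= => /hasP[p pV rp]; apply/orP; right.
  by apply/hasP; exists (p, -1) => //=; apply: map_f.
- by rewrite half_feasible ze.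
exists e, c; split=> // x /cS; last first.
  by rewrite mem_filter half_feasible => /andP[/andP[]].
by rewrite mem_cat; case: (e) => ->; rewrite ?orbT.
Qed.

Lemma phi_atK z : phi_at w f (phi_at (- w) f z) = z :> 'cV[rat]_2.
Proof.
have wfQ : pr (map_mx intr w) f = 0 :> rat by rewrite pr_map wf.
rewrite /phi_at prB prZ map_mxN prN wfQ oppr0 mulr0 subr0 scalerN opprK.
by rewrite addrK.
Qed.

Lemma phi_at_scale z (v : M) (d : nat) : map_mx intr v = z *+ d ->
  map_mx intr (phi w f v) = phi_at w f z *+ d :> 'cV[rat]_2.
Proof.
move=> vE; rewrite /phi /phi_at map_mxB map_mxZ /= vE mulrnBl; congr (_ - _).
rewrite scalerMnl; congr (_ *: _).
have prv : (pr v f)%:~R = pr z f *+ d by rewrite -pr_map vE prMn.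
rewrite /lev; have [zf|zf] := leP 0 (pr z f).
  by rewrite mul0rn min_l // -(ler_int rat) prv mulrn_wge0.
by rewrite min_r // -(ler_int rat) prv mulrn_wle0 // ltW.
Qed.

Hypothesis phiV : forall t (u : M), inside V t u = inside V' t (phi w f u).
Hypothesis phiQ : forall z, polar V z = polar V' (phi_at w f z).

(* Representatives of all faces of both polar polygons, and the corners of the
   two halves of the first one. *)
Lemma polar_points : exists W : seq 'cV[rat]_2, [/\ all (polar V) W,
  {subset walls <= W},
  forall z, polar V z -> exists2 x, x \in W &
    forall p, p \in V -> (pr x p == -1) = (pr z p == -1) &
  forall z, polar V' z -> exists2 x, x \in W &
    forall p, p \in V' -> (pr (phi_at w f x) p == -1) = (pr z p == -1)].
Proof.
have [W [WV Wface]] := face_reps V; have [W' [WV' Wface']] := face_reps V'.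
exists (walls ++ W ++ [seq phi_at (- w) f z | z <- W']); split.
- rewrite all_cat walls_polar all_cat WV all_map /=; apply/allP => z /(allP WV') Vz.
  by rewrite /= phiQ phi_atK.
- by move=> x xW; rewrite mem_cat xW.
- move=> z /Wface[x xW xz]; exists x => //.
  by rewrite !mem_cat xW orbT.
- move=> z /Wface'[x xW xz]; exists (phi_at (- w) f x).
    by rewrite !mem_cat (map_f (phi_at (- w) f) xW) !orbT.
  by move=> p pV; rewrite phi_atK xz.
Qed.

Lemma dlevMn (z u : M) e : (0 < e)%N -> dlev f (z *+ e) u = dlev f z u.
Proof. by move=> e0; rewrite /dlev prMn !(pmulrn_lgt0, pmulrn_llt0). Qed.

Lemma tangentMn (d : int) (z u : M) e : (0 < e)%N ->
  tangent V (d *+ e) (z *+ e) u = tangent V d z u.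
Proof.
move=> e0; apply: eq_all => p; congr (_ ==> _).
by rewrite prMn -mulNrn !natE (inj_eq (mulIf _)) // gt_eqF.
Qed.

(** d clears denominators. A further factor e does not affect tangent cones or derivatives of h,
    while for e large the finitely many generators b, moved to b + e v, enter the dilated polygon
    and h is linearized there. These points form L and generate in every chart. *)
Lemma lattice_points (W : seq 'cV[rat]_2) : all (polar V) W ->
  exists (d : nat) (v : 'cV[rat]_2 -> M) (L : seq M),
  [/\ (0 < d)%N, all (inside V (- (d : int))) L,
    forall z, z \in W -> map_mx intr (v z) = z *+ d /\ v z \in L &
    forall z u, z \in W -> tangent V d (v z) u -> exists c : seq M,
      [/\ forall x, x \in c -> x \in L,
        \sum_(x <- c) x = u + v z *+ size c &
        \sum_(x <- c) lev f x = dlev f (v z) u + lev f (v z) *+ size c]].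
Proof.
move=> WV; have [d d0 /choice[v vE]] : exists2 d : nat, (0 < d)%N &
    forall z, exists u : M, z \in W -> map_mx intr u = z *+ d.
  have [d d0 H] := common_denominator W; exists d => // z.
  by have [/H[u uE]|] := boolP (z \in W); [exists u|exists 0].
have Vv z : z \in W -> inside V (- (d : int)) (v z).
  move=> zW; apply/insideP => p pV; rewrite -(ler_int rat) -pr_map vE // prMn.
  have := allP (allP WV z zW) p pV; rewrite -(ler_pMn2r d0) mulNrn.
  by rewrite rmorphN.
have /choice[B BP] z := tangent_gen f V d (v z).
pose good z b e := inside V (- (d : int) *+ e) (b + v z *+ e) /\
  lev f (b + v z *+ e) = dlev f (v z) b + lev f (v z) *+ e.
have [E HE] : exists E, forall e, (E <= e)%N -> forall z, z \in W ->
    forall b, b \in B z -> good z b e.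
  apply: seq_bound => z zW.
  have [E HE] : exists E, forall e, (E <= e)%N -> forall b, b \in B z -> good z b e.
    apply: seq_bound => b bB; have [_ /allP/(_ b bB) Tb _] := BP z.
    have [E1 HE1] := (tangent_lim b (Vv z zW)).1 Tb.
    have [E2 HE2] := dlev_lim f (v z) b.
    exists (maxn E1 E2) => e; rewrite geq_max => /andP[l1 l2].
    by split; [rewrite mulNrn; exact: HE1|exact: HE2].
  by exists E.
(* The successor keeps e positive, as invariance under scaling requires. *)
pose e := E.+1; have {}HE := HE e (leqnSn E).
pose L := [seq b + v z *+ e | z <- W, b <- B z].
have memL z b : z \in W -> b \in B z -> b + v z *+ e \in L.
  by move=> zW bB; apply/allpairsPdep; exists z, b.
exists (d * e)%N, (fun z => v z *+ e), L; split=> [||z zW|z u zW].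
- by rewrite muln_gt0 d0.
- apply/allP => _ /allpairsPdep[z [b [zW bB ->]]].
  by rewrite PoszM -mulNr -natE; case: (HE z zW b bB).
- split; last by rewrite -[_ *+ e]add0r; apply: memL => //; case: (BP z).
  by rewrite raddfMn /= vE // mulrnA.
rewrite PoszM -natE tangentMn // dlevMn //.
have [_ _ H] := BP z => /H[c [cB -> ->]].
exists [seq b + v z *+ e | b <- c]; split.
- by move=> _ /mapP[b /cB bB ->]; exact: memL.
- rewrite big_map big_split /= size_map; congr (_ + _).
  by rewrite big_const_seq count_predT iter_addr_0.
rewrite big_map size_map levMn.
rewrite (eq_big_seq (fun b => dlev f (v z) b + lev f (v z) *+ e)); last first.
  by move=> b /cB bB; case: (HE z zW b bB).
by rewrite big_split /= big_const_seq count_predT iter_addr_0.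
Qed.
Lemma point_selection : exists (d : nat) (n : nat) (pt : 'I_n.+1 -> M)
    (Vpt : forall i, inside V (- (d : int)) (pt i)) (spc : pred 'I_n.+1),
  [/\ (0 < d)%N /\
    forall i, spc i -> special w (lev f) pt i (deform_at wf phiV (Vpt i)),
    forall i, exists c, [/\ c != [::], all spc c, psum pt c = pt i *+ size c &
      hsum (lev f) pt c = lev f (pt i) *+ size c],
    forall z, polar V z -> exists2 i, spc i &
      forall p, p \in V -> (pr (pt i) p == - (d : int)) = (pr z p == -1) &
    forall z, polar V' z -> exists2 i, spc i &
      forall p, p \in V' -> (pr (phi w f (pt i)) p == - (d : int)) = (pr z p == -1)].
Proof.
have [W [WV wallsW faceW faceW']] := polar_points.
have [d [v [L [d0 LV vW genW]]]] := lattice_points WV.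
have [z0 z0W _] := faceW 0 (polar0 V).
have [_ vz0L] := vW z0 z0W.
have szL : (0 < size L)%N by case: (L) vz0L.
pose n := (size L).-1; have nE : n.+1 = size L by rewrite prednK.
pose pt (i : 'I_n.+1) := nth 0 L i.
have ptL i : pt i \in L by rewrite mem_nth // -nE.
have /choice[ix ixP] : forall x : M, exists i : 'I_n.+1, x \in L -> pt i = x.
  move=> x; have [xL|] := boolP (x \in L); last by exists ord0.
  have lt : (index x L < n.+1)%N by rewrite nE index_mem.
  by exists (Ordinal lt) => _; rewrite /pt /= nth_index.
have Vpt i : inside V (- (d : int)) (pt i) by exact: (allP LV).
(* Only the points that come from W carry charts; the others serve as generators. *)
pose spc (i : 'I_n.+1) := pt i \in [seq v z | z <- W].
have spcv z : z \in W -> spc (ix (v z)) /\ pt (ix (v z)) = v z.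
  by move=> zW; have [_ vL] := vW z zW; rewrite /spc ixP // map_f.
have act (x : 'cV[rat]_2) (u : M) p : map_mx intr u = x *+ d ->
    (pr u p == - (d : int)) = (pr x p == -1).
  move=> uE; rewrite -(eqr_int rat) -pr_map uE prMn rmorphN /= -[- (d : int)%:~R]mulN1r.
  rewrite -[(d : int)%:~R]/(d%:R : rat) -[pr x p *+ d]mulr_natr (inj_eq (mulIf _)) //.
  by rewrite pnatr_eq0 -lt0n.
exists d, n, pt, Vpt, spc; split.
- split=> // i spci; split=> //= [u N|u|i' j le|u Tu].
  + exact: dlev_der.
  + exact: dlev_lim.
  + exact: tangent_chart le.
  have /mapP[z zW ziE] := spci.
  rewrite ziE in Tu; have [c [cL cE cE']] := genW z u zW Tu.
  exists [seq ix x | x <- c]; split.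
    rewrite /psum big_map size_map ziE -cE.
    by apply: eq_big_seq => x /cL xL; rewrite ixP.
  rewrite /hsum big_map size_map -[dh _ u]/(dlev f (pt i) u) ziE -cE'.
  by apply: eq_big_seq => x /cL xL; rewrite ixP.
(* x is the point of Q with d x = [pt i]; it is a rational combination of corners of one half of Q,
   all of them special. *)
- move=> i; pose x : 'cV[rat]_2 := d%:R^-1 *: map_mx intr (pt i).
  have dn0 : d%:R != 0 :> rat by rewrite pnatr_eq0 -lt0n.
  have xE : map_mx intr (pt i) = x *+ d by rewrite -scaler_nat scalerA divff // scale1r.
  have Vx : polar V x.
    apply/allP => p pV; rewrite prZ pr_map -(ler_pM2l (_ : 0 < d%:R)) ?ltr0n //.
    rewrite mulrA divff // mul1r mulrN1.
    by have := insideP _ _ _ (Vpt i) p pV; rewrite -(ler_int rat) rmorphN.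
  have [e [c [cn cW cE ce]]] := walls_cover Vx.
  have {cW} cW y : y \in c -> y \in W by move=> /cW /wallsW.
  exists [seq ix (v y) | y <- c]; rewrite size_map.
  have sumE : \sum_(y <- c) v y = pt i *+ size c.
    have : map_mx intr (\sum_(y <- c) v y) = map_mx intr (pt i *+ size c) :> 'cV[rat]_2.
      rewrite raddf_sum raddfMn /= xE -mulrnA mulnC mulrnA -cE -sumrMnl.
      by apply: eq_big_seq => y /cW yW; case: (vW y yW).
    move=> /matrixP H; apply/matrixP => a b; have := H a b.
    by rewrite ![map_mx _ _ a b]mxE => /intr_inj.
  split.
  + by case: (c) cn.
  + by rewrite all_map; apply/allP => y /cW/spcv[].
  + rewrite /psum big_map -sumE; apply: eq_big_seq => y /cW/spcv[_].
    exact.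
  rewrite /hsum big_map -levMn -sumE.
  rewrite (eq_big_seq (fun y => lev f (v y))) => [|y /cW/spcv[_ -> //]].
  (* [lev] is its own derivative at the origin, so the additivity on one side of the wall applies to
     it. *)
  have dl u : lev f u = dlev f 0 u by rewrite /dlev pr0 ltxx.
  rewrite dl -[\sum_(y <- c) v y](big_map v xpredT idfun) (@dlev_sum _ _ e).
    by rewrite big_map; apply: eq_bigr => y _; rewrite dl.
  move=> _ /mapP[y yc ->]; have [vE _] := vW y (cW y yc).
  rewrite -(ler_int rat) rmorphM rmorph_sign -pr_map vE prMn mulrnAr.
  by rewrite mulrn_wge0 ?ce.
- move=> z /faceW[x xW xz]; have [vE _] := vW x xW; have [sx ptx] := spcv x xW.
  by exists (ix (v x)) => // p pV; rewrite ptx (act x) ?xz.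
move=> z /faceW'[x xW xz]; have [vE _] := vW x xW; have [sx ptx] := spcv x xW.
exists (ix (v x)) => // p pV; rewrite ptx (act (phi_at w f x)) ?xz //.
exact: phi_at_scale.
Qed.

End PointSelection.

(** * Fans and the theorem *)

Section FaceCones.
Variables (R : realType) (P : set 'rV[R]_2) (U : seq 'rV[int]_2).
Hypothesis PU : P = conv_hull (lattice_pt R @` [set` U]).
Local Notation M := 'cV[int]_2.
Local Notation face l c := [set x | P x /\ (x *m l) 0 0 = c].

Lemma pairing_lattice (u : M) p : pairing u (lattice_pt R p) = (pr u p)%:~R.
Proof. exact: (pr_map intr). Qed.

(** A convex combination attains the maximum of l only if every generator of nonzero weight does, so
    a bound on the generators in the face carries over to the face. *)
Lemma face_ge (A : set 'rV[R]_2) (l u : 'cV[R]_2) c t :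
  (forall x, A x -> dot x l <= c) ->
  (forall x, A x -> dot x l = c -> t <= dot x u) ->
  forall x, conv_hull A x -> dot x l = c -> t <= dot x u.
Proof.
move=> Al Au _ [n [a [y [a0 Ay a1 ->]]]] lc.
have tight i : a i != 0 -> dot (y i) l = c.
  move=> ai; have : \sum_i a i * (c - dot (y i) l) = 0.
    under eq_bigr do rewrite mulrBr.
    rewrite sumrB -mulr_suml a1 mul1r -lc dot_suml.
    by apply/eqP; rewrite subr_eq0; apply/eqP/eq_bigr => j _; rewrite dotZl.
  have s0 j : 0 <= a j * (c - dot (y j) l) by rewrite mulr_ge0 // subr_ge0 Al.
  move=> /eqP; rewrite psumr_eq0 // => /allP/(_ i (mem_index_enum i)) /=.
  by rewrite mulf_eq0 (negPf ai) subr_eq0 => /eqP.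
rewrite dot_suml -[t]mul1r -a1 mulr_suml; apply: ler_sum => i _; rewrite dotZl.
have [->|ai] := eqVneq (a i) 0; first by rewrite !mul0r.
by rewrite ler_wpM2l // Au // tight.
Qed.

Lemma face_dual (l : 'cV[R]_2) (c : R) (d : int) (q : M) :
  (forall x, P x -> dot x l <= c) ->
  (forall p, p \in U -> dot (lattice_pt R p) l = c <-> pr q p = - d) ->
  (forall u, dual_monoid (cone_over (face l c)) u <-> tangent U d q u) /\
  forall p, p \in U -> pr q p = - d -> cone_over (face l c) (lattice_pt R p).
Proof.
move=> Pl act.
have UP p : p \in U -> P (lattice_pt R p).
  by move=> pU; rewrite PU; apply: sub_conv; exists p.
have cone_p p : p \in U -> pr q p = - d -> cone_over (face l c) (lattice_pt R p).
  move=> pU qp; right; exists (lattice_pt R p).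
    by split; [exact: UP|apply/act].
  by exists 1; rewrite ?scale1r.
split=> // u; split=> [Hu|/tangentP Tu x [->|[y [Py yl] [t t0 ->]]]].
- apply/tangentP => p pU qp; have := Hu _ (cone_p p pU qp).
  by rewrite pairing_lattice ler0z.
- by rewrite -[pairing _ _]/(dot 0 _) dot0l.
rewrite -[pairing _ _]/(dot (t *: y) _) dotZl mulr_ge0 //.
move: Py; rewrite {1}PU => Py; apply: face_ge Py yl => [a Aa|_ [p pU <-] pl].
  by apply: Pl; rewrite PU; exact: sub_conv.
rewrite -[dot _ _]/(pairing u (lattice_pt R p)) pairing_lattice ler0z.
by apply: Tu => //; apply/act.
Qed.

Hypothesis (P0 : P 0) (Usp : spans R U).

(** Since c > 0, the functional - l / c lies in the polar polygon and is tight on the face;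
    [rational_face] replaces it by a rational one with the same tight constraints. *)
Lemma proper_face_polar E : proper_face P E -> exists (l : 'cV[R]_2) (c : R) (z : 'cV[rat]_2),
  [/\ E = face l c, forall x, P x -> dot x l <= c, polar U z &
    forall p, p \in U -> dot (lattice_pt R p) l = c <-> pr z p = -1].
Proof.
move=> [nP [l [c [Pl Ec]]]].
have UP p : p \in U -> P (lattice_pt R p).
  by move=> pU; rewrite PU; apply: sub_conv; exists p.
(* If c = 0, then either l = 0 and the face is P itself, or P lies in a half-plane bounded by a line
   through the origin. *)
have c0 : 0 < c.
  have := Pl 0 P0; rewrite -[(0 *m l) 0 0]/(dot 0 l) dot0l le_eqVlt => /orP[/eqP c0|//].
  have [l0|l0] := eqVneq l 0.
    case: nP; rewrite Ec l0 -c0 eqEsubset; split=> [y []|y Py] //; split=> //.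
    by rewrite mulmx0 mxE.
  have [|p pU] := Usp (_ : - l != 0); first by rewrite oppr_eq0.
  rewrite prN oppr_lt0 => /lt_geF.
  by rewrite {1}c0 (Pl _ (UP p pU)).
have lE p : pr (- c^-1 *: l) p = - (dot (lattice_pt R p) l / c).
  by rewrite prZ mulNr mulrC.
have [z zP] : exists z : 'cV[rat]_2, forall p, p \in U ->
    -1 <= pr z p /\ (pr (- c^-1 *: l) p = -1 <-> pr z p = -1).
  apply: rational_face => p pU; rewrite lE lerN2 ler_pdivrMr // mul1r.
  by apply: Pl; exact: UP.
exists l, c, z; split=> // [|p pU].
  by apply/allP => p pU; case: (zP p pU).
have [_ <-] := zP p pU; rewrite lE; split=> [->|/oppr_inj].
  by rewrite divff // gt_eqF.
by move=> /(congr1 (fun x => x * c)); rewrite divfK ?gt_eqF // mul1r.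
Qed.

Variables (I : Type) (spc : pred I) (q : I -> M) (d : nat).
Hypothesis qU : forall i, spc i -> inside U (- (d : int)) (q i).
Hypothesis faces : forall z, polar U z -> exists2 i, spc i &
  forall p, p \in U -> (pr (q i) p == - (d : int)) = (pr z p == -1).

(** The last clause puts the vertices tight at two points into the intersection of their cones,
    which is what [carrier_conduct] depends on. *)
Definition carries i (s : set 'rV[R]_2) : Prop :=
  [/\ spc i, forall u, dual_monoid s u <-> tangent U d (q i) u &
    forall p, p \in U -> pr (q i) p = - (d : int) -> s (lattice_pt R p)].

Lemma cone_carrier s : spanning_fan P s -> exists i, carries i s.
Proof.
move=> [E /proper_face_polar[l [c [z [-> Pl Vz zact]]]] <-].
have [i spi ziact] := faces Vz; exists i.
have [|H1 H2] := @face_dual l c d (q i) Pl; last by split.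
by move=> p pU; rewrite zact //; split=> /eqP; [rewrite -ziact|rewrite ziact] => // /eqP.
Qed.

(** At a vertex tight for [q i] only, the shift is positive and enough copies of it outweigh u; a
    vertex tight for both lies in the two cones, where u is nonnegative already. *)
Lemma carrier_conduct i s j t u : carries i s -> carries j t ->
  dual_monoid (s `&` t) u ->
  exists K, dual_monoid s (u + (q j - q i) *+ K).
Proof.
move=> [spi si ai] [spj sj aj] Hu.
have [K HK] : exists K, forall N, (K <= N)%N -> forall p, p \in U ->
    pr (q i) p = - (d : int) -> 0 <= pr (u + (q j - q i) *+ N) p.
  apply: seq_bound => p pU; have [qjp|qjp] := eqVneq (pr (q j) p) (- (d : int)).
    exists 0%N => N _ qip; rewrite prD prMn prB qip qjp subrr mul0rn addr0.
    by rewrite -(ler0z R) -pairing_lattice; apply: Hu; split; [exact: ai|exact: aj].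
  exists `|pr u p|%N => N le qip; rewrite prD prMn prB qip opprK.
  have lt : 1 <= pr (q j) p + (d : int).
    have := insideP _ _ _ (qU spj) p pU; move/eqP: qjp; lia.
  have : 1 *+ N <= (pr (q j) p + (d : int)) *+ N by rewrite lerMn2r lt orbT.
  by rewrite natz; lia.
by exists K; apply/si/tangentP => p pU; exact: HK.
Qed.

Hypothesis d0 : (0 < d)%N.

(** The face is where - q i takes the value d on P. It is proper because that functional vanishes at
    the origin and d > 0. *)
Lemma carrier_cone i : spc i -> exists s, spanning_fan P s /\ carries i s.
Proof.
move=> spi; pose l : 'cV[R]_2 := - map_mx intr (q i).
have lE p : dot (lattice_pt R p) l = - (pr (q i) p)%:~R.
  by rewrite /l -[dot _ _]/(pr _ p) prN pr_map.
have Pl x : P x -> dot x l <= d%:R.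
  have NlE y : dot y (- l) = - dot y l by rewrite -scaleN1r dotZr mulN1r.
  rewrite -lerN2 -NlE PU; apply: conv_ge => _ [p pU <-].
  rewrite NlE lE opprK; have := insideP _ _ _ (qU spi) p pU.
  by rewrite -(ler_int R) rmorphN.
exists (cone_over (face l d%:R)); split.
  exists (face l d%:R) => //; split; last by exists l, d%:R.
  move=> e; have : face l d%:R 0 by rewrite e.
  case=> _; rewrite mul0mx mxE => /eqP; rewrite eq_sym pnatr_eq0.
  by rewrite gtn_eqF.
have [|H1 H2] := @face_dual l d%:R d (q i) Pl; last by split.
move=> p pU; rewrite lE; split=> [|->]; last by rewrite rmorphN opprK.
by move=> e; apply/eqP; rewrite -(eqr_int R) rmorphN /= -[_%:~R]opprK e.
Qed.

End FaceCones.

Section PolygonFibre.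
Variables (R : realType) (k : fieldType) (w : 'cV[int]_2) (f : 'rV[int]_2).
Variables (V V' : seq 'rV[int]_2).
Hypothesis wf : pr w f = 0.
Hypothesis phiV : forall t u, inside V t u = inside V' t (phi w f u).
Variables (d n : nat) (pt : 'I_n.+1 -> 'cV[int]_2).
Hypothesis d0 : (0 < d)%N.
Hypothesis Vpt : forall i, inside V (- (d : int)) (pt i).
Variable spc : pred 'I_n.+1.
Hypothesis spP : forall i, spc i -> special w (lev f) pt i (deform_at wf phiV (Vpt i)).
Hypothesis spcover : forall i, exists c, [/\ c != [::], all spc c,
  psum pt c = pt i *+ size c & hsum (lev f) pt c = lev f (pt i) *+ size c].

(** P stands for either polygon, with vertices U: the original one for [eps = false], its mutation
    for [eps = true]. The hypotheses say that [psi] and its derivative match the lattice points and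
    tangent cones with those of the polar polygon of P. *)
Lemma polygon_fibre (P : set 'rV[R]_2) (U : seq 'rV[int]_2) (c : k) (eps : bool) :
  c != 0 -> P = conv_hull (lattice_pt R @` [set` U]) -> P 0 -> spans R U ->
  (forall i, inside U (- (d : int)) (psi w (lev f) eps (pt i))) ->
  (forall i u, tangent V d (pt i) (u + dlev f (pt i) u *: ew w eps) =
    tangent U d (psi w (lev f) eps (pt i)) u) ->
  (forall z, polar U z -> exists2 i, spc i & forall p, p \in U ->
    (pr (psi w (lev f) eps (pt i)) p == - (d : int)) = (pr z p == -1)) ->
  is_toric_variety (spanning_fan P)
    (fibre (fam_pi k w (lev f) pt) (fib_a c eps) (fib_b c eps)).
Proof.
move=> c0 PU P0 Usp Uq tanU faces.
pose q i := psi w (lev f) eps (pt i).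
have qU i : spc i -> inside U (- (d : int)) (q i) by move=> _; exact: Uq.
have /choice[vs vsP] : forall s : {s | spanning_fan P s},
    exists i, carries U spc q d i (sval s).
  by move=> [s Ps]; exact: (cone_carrier PU P0 Usp faces Ps).
have tan_shift i j : tangent U d (q i) (q j - q i) by exact/tangent_sub/Uq.
apply: (fibre_toric (levD f) _ (levMn f) c0 spP spcover (vs := vs)).
- by move=> u; rewrite -[w in _ + w]scale1r (lev_w wf).
- by move=> s; case: (vsP s).
- by move=> s u; case: (vsP s) => _ -> _; rewrite -tanU.
- by move=> s t u [su _]; have [_ H _] := vsP s; apply: (H _).2 u su; exact: tan_shift.
- by move=> s t u; exact: (carrier_conduct qU (vsP s) (vsP t)).
move=> v spv; have [s [Ps [_ sv _]]] := carrier_cone PU P0 qU d0 spv.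
exists (exist _ s Ps); have [_ su _] := vsP (exist _ s Ps).
change (tangent V d (pt v) (ipsi w eps (deform_at wf phiV (Vpt v))
  (q v - q (vs (exist _ s Ps))))).
rewrite tanU; apply/sv/su; exact: tan_shift.
Qed.

End PolygonFibre.

Theorem theorem1p3 (R : realType) (P P' : set 'rV[R]_2)
    (P_fano : fano_polygon P) (P'_fano : fano_polygon P')
    (P_P' : combinatorial_mutation P P') :
  exists (X : kfunctor R[i]) (pi : kmor X (affine_plane R[i])),
    [/\ is_scheme X, flat pi, projective pi,
        forall b : R[i], b != 0 ->
          is_toric_variety (spanning_fan P) (fibre pi 0 b) &
        forall a : R[i], a != 0 ->
          is_toric_variety (spanning_fan P') (fibre pi a 0)].
Proof.
have origin (Q : set 'rV[R]_2) : fano_polygon Q -> Q 0.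
  by case=> _ _ /interior_subset.
have [V [PV Vv Vsp]] := fano_vertices P_fano.
have [V' [PV' _ Vsp']] := fano_vertices P'_fano.
have [w [f [G [_ [_ wfR] HG P'M]]]] := P_P'.
have wf : pr w f = 0.
  by apply/eqP; rewrite -(intr_eq0 R) -pairing_lattice wfR.
have H := mutation_polar PV Vv PV' wfR HG P'M.
(* The comparison of polar polygons is proved over the reals and pulled back to integral u here, and
   to rational points next, along order embeddings. *)
have phiV t (u : 'cV[int]_2) : inside V t u = inside V' t (phi w f u).
  have HZ := mutation_polar_map (g := intr) (ler_int R) H t u.
  have -> : phi w f u = phi_at w f u.
    by rewrite /phi /phi_at; congr (_ - _ *: _); apply/matrixP => i j; rewrite mxE intz.
  by apply/insideP/insideP => /HZ.
have phiQ (z : 'cV[rat]_2) : polar V z = polar V' (phi_at w f z).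
  have HQ := mutation_polar_map (g := ratr) (ler_rat R) H (-1) z.
  by apply/allP/allP => /HQ.
have Vbound (r : 'cV[rat]_2) : r != 0 -> has (fun p => pr r p < 0) V.
  move=> r0; have [|p pV] := Vsp (map_mx ratr r); first by rewrite map_mx_eq0.
  by rewrite pr_map ltrq0 => rp; apply/hasP; exists p.
have [d [n [pt [Vpt [spc [[d0 spP] spcover faceP faceP']]]]]] :=
  point_selection wf Vbound phiV phiQ.
have lev_addw u : lev f (u + w) = lev f u by rewrite -[w in u + w]scale1r lev_w.
exists (family R[i] w (lev f) pt), (fam_pi R[i] w (lev f) pt); split.
- exact: (family_scheme R[i] (levD f) lev_addw (levMn f) spP spcover).
- exact: (family_flat R[i] (levD f) lev_addw (levMn f) spP spcover).
- exact: fam_projective.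
- have psiE u : psi w (lev f) false u = u by rewrite /psi scaler0 subr0.
  move=> b b0; apply: (polygon_fibre (eps := false) d0 spP spcover b0 PV (origin _ P_fano) Vsp).
  + by move=> i; rewrite psiE.
  + by move=> i u; rewrite psiE scaler0 addr0.
  + move=> z /faceP[i spi ziE]; exists i => // p pV; rewrite psiE; exact: ziE.
have psiE u : psi w (lev f) true u = phi w f u by [].
move=> a a0; apply: (polygon_fibre (eps := true) d0 spP spcover a0 PV' (origin _ P'_fano) Vsp').
- by move=> i; rewrite psiE -phiV.
- move=> i u; rewrite psiE (tangent_phi phiV _ (Vpt i)) dlev_w //.
  by rewrite addrK.
- move=> z /faceP'[i spi ziE]; exists i => // p pV; rewrite psiE; exact: ziE.
Qed.
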